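(* Let $d\ge1$ and $n\ge0$ be integers. Let $\phi,\psi_1,\dots,\psi_d\in C_b^{n}(\mathbb{R})$ be kernels of order $n+1$ with constant discrete moments, i.e. $m_r(\phi,u)$ and $m_r(\psi_i,u)$ do not depend on $u\in\mathbb{R}$ for $r=0,1,\dots,n+1$ and $i=1,\dots,d$, and such that for every $l=1,\dots,n$ the series $$\sum_{k\in\mathbb{Z}}|u-k|^{n+1}\,|\phi^{(l)}(u-k)|\quad\text{and}\quad\sum_{k\in\mathbb{Z}}|u-k|^{n+1}\,|\psi_i^{(l)}(u-k)|,\qquad i=1,\dots,d,$$ are uniformly convergent in $u\in\mathbb{R}$. Let $p\ge0$ be an integer and $\mathbf{q}\in\mathbb{Z}_+^d$ with $p+|\mathbf{q}|\le n$, and let $f\in C_b^{n+1}(\mathbb{R}\times\mathbb{R}^{d})$. Then, writing $N_{a,\mathbf{b}}=n-(p+|\mathbf{q}|-a-|\mathbf{b}|)$, for every $(x,\mathbf{y})\in\mathbb{R}\times\mathbb{R}^d$, $$\begin{aligned}&\lim_{w\to\infty}w^{n-(p+|\mathbf{q}|)+1}\big(\partial^{(p,\mathbf{q})}K_{n,w}^{\phi,\psi}f(x,\mathbf{y})-\partial^{(p,\mathbf{q})}f(x,\mathbf{y})\big)\\&=\sum_{a=0}^{p}\ \sum_{\mathbf{0}\le\mathbf{b}\le\mathbf{q}}\binom{p}{a}\binom{\mathbf{q}}{\mathbf{b}}\sum_{l+|\mathbf{j}|=N_{a,\mathbf{b}}+1}\frac{(-1)^{N_{a,\mathbf{b}}}}{l!\,\mathbf{j}!}\sum_{c=0}^{l}\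 \sum_{\mathbf{0}\le\mathbf{e}\le\mathbf{j}}\binom{l}{c}\binom{\mathbf{j}}{\mathbf{e}}\frac{m_c(\phi^{(a)})}{l-c+1}\prod_{i=1}^{d}\frac{m_{e_i}(\psi_i^{(b_i)})}{j_i-e_i+1}\ \partial^{(l+p-a,\ \mathbf{j}+\mathbf{q}-\mathbf{b})}f(x,\mathbf{y}),\end{aligned}$$ where $a,l,c\ge 0$ are integers, $\mathbf{b},\mathbf{j},\mathbf{e}\in\mathbb{Z}_+^d$, and $m_c(\phi^{(a)})$, $m_{e_i}(\psi_i^{(b_i)})$ denote the constant values of the discrete moments of the derivatives $\phi^{(a)}$, $\psi_i^{(b_i)}$.
   Context: Notation. For multi-indices in $\mathbb{Z}_+^d$ (non-negative integer entries): $|\mathbf{j}|=j_1+\dots+j_d$, $\mathbf{j}!=\prod_i j_i!$, $\mathbf{e}\le\mathbf{j}$ means $e_i\le j_i$ for all $i$, $\binom{\mathbf{j}}{\mathbf{e}}=\frac{\mathbf{j}!}{\mathbf{e}!(\mathbf{j}-\mathbf{e})!}$, and $\mathbf{x}^{\mathbf{j}}=\prod_i x_i^{j_i}$ for $\mathbf{x}\in\mathbb{R}^d$; $0^0=1$. Points of $\mathbb{R}\times\mathbb{R}^d$ are written $(x,\mathbf{y})$; $\partial^{(l,\mathbf{j})}f=\frac{\partial^{l+|\mathbf{j}|}f}{\partial x^l\partial y_1^{j_1}\cdots\partial y_d^{j_d}}$. Function spaces. $C_b^{m}(X)$ (for $X=\mathbb{R}$ or $X=\mathbb{R}\times\mathbb{R}^d$)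 is the space of $m$-times continuously differentiable real functions all of whose (partial) derivatives of order at most $m$ are bounded and continuous. Uniform convergence of moment series. For $g:\mathbb{R}\to\mathbb{R}$ and an integer $N\ge0$, the series $\sum_{k\in\mathbb{Z}}|u-k|^{N}|g(u-k)|$ is called uniformly convergent in $u\in\mathbb{R}$ if it converges for every $u$ and $\lim_{R\to\infty}\sup_{u\in\mathbb{R}}\sum_{k\in\mathbb{Z},\,|u-k|\ge R}|u-k|^{N}|g(u-k)|=0$. Kernels and moments. For $\chi:\mathbb{R}\to\mathbb{R}$, $\beta\ge0$ and integer $r\ge0$ put $M_\beta(\chi)=\sup_{u\in\mathbb{R}}\sum_{k\in\mathbb{Z}}|u-k|^{\beta}|\chi(u-k)|$ and $m_r(\chi,u)=\sum_{k\in\mathbb{Z}}(k-u)^{r}\chi(u-k)$; when $m_r(\chi,u)$ is independent of $u$ it is written $m_r(\chi)$. The function $\chi$ is a kernel of order $N$ if (i) $\sum_{k\in\mathbb{Z}}\chi(u-k)=1$ for every $u\in\mathbb{R}$; (ii) the series $\sum_{k\in\mathbb{Z}}|u-k|^{N}|\chi(u-k)|$ is uniformly convergent in $u\in\mathbb{R}$, i.e. it converges for every $u$ and $\lim_{R\to\infty}\sup_{u\in\mathbb{R}}\sum_{k\in\mathbb{Z},\,|u-k|\ge R}|u-k|^{N}|\chi(u-k)|=0$, and $M_\beta(\chi)<\infty$ for all $0\le\beta\le N$. (Under the hypotheses of the claim the moments $m_r(\phi^{(a)},u)$, $m_r(\psi_i^{(b)},u)$ with $0\le r\le n+1$, $0\le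 a,b\le n$ are also independent of $u$.) Operator. For $w>0$, $k\in\mathbb{Z}$, $\mathbf{m}\in\mathbb{Z}^d$ let $I_k^w=[\frac{k}{w},\frac{k+1}{w}]$ and $I_{\mathbf{m}}^w=\prod_{i=1}^d[\frac{m_i}{w},\frac{m_i+1}{w}]$. The Hermite-type sampling Kantorovich operator is $$K_{n,w}^{\phi,\psi}f(x,\mathbf{y})=\sum_{k\in\mathbb{Z}}\sum_{\mathbf{m}\in\mathbb{Z}^d}\phi(wx-k)\prod_{i=1}^d\psi_i(wy_i-m_i)\left(\sum_{l+|\mathbf{j}|\le n}\frac{1}{l!\,\mathbf{j}!}\,w^{d+1}\int_{I_k^w}\int_{I_{\mathbf{m}}^w}\frac{\partial^{l+|\mathbf{j}|}f(u,\mathbf{v})}{\partial u^l\partial\mathbf{v}^{\mathbf{j}}}(x-u)^l(\mathbf{y}-\mathbf{v})^{\mathbf{j}}\,d\mathbf{v}\,du\right),$$ where the inner sum is over integers $l\ge0$ and $\mathbf{j}\in\mathbb{Z}_+^d$. *)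

(* Defs.v *)
(* MathComp-Analysis; the reals are an arbitrary [R : realType]. *)
From HB Require Import structures.
From mathcomp Require Import all_boot all_order all_algebra.
From mathcomp Require Import all_classical all_reals all_analysis.

Set Implicit Arguments.
Unset Strict Implicit.
Unset Printing Implicit Defensive.

Import Order.TTheory GRing.Theory Num.Theory.
Import numFieldNormedType.Exports.

Local Open Scope ring_scope.
Local Open Scope classical_set_scope.

(* Multi-indices of Z_+^d are functions ['I_d -> nat]. Finite sums over
   multi-indices range over [{ffun 'I_d -> 'I_N}], for a bound N exceeding every
   entry that the summation condition allows, and [mi] forgets that bound. *)
Section multi_index.
Variable d : nat.

Definition mi N (j : {ffun 'I_d -> 'I_N}) : 'I_d -> nat := fun i => j i.

Definition mdeg (j : 'I_d -> nat) : nat := (\sum_i j i)%N.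

Definition mfact (j : 'I_d -> nat) : nat := (\prod_i (j i)`!)%N.

Definition mle (e j : 'I_d -> nat) : bool := [forall i, (e i <= j i)%N].

Definition mbin (R : realType) (j e : 'I_d -> nat) : R :=
  (mfact j)%:R / (mfact e * mfact (fun i => j i - e i)%N)%:R.

Definition mpow (R : realType) (y : 'rV[R]_d) (j : 'I_d -> nat) : R :=
  \prod_i y 0 i ^+ j i.

End multi_index.

(* Sum of an absolutely summable real family over a countable type, independent
   of any enumeration. The value is 0 if the positive or the negative part has
   an infinite sum. *)
Definition zsum (R : realType) (T : choiceType) (a : T -> R) : R :=
  fine (\esum_(i in [set: T]) (Num.max (a i) 0)%:E
        - \esum_(i in [set: T]) (Num.max (- a i) 0)%:E)%E.

Section partial_derivatives.
Variables (R : realType) (d : nat).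
Implicit Types (f : R * 'rV[R]_d -> R) (s : seq (option 'I_d)).

(* The coordinates of (x, y) are indexed by [option 'I_d]: [None] is x and
   [Some i] is y_i. *)
Definition dir (c : option 'I_d) : R * 'rV[R]_d :=
  if c is Some i then (0, delta_mx 0 i) else (1, 0).

(* The last coordinate of the list is differentiated first. *)
Fixpoint pderivs s f : R * 'rV[R]_d -> R :=
  if s is c :: s' then 'D_(dir c) (pderivs s' f) else f.

(* ['D_v] is total: this says that each limit taken in [pderivs s f] exists. *)
Fixpoint pderivable s f : Prop :=
  if s is c :: s' then
    pderivable s' f /\ forall z, derivable (pderivs s' f) z (dir c)
  else True.

(* d^l/dx^l d^(j_1)/dy_1^(j_1) ... d^(j_d)/dy_d^(j_d), in this order *)
Definition coords (l : nat) (j : 'I_d -> nat) : seq (option 'I_d) :=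
  nseq l None ++ flatten [seq nseq (j i) (Some i) | i <- enum 'I_d].

Definition partial (l : nat) (j : 'I_d -> nat) f := pderivs (coords l j) f.

(* C_b^m(R x R^d); mixed derivatives are taken in every possible order. *)
Definition Cb_prod (m : nat) f : Prop :=
  forall s, (size s <= m)%N ->
    [/\ pderivable s f, continuous (pderivs s f) & bounded_fun (pderivs s f)].

End partial_derivatives.

(* C_b^m(R) *)
Definition Cb_real (R : realType) (m : nat) (g : R -> R) : Prop :=
  (forall l, (l < m)%N -> forall x, derivable (g^`(l)) x 1) /\
  (forall l, (l <= m)%N -> continuous (g^`(l)) /\ bounded_fun (g^`(l))).

Section kernels.
Variable R : realType.
Implicit Types (g chi : R -> R).

Definition unif_conv (N : nat) g : Prop :=
  (forall u : R,
    \esum_(k in [set: int])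
      (`|u - k%:~R| ^+ N * `|g (u - k%:~R)|)%:E < +oo)%E /\
  ((fun r : R => ereal_sup
      [set (\esum_(k in [set k : int | (r <= `|u - k%:~R|)%R])
        (`|u - k%:~R| ^+ N * `|g (u - k%:~R)|)%:E)%E | u in [set: R]])
    @ +oo --> 0%E).

(* M_beta(chi); the convention 0^0 = 1 is that of [powR]. *)
Definition absmoment (beta : R) chi : \bar R :=
  ereal_sup [set (\esum_(k in [set: int])
    (`|u - k%:~R| `^ beta * `|chi (u - k%:~R)|)%:E)%E | u in [set: R]].

Definition dmoment (r : nat) chi (u : R) : R :=
  zsum (fun k : int => (k%:~R - u) ^+ r * chi (u - k%:~R)).

Definition const_moment (r : nat) chi : Prop :=
  forall u v : R, dmoment r chi u = dmoment r chi v.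

(* The value of a discrete moment that does not depend on u. *)
Definition moment (r : nat) chi : R := dmoment r chi 0.

Definition kernel_of_order (N : nat) chi : Prop :=
  [/\ forall u : R, zsum (fun k : int => chi (u - k%:~R)) = 1,
      unif_conv N chi &
      forall beta : R, 0 <= beta <= N%:R -> (absmoment beta chi < +oo)%E].

End kernels.

Section operator.
Variables (R : realType) (d : nat).

Definition set_coord (v : 'rV[R]_d) (i : 'I_d) (t : R) : 'rV[R]_d :=
  \row_j (if j == i then t else v 0 j).

(* Integral of g over the box prod_i [lo_i, hi_i], as an iterated Lebesgue
   integral; the base point 0 is irrelevant since every coordinate is
   overwritten. *)
Definition box_integral (lo hi : 'rV[R]_d) (g : 'rV[R]_d -> R) : R :=
  foldr (fun i (h : 'rV[R]_d -> R) v =>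
           \int[lebesgue_measure]_(t in `[lo 0 i, hi 0 i]) h (set_coord v i t))
        g (enum 'I_d) 0.

Definition kantorovich (n : nat) (phi : R -> R) (psi : 'I_d -> R -> R) (w : R)
    (f : R * 'rV[R]_d -> R) (z : R * 'rV[R]_d) : R :=
  zsum (fun k : int => zsum (fun m : {ffun 'I_d -> int} =>
    phi (w * z.1 - k%:~R) * (\prod_i psi i (w * z.2 0 i - (m i)%:~R)) *
    \sum_(l < n.+1)
      \sum_(j : {ffun 'I_d -> 'I_n.+1} | (l + mdeg (mi j) <= n)%N)
        (l`! * mfact (mi j))%:R^-1 *
        (w ^+ d.+1 *
         \int[lebesgue_measure]_(u in `[k%:~R / w, (k%:~R + 1) / w])
           box_integral (\row_i ((m i)%:~R / w)) (\row_i (((m i)%:~R + 1) / w))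
             (fun v => partial l (mi j) f (u, v) *
                       (z.1 - u) ^+ l * mpow (z.2 - v) (mi j))))).

End operator.

(* Main.v *)
Require Import Defs.
From HB Require Import structures.
From mathcomp Require Import all_boot all_order all_algebra.
From mathcomp Require Import all_classical all_reals all_analysis.
From mathcomp Require Import ring lra zify.

(** Write z = (x, y), index its coordinates by c, and let chi_c be the kernel
attached to the coordinate c. For a lattice point kappa let A_kappa be the mean
value over the cell of side 1/w with lower corner kappa / w, and let T_N g (u; z)
be the Taylor polynomial of degree N of g at u, evaluated at z. The operator is
  K f (z) = sum_kappa (prod_c chi_c (w z_c - kappa_c)) A_kappa [T_n f (.; z)],
so z occurs in the kernels and as the evaluation point of the polynomial.

Each partial derivative in z therefore falls on one of these two factors. On a
kernel it produces a factor w and one more derivative of chi_c. On the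
polynomial it turns T_{N+1} g (.; z) into T_N (d_c g) (.; z), because the term of
degree m in the displacement z - u becomes the term of degree m - 1 for d_c g
(avg_taylor_derive). Repeated differentiation is thus a Leibniz rule
(opseries_derive, opseries_pderivs, leibniz2E): the derivative of order (p, q) of
K f is the sum, over the decompositions J + I = (p, q) and with binomial
coefficients, of the series
  S(J, I) = w^|J| sum_kappa (prod_c chi_c^(J_c) (w z_c - kappa_c))
                            A_kappa [T_{n-|I|} (d^I f) (.; z)].
The uniform convergence of the moment series gives no summable majorant. It
gives bounds, uniform in the point, on the tails of the weighted kernel sums
(tame_unif_conv), and products of kernels inherit them (prod_weight_tail). That
is enough to differentiate the series term by term (is_derive_uniform_limit).

It remains to find the limit of one Leibniz term (series_limit). Put
N = n - |I| and g = d^I f. Together with w^|J| the available power of w is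
w^(N+1), and Lagrange's form of the remainder on the segment from u to z gives
  T_N g (u; z) = g(z) + (-1)^N / (N+1)! ((u - z) . nabla)^(N+1) g (v)
with v between z and u (taylor_Lagrange).
- The constant g(z) contributes g(z) times the product of the moments
  m_0(chi_c^(J_c)). Differentiating a constant moment shows that
  m_r(chi^(a+1)) = r m_{r-1}(chi^(a)) (kernel_moment_succ); so m_0 is 1 for a
  kernel and 0 for its derivatives. Hence only the term J = 0 has a constant
  part, and this part is the derivative of order (p, q) of f.
- Replace v by z in the remainder. The cell mean of a monomial of degree N + 1 in
  u - z, multiplied by w^(N+1), is a polynomial in kappa - w z (avg_monomial).
  Summed against the kernels it gives a combination of products of moments, and
  these do not depend on w. This is the limit.
- The error of replacing v by z is small on the cells near z, by continuity of
  the derivatives of order N + 1, and bounded relative to the weight elsewhere,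
  where the weighted kernel sum is a small tail (taylor_rem_bound). So the
  rescaled error tends to 0.
*)

Set Implicit Arguments.
Unset Strict Implicit.
Unset Printing Implicit Defensive.

Import Order.TTheory GRing.Theory Num.Theory.
Import numFieldNormedType.Exports.

Local Open Scope ring_scope.
Local Open Scope classical_set_scope.

(** * Derivatives along a line *)

Section line_calculus.
Variables (R : realType).

Lemma cvgn_ler (u : nat -> R) (l c : R) :
  u n @[n --> \oo] --> l -> (\forall n \near \oo, u n <= c) -> l <= c.
Proof.
move=> ul uc; rewrite -(cvg_lim _ ul)//; apply: limr_le => //.
exact: cvgP ul.
Qed.

(** The first-order expansion with remainder at most e |h|. This form is
multiplicative in h, so that increments can be estimated without dividing by h
and the case h = 0 needs no separate treatment. *)
Lemma is_derive_epsP (V : normedModType R) (f : V -> R) (x v : V) (l : R) :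
  is_derive x v f l <->
  forall e : R, 0 < e -> exists2 del : R, 0 < del &
    forall h : R, `|h| < del -> `|f (x + h *: v) - f x - h * l| <= e * `|h|.
Proof.
split=> [[dv <-] e e0|H].
  move: dv => /cvg_ex[/= l' cl'].
  have -> : 'D_v f x = l' by apply: cvg_lim.
  move/cvgrPdist_le: cl' => /(_ e e0) [del del0 Hd].
  exists del => // h hd; have [->|h0] := eqVneq h 0.
    by rewrite scale0r addr0 subrr mul0r subrr normr0 mulr0.
  have := Hd h; rewrite /ball_ /= sub0r normrN => /(_ hd h0).
  rewrite [h *: v + x]addrC distrC => H.
  have -> : f (x + h *: v) - f x - h * l' =
    h * (h^-1 * (f (x + h *: v) - f x) - l').
    by rewrite mulrBr mulrA divff// mul1r.
  by rewrite normrM mulrC ler_wpM2r.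
have C : (fun h => h^-1 *: ((f \o shift x) (h *: v) - f x)) @ 0^' --> l.
  apply/cvgrPdist_le => e e0; have [del del0 Hd] := H _ e0.
  exists del => // h; rewrite /ball_ /= sub0r normrN => hd h0.
  rewrite distrC [h *: v + x]addrC.
  have -> : h^-1 *: (f (x + h *: v) - f x) - l =
     h^-1 * (f (x + h *: v) - f x - h * l).
    by rewrite mulrBr mulrA mulVf// mul1r.
  rewrite normrM normfV ler_pdivrMl ?normr_gt0// [leRHS]mulrC.
  exact: Hd.
by apply: DeriveDef; [apply/cvg_ex; exists l|apply: cvg_lim].
Qed.

(** Directional derivatives are derivatives of a function of one variable, which
gives access to the mean value theorem and to Rolle's theorem in any normed
space. *)
Lemma is_derive_line (V : normedModType R) (f : V -> R) (x v : V) (t l : R) :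
  is_derive (x + t *: v) v f l <-> is_derive t (1:R) (fun s : R => f (x + s *: v)) l.
Proof.
split=> /is_derive_epsP H; apply/is_derive_epsP => e /H[del del0 Hd];
 exists del => // h hd; have := Hd h hd; by rewrite [_ *: 1]mulr1 scalerDl addrA.
Qed.

Lemma line0 (V : normedModType R) (x v : V) : x + (0 : R) *: v = x.
Proof. by rewrite scale0r addr0. Qed.

Lemma is_derive_line0 (V : normedModType R) (f : V -> R) (x v : V) (l : R) :
  is_derive (0:R) (1:R) (fun s : R => f (x + s *: v)) l -> is_derive x v f l.
Proof. by move=> H; have := (is_derive_line f x v 0 l).2 H; rewrite line0. Qed.

(** Stating the position of xi relative to a as a bound by |b - a| covers both
orders of a and b, so that increments of either sign are treated at once. *)
Lemma MVT_line (g dg : R -> R) (a b : R) :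
  (forall t : R, is_derive t (1:R) g (dg t)) ->
  exists2 xi, `|xi - a| <= `|b - a| & g b - g a = (b - a) * dg xi.
Proof.
move=> H.
have cg (A : set R) : {within A, continuous g}.
  apply: continuous_subspaceT => z; apply: differentiable_continuous.
  by apply/derivable1_diffP; have [] := H z.
have [ab|ba] := leP a b.
  have [c cab ->] := @MVT_segment R g dg a b ab (fun z _ => H z) (cg _).
  exists c; last by rewrite mulrC.
  move: cab; rewrite in_itv/= => /andP[ac cb].
  by rewrite !ger0_norm ?subr_ge0// lerB.
have [c cab E] := @MVT_segment R g dg b a (ltW ba) (fun z _ => H z) (cg _).
exists c; last by rewrite -opprB E mulrC -mulNr opprB.
move: cab; rewrite in_itv/= => /andP[ac cb].
by rewrite distrC [leRHS]distrC !ger0_norm ?subr_ge0// ?(ltW ba)// lerB.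
Qed.

Lemma MVT_dir (V : normedModType R) (f : V -> R) (x v : V) (t : R) :
  (forall z, derivable f z v) ->
  exists2 xi : R, `|xi| <= `|t| & f (x + t *: v) - f x = t * 'D_v f (x + xi *: v).
Proof.
move=> H.
have [|xi] := @MVT_line (fun s => f (x + s *: v)) (fun s => 'D_v f (x + s *: v)) 0 t.
  by move=> s; apply: (is_derive_line f x v s _).1; exact/derivableP/H.
by rewrite !subr0 scale0r addr0 => xit E; exists xi.
Qed.

(** With h_m the m-th derivative of a function, this is Taylor's formula expanded
at the right end point 1 and evaluated at 0. The function
F(t) = sum_m (-t)^m h_m(t) / m! interpolates between h_0(0) and the left-hand
side, and its derivative telescopes to (-t)^N h_{N+1}(t) / N!; the Lagrange form
comes from Rolle's theorem applied to F(t) - t^(N+1) (F(1) - F(0)). *)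
Lemma Taylor_Lagrange (N : nat) (h : nat -> R -> R) :
  (forall m (t : R), (m <= N)%N -> is_derive t (1:R) (h m) (h m.+1 t)) ->
  exists2 xi : R, 0 <= xi <= 1 &
    \sum_(m < N.+1) (-1) ^+ m * h m 1 / m`!%:R =
    h 0%N 0 + (-1) ^+ N * h N.+1 xi / N.+1`!%:R.
Proof.
move=> H.
pose F M t := \sum_(m < M.+1) (- t) ^+ m * h m t / m`!%:R.
have dF M t : (M <= N)%N -> is_derive t (1:R) (F M) ((- t) ^+ M * h M.+1 t / M`!%:R).
  elim: M => [|M IH] MN.
    have -> : F 0%N = h 0%N.
      by apply/funext => s; rewrite /F big_ord1 expr0 mul1r fact0 invr1 mulr1.
    by rewrite expr0 mul1r fact0 invr1 mulr1; apply: H.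
  have -> : F M.+1 = F M \+ (fun t => (- t) ^+ M.+1 * h M.+1 t / M.+1`!%:R).
    by apply/funext => s; rewrite /F big_ord_recr.
  have dd := IH (ltnW MN); have dh := H _ t MN.
  have -> : (fun t => (- t) ^+ M.+1 * h M.+1 t / M.+1`!%:R) =
    (M.+1`!%:R^-1) *: (((-%R : R -> R) ^+ M.+1) * h M.+1).
    apply/funext => s; rewrite mulrC; congr (_ * (_ * _)).
    by elim: (M.+1) => [|k IHk]; rewrite ?expr0// !exprS IHk.
  apply: is_derive_eq.
  have E : (-%R ^+ M.+1 : R -> R) t = (- t) ^+ M.+1.
    by elim: (M.+1) => [|k IHk]; rewrite ?expr0// !exprS -IHk.
  rewrite E /= factS natrM invfM /GRing.scale/=.
  set x := M.+1%:R; set y := M`!%:R.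
  have x0 : x != 0 :> R by rewrite pnatr_eq0.
  have y0 : y != 0 :> R by rewrite pnatr_eq0 -lt0n fact_gt0.
  clearbody x y; field; by rewrite x0 y0.
(* Phi takes the value F(0) at both ends of [0, 1]. *)
pose Phi t := F N t - t ^+ N.+1 * (F N 1 - F N 0).
have dPhi t : is_derive t (1:R) Phi ((- t) ^+ N * h N.+1 t / N`!%:R - N.+1%:R * t ^+ N * (F N 1 - F N 0)).
  have dd := dF N t (leqnn _).
  have -> : Phi = F N \- (F N 1 - F N 0) *: (id ^+ N.+1).
    apply/funext => s /=; rewrite /Phi mulrC; congr (_ - _ * _).
    by elim: (N.+1) => [|k IHk]; rewrite ?expr0// !exprS IHk.
  apply: is_derive_eq.
  rewrite /GRing.scale/=; ring.
have cPhi : {within `[0, 1], continuous Phi}.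
  apply: continuous_subspaceT => z; apply: differentiable_continuous.
  by apply/derivable1_diffP; have [] := dPhi z.
have [||xi xi01 dxi] := @Rolle R Phi 0 1 ltr01 _ cPhi.
- by move=> x _; have [] := dPhi x.
- by rewrite /Phi expr0n/= mul0r subr0 expr1n mul1r subKr.
move: xi01; rewrite in_itv/= => /andP[xi0 xi1].
exists xi; first by rewrite !ltW.
have := dPhi xi; move=> [_ D1]; case: dxi => _ D2; move: D1; rewrite D2 => /eqP.
rewrite eq_sym subr_eq0 => /eqP E.
have F1 : F N 1 = \sum_(m < N.+1) (-1) ^+ m * h m 1 / m`!%:R by [].
have F0 : F N 0 = h 0%N 0.
  rewrite /F big_ord_recl big1 ?addr0; last by move=> i _; rewrite oppr0 expr0n/= !mul0r.
  by rewrite expr0 mul1r fact0 divr1.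
rewrite -F1 -F0; move: E; rewrite [(- xi) ^+ N]exprNn factS natrM.
have a0 : xi ^+ N != 0 by rewrite expf_neq0 ?gt_eqF.
have x0 : N.+1%:R != 0 :> R by rewrite pnatr_eq0.
have y0 : N`!%:R != 0 :> R by rewrite pnatr_eq0 -lt0n fact_gt0.
move: (F N 1) (F N 0) (xi ^+ N) (N.+1%:R : R) (N`!%:R : R) (h N.+1 xi) ((-1) ^+ N : R) a0 x0 y0.
move=> X Y a x y k s a0 x0 y0 E.
apply: (mulfI (mulf_neq0 x0 a0)).
have -> : x * a * X = x * a * (X - Y) + x * a * Y by ring.
by rewrite -E; field; rewrite x0 y0.
Qed.

(** Termwise differentiation. The mean value theorem applied to S_N - S_{N0}
transfers the uniform Cauchy estimate from the derivatives to the difference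
quotients. Uniformity is asked only near x, because the tails of the sampling
series are uniform only for bounded arguments. *)
Lemma is_derive_uniform_limit (S dS : nat -> R -> R) (s g : R -> R) (x : R) :
  (forall N (t : R), is_derive t (1:R) (S N) (dS N t)) ->
  (forall t, S N t @[N --> \oo] --> s t) ->
  (forall t, dS N t @[N --> \oo] --> g t) ->
  (forall e : R, 0 < e -> exists N0, forall N (t : R), (N0 <= N)%N -> `|t - x| <= 1 ->
     `|dS N t - dS N0 t| <= e) ->
  is_derive x (1:R) s (g x).
Proof.
move=> dd cS cdS uS; apply/is_derive_epsP => e e0.
have e40 : 0 < e / 4 by lra.
have [N0 HN0] := uS _ e40.
have [del del0 Hd] := (is_derive_epsP _ _ _ _).1 (dd N0 x) _ e40.
exists (Num.min del 1); first by rewrite lt_min del0 ltr01.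
move=> h; rewrite lt_min => /andP[hd h1]; rewrite [_ *: 1]mulr1.
have := Hd h hd; rewrite [_ *: 1]mulr1 => H0.
have H1 : `|(s (x + h) - s x) - (S N0 (x + h) - S N0 x)| <= e / 4 * `|h|.
  have C : `|(S N (x + h) - S N x) - (S N0 (x + h) - S N0 x)| @[N --> \oo] -->
     `|(s (x + h) - s x) - (S N0 (x + h) - S N0 x)|.
    apply: cvg_norm; apply: cvgB; last exact: cvg_cst.
    by apply: cvgB; apply: cS.
  apply: (cvgn_ler C).
  near=> N.
  have := @MVT_line (S N \- S N0) (dS N \- dS N0) x (x + h).
  have dB (t : R) : is_derive t (1:R) (S N \- S N0) ((dS N \- dS N0) t).
    by have := dd N t; have := dd N0 t => ? ?; apply: is_deriveB.
  case/(_ dB) => xi.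
  rewrite addrAC subrr add0r /= => xih E.
  have -> : S N (x + h) - S N x - (S N0 (x + h) - S N0 x) =
     S N (x + h) - S N0 (x + h) - (S N x - S N0 x) by ring.
  rewrite E normrM mulrC ler_wpM2r//; apply: HN0.
    by near: N; exists N0.
  by rewrite (le_trans xih)// ltW.
have H2 : `|g x - dS N0 x| <= e / 4.
  have C : `|dS N x - dS N0 x| @[N --> \oo] --> `|g x - dS N0 x|.
    by apply: cvg_norm; apply: cvgB; [exact: cdS|exact: cvg_cst].
  apply: (cvgn_ler C).
  near=> N; apply: HN0; first by near: N; exists N0.
  by rewrite subrr normr0.
have -> : s (x + h) - s x - h * g x =
  (s (x + h) - s x - (S N0 (x + h) - S N0 x)) +
  (S N0 (x + h) - S N0 x - h * dS N0 x) - h * (g x - dS N0 x) by ring.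
have H3 : `|h * (g x - dS N0 x)| <= e / 4 * `|h|.
  by rewrite normrM mulrC ler_wpM2r.
apply: (le_trans (ler_normB _ _)).
have := ler_normD (s (x + h) - s x - (S N0 (x + h) - S N0 x)) (S N0 (x + h) - S N0 x - h * dS N0 x).
have := normr_ge0 h; have := mulr_ge0 (ltW e0) (normr_ge0 h).
set a := e * _.
have E : e / 4 * `|h| = a / 4 by rewrite /a; ring.
rewrite E in H0 H1 H3.
lra.
Unshelve. all: by end_near.
Qed.

(** Schwarz's theorem. The second difference of f over the parallelogram with
sides t u and t v equals t^2 times a value of either mixed derivative near z, by
two applications of the mean value theorem in either order. *)
Lemma derive_swap (V : normedModType R) (f : V -> R) (u v : V) :
  (forall z, derivable f z u) -> (forall z, derivable f z v) ->
  (forall z, derivable ('D_u f) z v) -> (forall z, derivable ('D_v f) z u) ->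
  continuous ('D_u ('D_v f)) -> continuous ('D_v ('D_u f)) ->
  'D_u ('D_v f) = 'D_v ('D_u f).
Proof.
move=> du dv duv dvu cuv cvu; apply/funext => z; apply/eqP.
rewrite -subr_eq0 -normr_eq0 eq_le normr_ge0 andbT.
apply/ler_addgt0Pr => e e0; rewrite add0r.
have e20 : 0 < e / 2 by lra.
(* The mean value theorem in direction a, for the increment of f in direction b,
   and then in direction b for the derivative. *)
have key (a b : V) : (forall z, derivable f z a) -> (forall z, derivable ('D_a f) z b) ->
    continuous ('D_b ('D_a f)) -> exists2 del : R, 0 < del & forall t : R, 0 < t < del ->
      `|f (z + t *: a + t *: b) - f (z + t *: a) - f (z + t *: b) + f z - t ^+ 2 * 'D_b ('D_a f) z| <= t ^+ 2 * (e / 2).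
  move=> da dab cba.
  have /cvgrPdist_le/(_ _ e20)/nbhs_ballP[r /= r0 Hr] := cba z.
  exists (r / (`|a| + `|b| + 1)); first by rewrite divr_gt0// ltr_wpDl// addr_ge0.
  move=> t /andP[t0]; rewrite ltr_pdivlMr ?ltr_wpDl ?addr_ge0// => tr.
  have dg (s : R) : is_derive s (1:R) (fun s => f (z + t *: b + s *: a) - f (z + s *: a))
      ('D_a f (z + t *: b + s *: a) - 'D_a f (z + s *: a)).
    have h1 := (is_derive_line f (z + t *: b) a s _).1 (derivableP (da _)).
    have h2 := (is_derive_line f z a s _).1 (derivableP (da _)).
    exact: is_deriveB.
  have [xi] := MVT_line 0 t dg.
  rewrite !subr0 !scale0r !addr0 => xit E.
  have [eta etat E2] := MVT_dir (z + xi *: a) t dab.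
  have -> : f (z + t *: a + t *: b) - f (z + t *: a) - f (z + t *: b) + f z =
     t ^+ 2 * 'D_b ('D_a f) (z + xi *: a + eta *: b).
    rewrite expr2 -mulrA -E2 -[z + xi *: a + t *: b]addrAC -E.
    rewrite -[z + t *: a + t *: b]addrAC; ring.
  rewrite -mulrBr normrM ger0_norm ?exprn_ge0 ?(ltW t0)//.
  rewrite ler_wpM2l ?exprn_ge0 ?(ltW t0)// distrC; apply: Hr.
  rewrite -ball_normE /ball_/= opprD addrA opprD addrA subrr sub0r -opprD normrN.
  apply: le_lt_trans tr; apply: (le_trans (ler_normD _ _)); rewrite !normrZ.
  move: xit etat; rewrite (ger0_norm (ltW t0)) => xit etat.
  rewrite mulrDr mulrDr mulr1 -addrA; apply: lerD; first by rewrite ler_wpM2r.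
  by apply: (@le_trans _ _ (t * `|b|)); [rewrite ler_wpM2r|rewrite lerDl ltW].
have [d1 d10 H1] := key v u dv dvu cuv.
have [d2 d20 H2] := key u v du duv cvu.
pose t := Num.min d1 d2 / 2.
have t0 : 0 < t by rewrite divr_gt0// lt_min d10.
have tm : t < Num.min d1 d2.
  by rewrite /t ltr_pdivrMr// ltr_pMr ?ltr1n// lt_min d10.
move: tm; rewrite lt_min => /andP[td1 td2].
have := H1 t; rewrite t0 td1 => /(_ isT) {}H1.
have := H2 t; rewrite t0 td2 => /(_ isT) {}H2.
have tt : 0 < t ^+ 2 by rewrite exprn_gt0.
rewrite -(ler_pM2l tt) -[X in X * _](ger0_norm (ltW tt)) -normrM.
move: H1 H2; rewrite [z + t *: v + t *: u]addrAC.
move: ('D_u ('D_v f) z) ('D_v ('D_u f) z) => X Y.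
move: (f (z + t *: u + t *: v)) (f (z + t *: v)) (f (z + t *: u)) (f z).
move=> A B C D H1 H2.
have -> : t ^+ 2 * (X - Y) =
   (A - C - B + D - t ^+ 2 * Y) - (A - B - C + D - t ^+ 2 * X) by ring.
apply: (le_trans (ler_normB _ _)).
have -> : t ^+ 2 * e = t ^+ 2 * (e / 2) + t ^+ 2 * (e / 2) by field.
exact: lerD.
Qed.

(** Continuous partial derivatives make f differentiable along every combination
of the directions: the increment is split into one step per direction, and the
mean value theorem is applied to each step. *)
Lemma is_derive_chain (V : normedModType R) (I : eqType) (L : seq I) (e : I -> V)
  (a : I -> R) (f : V -> R) (z : V) :
  (forall i z, derivable f z (e i)) -> (forall i, continuous ('D_(e i) f)) ->
  is_derive z (\sum_(i <- L) a i *: e i) f (\sum_(i <- L) a i * 'D_(e i) f z).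
Proof.
move=> df cf; elim: L => [|i L IH].
  rewrite !big_nil; apply/is_derive_epsP => eps e0; exists 1 => // h _.
  by rewrite scaler0 addr0 subrr mulr0 subrr normr0 mulr_ge0// ltW.
rewrite !big_cons; set v := \sum_(j <- L) _; set l := \sum_(j <- L) (a j * _).
have {}IH : is_derive z v f l := IH.
apply/is_derive_epsP => eps e0.
pose m : R := `|a i| + 1.
have m0 : 0 < m by rewrite ltr_wpDl.
have e20 : 0 < eps / 2 by lra.
have e2m : 0 < eps / 2 / m by rewrite divr_gt0.
have [d1 d10 H1] := (is_derive_epsP _ _ _ _).1 IH _ e20.
have /cvgrPdist_le/(_ _ e2m)/nbhs_ballP[r /= r0 Hr] := cf i z.
pose M : R := `|a i| * `|e i| + `|v| + 1.
have M0 : 0 < M by rewrite ltr_wpDl// addr_ge0// mulr_ge0.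
exists (Num.min d1 (r / M)); first by rewrite lt_min d10 divr_gt0.
move=> h; rewrite lt_min ltr_pdivlMr// => /andP[hd1 hr].
have [xi xih E] := MVT_dir (z + h *: v) (h * a i) (df i).
have -> : z + h *: (a i *: e i + v) = z + h *: v + (h * a i) *: e i.
  by rewrite scalerDr scalerA [_ + h *: v]addrC addrA.
have -> : f (z + h *: v + (h * a i) *: e i) - f z - h * (a i * 'D_(e i) f z + l) =
  (f (z + h *: v) - f z - h * l) +
  h * a i * ('D_(e i) f (z + h *: v + xi *: e i) - 'D_(e i) f z).
  by rewrite mulrBr -E; ring.
apply: (le_trans (ler_normD _ _)).
have -> : eps * `|h| = eps / 2 * `|h| + eps / 2 * `|h| by field.
apply: lerD; first exact: H1.
rewrite normrM (_ : eps / 2 * `|h| = `|h| * m * (eps / 2 / m)); last first.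
  by field; rewrite gt_eqF.
rewrite normrM ler_pM ?mulr_ge0//.
  by rewrite ler_wpM2l// lerDl.
rewrite distrC; apply: Hr.
rewrite -ball_normE /ball_/= opprD addrA opprD addrA subrr sub0r -opprD normrN.
apply: le_lt_trans hr; apply: (le_trans (ler_normD _ _)); rewrite !normrZ.
apply: (@le_trans _ _ (`|h| * `|v| + `|h| * `|a i| * `|e i|)).
  by rewrite lerD2l ler_wpM2r// -normrM.
by rewrite /M !mulrDr mulr1 mulrA addrC lerDl.
Qed.

Lemma is_derive_bigsum (V : normedModType R) (I : Type) (r : seq I)
  (F : I -> V -> R) (dF : I -> R) (z v : V) :
  (forall i, is_derive z v (F i) (dF i)) ->
  is_derive z v (fun s => \sum_(i <- r) F i s) (\sum_(i <- r) dF i).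
Proof.
move=> H; elim: r => [|i r IH].
  rewrite big_nil (_ : (fun _ => _) = cst 0); first exact: is_derive_cst.
  by apply/funext => s; rewrite big_nil.
rewrite big_cons (_ : (fun _ => _) = F i \+ (fun s => \sum_(j <- r) F j s)).
  exact: is_deriveD.
by apply/funext => s; rewrite big_cons.
Qed.

Lemma is_derive_mul (V : normedModType R) (f g : V -> R) (z v : V) (a b : R) :
  is_derive z v f a -> is_derive z v g b ->
  is_derive z v (fun s => f s * g s) (f z * b + g z * a).
Proof. by move=> fa gb; exact: is_deriveM. Qed.

Lemma is_derive_scale (V : normedModType R) (F : V -> R) (k dF : R) (z v : V) :
  is_derive z v F dF -> is_derive z v (fun s => k * F s) (k * dF).
Proof. by move=> H; exact: is_deriveZ. Qed.

End line_calculus.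

Lemma big_option (A : Type) (idx : A) (op : Monoid.com_law idx) (T : finType)
  (F : option T -> A) :
  \big[op/idx]_(c : option T) F c = op (F None) (\big[op/idx]_(i : T) F (Some i)).
Proof.
rewrite (bigD1 None)//=; congr (op _ _).
rewrite (reindex_omap Some id) => [|[i|]]//=.
by apply: eq_bigl => i; rewrite eqxx.
Qed.

Lemma continuous_epsP (R : realType) (V : normedModType R) (f : V -> R) :
  continuous f <-> forall (z : V) (e : R), 0 < e -> exists2 del : R, 0 < del &
    forall z', `|z' - z| < del -> `|f z' - f z| < e.
Proof.
split=> [cf z e e0|H z].
  have /cvgrPdist_lt/(_ _ e0)/nbhs_ballP[r /= r0 Hr] := cf z.
  exists r => // z' zz'; rewrite distrC; apply: Hr.
  by rewrite -ball_normE /ball_/= distrC.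
apply/cvgrPdist_lt => e e0; have [r r0 Hr] := H z e e0.
apply/nbhs_ballP; exists r => // z'.
rewrite -ball_normE /ball_/= distrC => /Hr; by rewrite distrC.
Qed.

Lemma continuous_bigsum (R : realType) (T : topologicalType) (I : Type) (r : seq I)
  (F : I -> T -> R) :
  (forall i, continuous (F i)) -> continuous (fun x => \sum_(i <- r) F i x).
Proof.
move=> H; elim: r => [|i r IH] x.
  rewrite (_ : (fun _ => _) = cst 0); first exact: cvg_cst.
  by apply/funext => y; rewrite big_nil.
rewrite (_ : (fun _ => _) = F i \+ (fun y => \sum_(j <- r) F j y)).
  by apply: continuousD; [exact: H|exact: IH].
by apply/funext => y; rewrite big_cons.
Qed.

(** * Partial derivatives and the Taylor polynomial in several variables *)

Section several_variables.
Variables (R : realType) (d : nat).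
Local Notation Z := (R * 'rV[R]_d)%type.
Local Notation O := (option 'I_d).
Implicit Types (g f : Z -> R) (c : O).

Definition pcoord (z : Z) c : R := if c is Some i then z.2 0 i else z.1.

Lemma pcoordD z z' c : pcoord (z + z') c = pcoord z c + pcoord z' c.
Proof. by case: c => [i|]//=; rewrite mxE. Qed.

Lemma pcoordN z c : pcoord (- z) c = - pcoord z c.
Proof. by case: c => [i|]//=; rewrite mxE. Qed.

Lemma pcoordB z z' c : pcoord (z - z') c = pcoord z c - pcoord z' c.
Proof. by rewrite pcoordD pcoordN. Qed.

Lemma pcoordZ (a : R) z c : pcoord (a *: z) c = a * pcoord z c.
Proof. by case: c => [i|]//=; rewrite mxE. Qed.

Lemma pcoord_dir c c' : pcoord (dir R c) c' = (c' == c)%:R.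
Proof. by case: c c' => [i|] [j|]//=; rewrite mxE// eqxx. Qed.

Lemma pcoord_ext (z z' : Z) : pcoord z =1 pcoord z' -> z = z'.
Proof.
case: z z' => [x y] [x' y'] E; congr (_, _); first exact: (E None).
by apply/rowP => i; have := E (Some i).
Qed.

Lemma pcoord_sum (I : Type) (r : seq I) (F : I -> Z) c :
  pcoord (\sum_(i <- r) F i) c = \sum_(i <- r) pcoord (F i) c.
Proof.
elim: r => [|i r IH]; last by rewrite !big_cons pcoordD IH.
by rewrite !big_nil; case: c => [i|]//=; rewrite mxE.
Qed.

Lemma pcoord_decomp (z : Z) : z = \sum_c pcoord z c *: dir R c.
Proof.
apply: pcoord_ext => c; rewrite pcoord_sum (bigD1 c)//= pcoordZ pcoord_dir eqxx mulr1.
rewrite big1 ?addr0// => c' c'c; rewrite pcoordZ pcoord_dir eq_sym (negbTE c'c).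
by rewrite mulr0.
Qed.

Lemma pcoord_le_norm (z : Z) c : `|pcoord z c| <= `|z|.
Proof.
rewrite prod_normE; case: c => [i|] /=; rewrite le_max ?lexx//.
apply/orP; right; rewrite [leRHS]/Num.norm/= mx_normrE.
apply: (le_trans _ (le_bigmax_cond _ (fun ij => `|z.2 ij.1 ij.2|) (j := (ord0, i)) _)) => //=.
Qed.

Lemma norm_lt_pcoord (z : Z) (e : R) : 0 < e -> (forall c, `|pcoord z c| < e) -> `|z| < e.
Proof.
move=> e0 H; rewrite prod_normE gt_max (H None)/=.
rewrite /Num.norm/= mx_normrE; apply/bigmax_ltP; split => // -[i j] _ /=.
by rewrite ord1; exact: (H (Some j)).
Qed.

Lemma continuous_pcoord c : continuous (pcoord^~ c : Z -> R).
Proof.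
apply/(@continuous_epsP R Z) => z e e0; exists e => // z' zz'.
by rewrite -pcoordB; exact: le_lt_trans (pcoord_le_norm _ _) zz'.
Qed.

Lemma pderivs_cat (s1 s2 : seq O) f : pderivs (s1 ++ s2) f = pderivs s1 (pderivs s2 f).
Proof. by elim: s1 => //= c s1 ->. Qed.

Lemma pderivable_cat (s1 s2 : seq O) f : pderivable (s1 ++ s2) f <->
  pderivable s2 f /\ pderivable s1 (pderivs s2 f).
Proof.
elim: s1 => [|c s1 IH] /=; first by split=> [|[]].
rewrite pderivs_cat; split=> [[/IH[? ?] ?]|[? [? ?]]]; split=> //.
by apply/IH.
Qed.

Lemma Cb_prodW m m' f : (m' <= m)%N -> Cb_prod m f -> Cb_prod m' f.
Proof. by move=> mm H s sm; apply: H; apply: leq_trans mm. Qed.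

Lemma Cb_prod_continuous m f : Cb_prod m f -> continuous f.
Proof. by move=> /(_ [::] isT)[]. Qed.

Lemma Cb_prod_derivable m f c z : Cb_prod m.+1 f -> derivable f z (dir R c).
Proof. by move=> /(_ [:: c] isT)[[_ /(_ z)]]. Qed.

Lemma Cb_prod_derive m f c : Cb_prod m.+1 f -> Cb_prod m ('D_(dir R c) f).
Proof.
move=> H s sm; have : (size (rcons s c) <= m.+1)%N by rewrite size_rcons.
move=> /H; rewrite -cats1 pderivs_cat => -[/pderivable_cat[_ ?] ? ?].
by split.
Qed.

Lemma Cb_prod_pderivs m s f : Cb_prod (size s + m) f -> Cb_prod m (pderivs s f).
Proof.
elim/last_ind: s f => [|s c IH] f//=; rewrite size_rcons addSn => H.
by rewrite -cats1 pderivs_cat; apply: IH; apply: Cb_prod_derive.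
Qed.

Lemma Cb_prod_swap f c c' : Cb_prod 2 f ->
  'D_(dir R c) ('D_(dir R c') f) = 'D_(dir R c') ('D_(dir R c) f).
Proof.
move=> H; apply: derive_swap.
- by move=> z; exact: Cb_prod_derivable H.
- by move=> z; exact: Cb_prod_derivable H.
- by move=> z; apply: Cb_prod_derivable; apply: Cb_prod_derive H.
- by move=> z; apply: Cb_prod_derivable; apply: Cb_prod_derive H.
- by have [] := H [:: c; c'] isT.
- by have [] := H [:: c'; c] isT.
Qed.

Lemma pderivs_front m f s1 s2 c : Cb_prod m f -> (size s1 + size s2 < m)%N ->
  pderivs (s1 ++ c :: s2) f = pderivs (c :: s1 ++ s2) f.
Proof.
move=> H; elim: s1 => //= c1 s1 IH sm.
rewrite (IH (ltnW sm)); apply: Cb_prod_swap.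
apply: Cb_prod_pderivs; apply: Cb_prodW H; rewrite size_cat; lia.
Qed.

(** By Schwarz's theorem an iterated partial derivative depends only on the number
of times that each coordinate occurs. Iterated derivatives can therefore be
treated as lists when they are differentiated and as multi-indices when they are
counted. *)
Lemma pderivs_perm m f s1 s2 : Cb_prod m f -> (size s1 <= m)%N -> perm_eq s1 s2 ->
  pderivs s1 f = pderivs s2 f.
Proof.
move=> H; elim: s1 s2 => [|c s1 IH] s2 sm.
  by rewrite perm_sym => /perm_nilP ->.
move=> pe; have cs2 : c \in s2 by rewrite -(perm_mem pe) mem_head.
case/splitPr: cs2 pe => t1 t2 pe.
have ps : perm_eq s1 (t1 ++ t2).
  by rewrite -(perm_cons c) (perm_trans pe)//; apply/permPl; exact: (perm_catCA t1 [:: c] t2).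
rewrite (pderivs_front (m := m))//=; last first.
  by rewrite -size_cat -(perm_size ps).
by rewrite (IH _ _ ps)// ltnW.
Qed.

(** The m-th differential ((h . nabla)^m g)(p). Recursion on m replaces multinomial
coefficients by a sum over one coordinate at a time, which is how differentiation
acts on it; the multinomial form is dirpow_partial. *)
Fixpoint dirpow (m : nat) g (p : Z) (h : O -> R) : R :=
  if m is m'.+1 then \sum_c h c * dirpow m' ('D_(dir R c) g) p h else g p.

Lemma dirpowS m g p h :
  dirpow m.+1 g p h = \sum_c h c * dirpow m ('D_(dir R c) g) p h.
Proof. by []. Qed.

Lemma dirpowN m g p h : dirpow m g p (fun c => - h c) = (-1) ^+ m * dirpow m g p h.
Proof.
elim: m g => [|m IH] g /=; first by rewrite mul1r.
rewrite mulr_sumr; apply: eq_bigr => c _; rewrite IH exprS; ring.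
Qed.

Lemma dirpow_continuous m g z : Cb_prod m g ->
  continuous (fun p => dirpow m g p (pcoord (z - p))).
Proof.
elim: m g => [|m IH] g H /=; first exact: Cb_prod_continuous H.
apply: (@continuous_bigsum R Z) => c p; apply: (@continuousM R Z); last first.
  by apply: IH; apply: Cb_prod_derive.
have -> : (fun p => pcoord (z - p) c) = (fun p => pcoord z c - pcoord p c).
  by apply/funext => q; rewrite pcoordB.
by apply: (@continuousB R R Z); [exact: cvg_cst|exact: continuous_pcoord].
Qed.

(** The derivative with respect to h_c of the form (h . nabla)^m g is
m (h . nabla)^(m-1) d_c g: the form is symmetric because partial derivatives
commute. *)
Lemma is_derive_dirpow m g p (h : R -> O -> R) c (t : R) : Cb_prod m g ->
  (forall c', is_derive t (1:R) (fun s => h s c') (c' == c)%:R) ->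
  is_derive t (1:R) (fun s => dirpow m g p (h s))
    (m%:R * dirpow m.-1 ('D_(dir R c) g) p (h t)).
Proof.
move=> + dh; elim: m g => [|m IH] g H.
  by rewrite mul0r; exact: is_derive_cst.
have D c' := is_derive_mul (dh c') (IH _ (Cb_prod_derive c' H)).
apply: is_derive_eq (is_derive_bigsum _ D) _.
rewrite big_split/= [X in _ + X](bigD1 c)//= eqxx mulr1 [X in _ + (_ + X)]big1 ?addr0.
  rewrite -natr1 mulrDl mul1r; congr (_ + _).
  case: m H {IH D} => [|m] H; first by rewrite mul0r big1// => i _; rewrite mul0r mulr0.
  rewrite [m.+1.-1]/= dirpowS mulr_sumr; apply: eq_bigr => c' _.
  have H2 : Cb_prod 2 g by apply: Cb_prodW H.
  have E := Cb_prod_swap c c' H2.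
  apply: (etrans (congr1 (fun G => h t c' * (m.+1%:R * dirpow m G p (h t))) E)).
  exact: mulrCA.
by move=> i /negbTE ->; rewrite mulr0.
Qed.

Lemma is_derive_dirpow_line m g (z v : Z) (t : R) : Cb_prod m.+1 g ->
  is_derive t (1:R) (fun s => dirpow m g (z + s *: v) (pcoord v))
    (dirpow m.+1 g (z + t *: v) (pcoord v)).
Proof.
elim: m g => [|m IH] g H.
  apply: (is_derive_line g z v t _).1; rewrite {2}[v]pcoord_decomp.
  apply: is_derive_chain => [c z'|c]; first exact: Cb_prod_derivable H.
  exact: Cb_prod_continuous (Cb_prod_derive c H).
apply: is_derive_bigsum => c.
apply: is_derive_eq (is_derive_mul (is_derive_cst (pcoord v c) t 1) (IH _ (Cb_prod_derive c H))) _.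
by rewrite /= mulr0 addr0.
Qed.

(** The Taylor polynomial of degree N of g at p, at the displacement h. *)
Definition taylor N g p h := \sum_(m < N.+1) dirpow m g p h / m`!%:R.

(** Expanding at p and evaluating at z, instead of the usual converse, turns the
remainder into a correction to g(z) in which (p - z) occurs only to the power
N + 1. *)
Lemma taylor_Lagrange N g (z p : Z) : Cb_prod N.+1 g ->
  exists2 xi : R, 0 <= xi <= 1 &
    taylor N g p (pcoord (z - p)) = g z +
      (-1) ^+ N * dirpow N.+1 g (z + xi *: (p - z)) (pcoord (p - z)) / N.+1`!%:R.
Proof.
move=> H.
have [|xi xi01 E] := @Taylor_Lagrange R N (fun m s => dirpow m g (z + s *: (p - z)) (pcoord (p - z))).
  by move=> m t mN; apply: is_derive_dirpow_line; apply: Cb_prodW H.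
exists xi => //; move: E; rewrite [dirpow 0 _ _ _]/= scale0r addr0 => <-.
apply: eq_bigr => m _; rewrite scale1r subrKC -dirpowN; congr (dirpow _ _ _ _ / _).
by apply/funext => c; rewrite -pcoordN opprB.
Qed.

Definition dbound m g (C : R) := forall s, (size s <= m)%N -> forall z, `|pderivs s g z| <= C.

Lemma dboundW m m' g C : (m' <= m)%N -> dbound m g C -> dbound m' g C.
Proof. by move=> mm H s sm; apply: H; apply: leq_trans mm. Qed.

Lemma dbound_derive m g C c : dbound m.+1 g C -> dbound m ('D_(dir R c) g) C.
Proof.
move=> H s sm z; have : (size (rcons s c) <= m.+1)%N by rewrite size_rcons.
by move=> /H/(_ z); rewrite -cats1 pderivs_cat.
Qed.

Lemma dbound_exists m g : Cb_prod m g -> exists2 C, 0 <= C & dbound m g C.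
Proof.
elim: m g => [|m IH] g H.
  have [_ _ [M [_ HM]]] := H [::] isT.
  exists (Num.max 0 (M + 1)); first by rewrite le_max lexx.
  move=> [|//] _ z /=; have /HM := ltr_pwDr ltr01 (lexx M).
  by move=> /(_ z I) h; rewrite le_max h orbT.
have [C C0 HC] := IH _ (Cb_prodW (leqnSn m) H).
have /choice[D HD] c : exists D, 0 <= D /\ dbound m ('D_(dir R c) g) D.
  by have [D D0 HD] := IH _ (Cb_prod_derive c H); exists D.
have D0 c : 0 <= D c by have [] := HD c.
exists (C + \sum_c D c); first by rewrite addr_ge0// sumr_ge0.
elim/last_ind => [_ z|s c _].
  by apply: le_trans (HC [::] _ z) _ => //; rewrite lerDl sumr_ge0.
rewrite size_rcons ltnS -cats1 => sm z; rewrite pderivs_cat.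
have [_ /(_ s sm z) h] := HD c; apply: (le_trans h).
by rewrite (bigD1 c)//= addrCA lerDl addr_ge0// sumr_ge0.
Qed.

(** Only the l^1 norm of the displacement enters, and it is the quantity that the
weights of the kernels control. *)
Lemma dirpow_bound m g p h C : dbound m g C ->
  `|dirpow m g p h| <= C * (\sum_c `|h c|) ^+ m.
Proof.
elim: m g => [|m IH] g H; first by rewrite mulr1; exact: (H [::]).
rewrite /=; apply: (le_trans (ler_norm_sum _ _ _)).
rewrite exprS mulrCA mulr_suml; apply: ler_sum => c _; rewrite normrM ler_wpM2l//.
exact/IH/dbound_derive.
Qed.

End several_variables.

(** * Sums over multi-indices *)

Section multi_indices.
Variables (R : realType) (d : nat).
Local Notation O := (option 'I_d).
Local Notation idx := (O -> nat).
Implicit Types (J K : idx) (phi psi : idx -> R) (c : O) (s : seq O).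

Definition zeroI : idx := fun=> 0%N.
Definition inc c J : idx := fun c' => (J c' + (c' == c))%N.
Definition dec c J : idx := fun c' => (J c' - (c' == c))%N.
Definition subI K J : idx := fun c => (K c - J c)%N.
Definition addI K J : idx := fun c => (K c + J c)%N.
Definition ojoin (l : nat) (j : 'I_d -> nat) : idx :=
  fun c => if c is Some i then j i else l.
Definition cnt s : idx := fun c => count_mem c s.
Definition osize J : nat := (\sum_c J c)%N.

Lemma osizeE J : osize J = (J None + mdeg (fun i => J (Some i)))%N.
Proof. exact: big_option. Qed.

Lemma osize_inc c J : osize (inc c J) = (osize J).+1.
Proof.
rewrite /osize big_split/= -addn1; congr addn.
by rewrite (bigD1 c)//= eqxx big1// => c' /negbTE ->.
Qed.

Lemma osize0 : osize zeroI = 0%N. Proof. exact: big1. Qed.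

Lemma osize_cnt s : osize (cnt s) = size s.
Proof.
elim: s => [|c s IH]; first exact: big1.
rewrite /= -IH -(osize_inc c); apply: eq_bigr => c' _.
by rewrite /cnt/= addnC eq_sym.
Qed.

(** Kronecker's delta; comparing coordinatewise makes delta_inc a statement on each
coordinate. *)
Definition delta K J : R := [forall c, K c == J c]%:R.

Lemma deltaP K J : delta K J = (K == J)%:R.
Proof.
congr (_%:R); congr nat_of_bool; apply/idP/eqP => [/forallP H|->].
  by apply/funext => c; exact/eqP.
by apply/forallP => c.
Qed.

(** Adding a letter shifts the delta. With Pascal's rule, or with the multinomial
recursion, this computes word_sum and leibniz on deltas. *)
Lemma delta_inc K c J :
  delta K (inc c J) = (0 < K c)%N%:R * delta (dec c K) J.
Proof.
rewrite /delta -natrM mulnb; congr (_%:R); congr nat_of_bool.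
apply/forallP/andP => [H|[K0 /forallP H]].
  have Kc := H c; split; first by rewrite (eqP Kc) /inc eqxx addn1.
  by apply/forallP => c'; rewrite /dec (eqP (H c')) /inc addnK.
move=> c'; have /eqP := H c'; rewrite /dec/inc; case: eqP => [->|_] /=; lia.
Qed.

(** The sum of phi (cnt s) over all words s of length m in the coordinates. Each
multi-index J of size m occurs m! / J! times, as in the expansion of
(h . nabla)^m. *)
Fixpoint word_sum m phi : R :=
  if m is m'.+1 then \sum_c word_sum m' (fun J => phi (inc c J)) else phi zeroI.

(** The sum of phi (cnt t) over the 2^(size s) ways of keeping or dropping each
letter of s, t being the word that is kept. Each multi-index J below cnt s
occurs with the product of the binomial coefficients, as in Leibniz's rule. *)
Fixpoint leibniz s phi : R :=
  if s is c :: s' then leibniz s' phi + leibniz s' (fun J => phi (inc c J)) else phi zeroI.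

Lemma word_sum_supp m phi psi : (forall J, osize J = m -> phi J = psi J) ->
  word_sum m phi = word_sum m psi.
Proof.
elim: m phi psi => [|m IH] phi psi H /=; first by apply: H; exact: osize0.
by apply: eq_bigr => c _; apply: IH => J Jm; apply: H; rewrite osize_inc Jm.
Qed.

Lemma word_sum_sum m (I : Type) (r : seq I) (a : I -> R) (F : I -> idx -> R) :
  word_sum m (fun J => \sum_(i <- r) a i * F i J) = \sum_(i <- r) a i * word_sum m (F i).
Proof.
elim: m F => [|m IH] F //=.
rewrite (eq_bigr (fun c => \sum_(i <- r) a i * word_sum m (fun J => F i (inc c J)))).
  by rewrite exchange_big/=; apply: eq_bigr => i _; rewrite mulr_sumr.
by move=> c _; rewrite IH.
Qed.

Lemma leibniz_supp s phi psi : (forall J, (forall c, J c <= cnt s c)%N -> phi J = psi J) ->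
  leibniz s phi = leibniz s psi.
Proof.
elim: s phi psi => [|c s IH] phi psi H /=; first exact: H.
congr (_ + _); apply: IH => J HJ; apply: H => c'.
  by rewrite (leq_trans (HJ c'))// /cnt/= leq_addl.
by rewrite /inc /cnt/= addnC leq_add ?HJ// eq_sym.
Qed.

Lemma leibniz_sum s (I : Type) (r : seq I) (a : I -> R) (F : I -> idx -> R) :
  leibniz s (fun J => \sum_(i <- r) a i * F i J) = \sum_(i <- r) a i * leibniz s (F i).
Proof.
elim: s F => [|c s IH] F //=.
rewrite IH (IH (fun i J => F i (inc c J))) -big_split.
by apply: eq_bigr => i _; rewrite mulrDr.
Qed.

Lemma leibniz_add s phi psi :
  leibniz s (fun J => phi J + psi J) = leibniz s phi + leibniz s psi.
Proof. by elim: s phi psi => [|c s IH] phi psi //=; rewrite !IH; ring. Qed.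

Lemma word_sum_scale m (b : R) phi : word_sum m (fun J => b * phi J) = b * word_sum m phi.
Proof.
have := word_sum_sum m [:: tt] (fun=> b) (fun=> phi); rewrite big_seq1 => <-.
by apply: word_sum_supp => J _; rewrite big_seq1.
Qed.

Lemma leibniz_scale s (b : R) phi : leibniz s (fun J => b * phi J) = b * leibniz s phi.
Proof.
have := leibniz_sum s [:: tt] (fun=> b) (fun=> phi); rewrite big_seq1 => <-.
by apply: leibniz_supp => J _; rewrite big_seq1.
Qed.

Definition ofact J : nat := (\prod_c (J c)`!)%N.

Lemma ofact_dec c K : (0 < K c)%N -> ofact K = (K c * ofact (dec c K))%N.
Proof.
move=> K0; rewrite /ofact (bigD1 c)//= [in RHS](bigD1 c)//= mulnA.
congr muln; first by rewrite /dec eqxx subn1 -{1}(prednK K0) factS prednK.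
by apply: eq_bigr => c' /negbTE cc; rewrite /dec cc subn0.
Qed.

Lemma osize_dec c K : (0 < K c)%N -> osize K = (osize (dec c K)).+1.
Proof.
move=> K0; rewrite -(osize_inc c); apply: eq_bigr => c' _.
by rewrite /inc/dec; case: eqP => [->|_]; lia.
Qed.

(** Both sides obey the recursion m! / K! = sum_c K_c (m-1)! / K!, valid when the
K_c add up to m. *)
Lemma word_sum_delta m K :
  word_sum m (delta K) = (osize K == m)%:R * (m`!%:R / (ofact K)%:R).
Proof.
elim: m K => [|m IH] K /=.
  rewrite deltaP; case: eqP => [->|/eqP K0].
    rewrite osize0 eqxx fact0 (_ : ofact _ = 1)%N ?divr1 ?mulr1//.
    exact: big1.
  have -> : (osize K == 0)%N = false; last by rewrite mul0r.
  apply/eqP => /eqP; rewrite /osize sum_nat_eq0 => /forallP H; move/eqP: K0; apply.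
  by apply/funext => c; exact/eqP/(implyP (H c)).
rewrite (eq_bigr (fun c => (osize K == m.+1)%:R * (m`!%:R / (ofact K)%:R) * (K c)%:R)); last first.
  move=> c _; rewrite (word_sum_supp (psi := fun J => (0 < K c)%N%:R * delta (dec c K) J)).
    rewrite word_sum_scale IH; case: posnP => [->|K0]; first by rewrite mul0r mulr0.
    rewrite mul1r (osize_dec K0) eqSS (ofact_dec K0) natrM -!mulrA; congr (_ * (_ * _)).
    by rewrite invfM mulrAC mulVf ?mul1r// pnatr_eq0 -lt0n.
  by move=> J _; exact: delta_inc.
rewrite -mulr_sumr -natr_sum -/(osize K).
case: eqP => [->|_]; last by rewrite !mul0r.
by rewrite factS natrM; ring.
Qed.

(** The recursion on s is Pascal's rule in the coordinate of the first letter. *)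
Lemma leibniz_delta s K : leibniz s (delta K) = \prod_c 'C(cnt s c, K c)%:R.
Proof.
elim: s K => [|c s IH] K /=.
  rewrite deltaP; case: eqP => [->|/eqP K0]; first by rewrite big1// => c _; rewrite bin0.
  have [c Kc] : exists c, (0 < K c)%N.
    apply/existsP; apply: contraNT K0; rewrite negb_exists => /forallP H.
    by apply/eqP/funext => c; apply/eqP; rewrite -leqn0 leqNgt.
  by rewrite (bigD1 c)//= bin0n gtn_eqF// mul0r.
rewrite (leibniz_supp (phi := fun J => delta K (inc c J)) (psi := fun J => (0 < K c)%N%:R * delta (dec c K) J)); last first.
  by move=> J _; exact: delta_inc.
rewrite leibniz_scale !IH (bigD1 c)//= [X in _ + _ * X](bigD1 c)//= [RHS](bigD1 c)//=.
rewrite [X in _ + _ * (_ * X)](eq_bigr (fun i => 'C(cnt s i, K i)%:R)); last first.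
  by move=> i /negbTE ic; rewrite /dec ic subn0.
rewrite [X in _ = _ * X](eq_bigr (fun i => 'C(cnt s i, K i)%:R)); last first.
  by move=> i ic; rewrite /cnt/= eq_sym (negbTE ic).
rewrite mulrA -mulrDl; congr (_ * _); rewrite /cnt/= /dec eqxx add1n.
case: (K c) => [|k]; first by rewrite !bin0 mul0r addr0.
by rewrite mul1r subn1 binS natrD.
Qed.

Lemma leibniz_delta0 s phi :
  leibniz s (fun J => delta zeroI J * phi J) = phi zeroI.
Proof.
rewrite (leibniz_supp (psi := fun J => phi zeroI * delta zeroI J)).
  by rewrite leibniz_scale leibniz_delta big1 ?mulr1// => c _; rewrite bin0.
move=> J _; rewrite deltaP; case: eqP => [<-|_]; first by rewrite mulrC.
by rewrite mul0r mulr0.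
Qed.

(** Linear functionals of functions of multi-indices are determined by their
values on deltas. Only finitely many deltas are needed once the entries of J are
bounded, and these are indexed as in the sums over multi-indices of the
theorem. *)
Lemma delta_expand M1 M2 phi J : (J None < M1)%N -> (forall i, J (Some i) < M2)%N ->
  phi J = \sum_(l < M1) \sum_(j : {ffun 'I_d -> 'I_M2})
    phi (ojoin l (mi j)) * delta (ojoin l (mi j)) J.
Proof.
move=> J1 J2; rewrite (bigD1 (Ordinal J1))//= (bigD1 [ffun i => Ordinal (J2 i)])//=.
set K := ojoin _ _; have -> : K = J.
  by apply/funext => -[i|]//=; rewrite /K/= /mi ffunE.
rewrite deltaP eqxx mulr1 big1 => [|j jJ]; last first.
  rewrite deltaP; case: eqP => [/funeqP E|_]; last by rewrite mulr0.
  case/eqP: jJ; apply/ffunP => i; apply/val_inj; rewrite ffunE /=.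
  exact: (E (Some i)).
rewrite addr0 big1 ?addr0// => l lJ; rewrite big1// => j _; rewrite deltaP.
case: eqP => [/funeqP E|_]; last by rewrite mulr0.
by case/eqP: lJ; apply/val_inj; exact: (E None).
Qed.

Lemma delta_expand_pair M1 M2 phi J : (J None < M1)%N -> (forall i, J (Some i) < M2)%N ->
  phi J = \sum_(lj : 'I_M1 * {ffun 'I_d -> 'I_M2})
    phi (ojoin lj.1 (mi lj.2)) * delta (ojoin lj.1 (mi lj.2)) J.
Proof.
by move=> J1 J2; rewrite (delta_expand phi J1 J2) pair_bigA.
Qed.

Lemma leq_osize J c : (J c <= osize J)%N.
Proof. by rewrite /osize (bigD1 c)//= leq_addr. Qed.

Lemma word_sum_closed m M1 M2 phi : (m < M1)%N -> (m < M2)%N ->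
  word_sum m phi = \sum_(l < M1) \sum_(j : {ffun 'I_d -> 'I_M2} | (l + mdeg (mi j) == m)%N)
    m`!%:R / (l`! * mfact (mi j))%:R * phi (ojoin l (mi j)).
Proof.
move=> m1 m2.
rewrite (word_sum_supp (psi := fun J => \sum_(lj : 'I_M1 * {ffun 'I_d -> 'I_M2})
    phi (ojoin lj.1 (mi lj.2)) * delta (ojoin lj.1 (mi lj.2)) J)); last first.
  move=> J Jm; apply: delta_expand_pair => [|i]; first by rewrite (leq_ltn_trans (leq_osize J _))// Jm.
  by rewrite (leq_ltn_trans (leq_osize J _))// Jm.
rewrite word_sum_sum pair_big_dep/= [RHS]big_mkcond/=; apply: eq_bigr => -[l j] _ /=.
rewrite word_sum_delta osizeE /= /mi; case: eqP => _; last by rewrite mul0r mulr0.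
by rewrite mul1r mulrC /ofact big_option.
Qed.

Lemma mbinE (q b : 'I_d -> nat) : mle b q -> mbin R q b = \prod_i 'C(q i, b i)%:R.
Proof.
move=> /forallP bq; rewrite /mbin /mfact -big_split/= !natr_prod.
rewrite -prodf_div; apply: eq_bigr => i _.
have f0 k : k`!%:R != 0 :> R by rewrite pnatr_eq0 -lt0n fact_gt0.
apply: (mulIf (x := ((b i)`! * (q i - b i)`!)%:R)); first by rewrite natrM mulf_neq0.
by rewrite divfK ?natrM ?mulf_neq0// -!natrM bin_fact.
Qed.

Lemma leibniz_closed s p (q : 'I_d -> nat) M2 phi : cnt s = ojoin p q ->
  (forall i, q i < M2)%N ->
  leibniz s phi = \sum_(a < p.+1) \sum_(b : {ffun 'I_d -> 'I_M2} | mle (mi b) q)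
     'C(p, a)%:R * mbin R q (mi b) * phi (ojoin a (mi b)).
Proof.
move=> sE q2.
rewrite (leibniz_supp (psi := fun J => \sum_(lj : 'I_p.+1 * {ffun 'I_d -> 'I_M2})
    phi (ojoin lj.1 (mi lj.2)) * delta (ojoin lj.1 (mi lj.2)) J)); last first.
  move=> J Jm; apply: delta_expand_pair => [|i]; first by have := Jm None; rewrite sE.
  by rewrite (leq_ltn_trans _ (q2 i))//; have := Jm (Some i); rewrite sE.
rewrite leibniz_sum pair_big_dep/= [RHS]big_mkcond/=; apply: eq_bigr => -[l j] _ /=.
rewrite leibniz_delta big_option sE/=; case: ifPn => [h|].
  by rewrite mbinE// mulrC.
rewrite negb_forall => /existsP[i]; rewrite -ltnNge => h.
by rewrite [X in _ * (_ * X)](bigD1 i)//= (bin_small h) mul0r !mulr0.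
Qed.

(** Each letter of s, seen as a derivative of a product, is assigned to the first
or to the second factor; J and I count the letters that each factor receives. *)
Fixpoint leibniz2 s (H : idx -> idx -> R) : R :=
  if s is c :: s' then leibniz2 s' (fun J I => H (inc c J) I + H J (inc c I))
  else H zeroI zeroI.

(** The letters received by the second factor are those that the first one does
not receive, so the double recursion reduces to a sum over one multi-index. *)
Lemma leibniz2E s H : leibniz2 s H = leibniz s (fun J => H J (subI (cnt s) J)).
Proof.
elim: s H => [|c s IH] H //=.
rewrite IH leibniz_add addrC; congr (_ + _); apply: leibniz_supp => J HJ.
  congr H; apply/funext => c'; rewrite /inc/subI/cnt/=; have := HJ c'; rewrite /cnt.
  rewrite [c == c']eq_sym; move: (count_mem c' s) (nat_of_bool (c' == c)); lia.
congr H; apply/funext => c'; rewrite /inc/subI/cnt/=; have := HJ c'; rewrite /cnt.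
rewrite [c == c']eq_sym; move: (count_mem c' s) (nat_of_bool (c' == c)); lia.
Qed.

Lemma cnt_coords (l : nat) (j : 'I_d -> nat) : cnt (coords l j) = ojoin l j.
Proof.
apply/funext => c; rewrite /cnt /coords count_cat count_nseq count_flatten -map_comp.
rewrite sumnE big_map big_enum/= (eq_bigr (fun i => (Some i == c) * j i)%N); last first.
  by move=> i _ /=; rewrite count_nseq.
case: c => [i|] /=; last by rewrite mul1n big1 ?addn0.
rewrite mul0n add0n (bigD1 i)//= eqxx mul1n big1 ?addn0// => i' /negbTE ii.
by rewrite (inj_eq Some_inj) ii.
Qed.

Lemma size_coords l (j : 'I_d -> nat) : size (coords l j) = (l + mdeg j)%N.
Proof. by rewrite -osize_cnt cnt_coords osizeE. Qed.

Lemma cnt_cat s1 s2 : cnt (s1 ++ s2) = addI (cnt s1) (cnt s2).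
Proof. by apply/funext => c; rewrite /cnt count_cat. Qed.

Local Notation Z := (R * 'rV[R]_d)%type.

Definition dpart J (g : Z -> R) : Z -> R := partial (J None) (fun i => J (Some i)) g.

Lemma pderivs_dpart m g s : Cb_prod m g -> (size s <= m)%N ->
  pderivs s g = dpart (cnt s) g.
Proof.
move=> H sm; apply: (pderivs_perm H sm); apply/allP => c _ /=.
rewrite -/(cnt (coords (cnt s None) (fun i => cnt s (Some i))) c) cnt_coords.
by case: c.
Qed.

Definition opow (h : O -> R) J : R := \prod_c h c ^+ J c.

Lemma opow_inc h c J : opow h (inc c J) = h c * opow h J.
Proof.
rewrite /opow (bigD1 c)//= [in RHS](bigD1 c)//= mulrA -exprS /inc eqxx addn1.
congr (_ * _); apply: eq_bigr => c' /negbTE ->; by rewrite addn0.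
Qed.

(** The statement carries a list s of derivatives already taken, since the
recursion of dirpow differentiates the function. *)
Lemma dirpow_word_sum M m g s p h : Cb_prod M g -> (size s + m <= M)%N ->
  dirpow m (pderivs s g) p h =
  word_sum m (fun J => opow h J * dpart (addI J (cnt s)) g p).
Proof.
move=> H; elim: m s => [|m IH] s sm.
  rewrite addn0 in sm; rewrite [LHS]/= [RHS]/= /opow big1 ?mul1r => [|c _]; last exact: expr0.
  exact: (congr1 (fun G => G p) (pderivs_dpart H sm)).
rewrite dirpowS /=; apply: eq_bigr => c _.
rewrite -[derive _ ^~ _]/(pderivs (c :: s) g) IH ?addSnnS//= -word_sum_scale.
apply: word_sum_supp => J _; rewrite opow_inc mulrA; congr (_ * dpart _ _ _).
by apply/funext => c'; rewrite /addI /inc /cnt/= addnA [c == c']eq_sym.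
Qed.

Lemma dirpow_partial m M1 M2 g p h : (m < M1)%N -> (m < M2)%N -> Cb_prod m g ->
  dirpow m g p h / m`!%:R =
  \sum_(l < M1) \sum_(j : {ffun 'I_d -> 'I_M2} | (l + mdeg (mi j) == m)%N)
    (l`! * mfact (mi j))%:R^-1 *
     (opow h (ojoin l (mi j)) * partial l (mi j) g p).
Proof.
move=> m1 m2 H; rewrite (dirpow_word_sum (s := [::]) _ _ H)// (word_sum_closed _ m1 m2).
have f0 : m`!%:R != 0 :> R by rewrite pnatr_eq0 -lt0n fact_gt0.
rewrite mulr_suml; apply: eq_bigr => l _; rewrite mulr_suml; apply: eq_bigr => j _.
rewrite [LHS]mulrC mulrA; congr (_ * (_ * _)); first by rewrite mulrA mulVf ?mul1r.
congr (partial _ _ _ _); rewrite /addI/cnt/= ?addn0//.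
by apply/funext => i; rewrite addn0.
Qed.

End multi_indices.

(** * Unordered sums as limits over finite boxes *)

Section boxes.
Variables (R : realType).

(** An absolutely convergent unordered sum is the limit of its sums over any such
increasing finite sets, which reduces its properties to those of finite sums. *)
Definition exhaustion (T : choiceType) (bx : nat -> seq T) : Prop :=
  [/\ forall N, uniq (bx N),
      forall N M, (N <= M)%N -> {subset bx N <= bx M} &
      forall x, exists N, x \in bx N].

Lemma big_subseq_split (T : choiceType) (s t : seq T) (a : T -> R) :
  uniq s -> uniq t -> {subset s <= t} ->
  \sum_(x <- t) a x = \sum_(x <- s) a x + \sum_(x <- t | x \notin s) a x.
Proof.
move=> us ut st; rewrite (bigID (mem s))/=; congr (_ + _).
rewrite -big_filter; apply: perm_big; apply: uniq_perm => //.
  exact: filter_uniq.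
by move=> x; rewrite mem_filter; apply/andP/idP => [[]//|xs]; split=> //; exact: st.
Qed.

Lemma esum_seq_ge (T : choiceType) (I : set T) (s : seq T) (a : T -> R) :
  uniq s -> (forall x, x \in s -> I x) ->
  ((\sum_(x <- s) a x)%:E <= \esum_(x in I) (a x)%:E)%E.
Proof.
move=> us sI; apply: esum_ge; exists [set` s].
  by split=> //; exact: finite_seq.
by rewrite -fsbig_seq// sumEFin.
Qed.

Lemma exhaustion_finite (T : choiceType) (bx : nat -> seq T) (s : seq T) :
  exhaustion bx -> exists N, {subset s <= bx N}.
Proof.
move=> [_ mbx cbx]; elim: s => [|x s [N HN]]; first by exists 0%N.
have [M HM] := cbx x; exists (maxn N M) => y; rewrite inE => /predU1P[->|/HN].
  exact: mbx (leq_maxr _ _) _ HM.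
exact: mbx (leq_maxl _ _) _.
Qed.

Variables (T : choiceType) (bx : nat -> seq T).
Hypothesis bxP : exhaustion bx.

Lemma box_mono (a : T -> R) N M : (forall x, 0 <= a x) -> (N <= M)%N ->
  \sum_(x <- bx N) a x <= \sum_(x <- bx M) a x.
Proof.
have [ub mb _] := bxP; move=> a0 NM.
rewrite (big_subseq_split a (ub N) (ub M) (mb _ _ NM)) lerDl.
by apply: sumr_ge0.
Qed.

Lemma esum_box (a : T -> R) (M : R) : (forall x, 0 <= a x) ->
  (forall N, \sum_(x <- bx N) a x <= M) ->
  exists S : R, [/\ 0 <= S, S <= M, (\esum_(x in [set: T]) (a x)%:E = S%:E)%E &
    \sum_(x <- bx N) a x @[N --> \oo] --> S].
Proof.
move=> a0 aM.
pose u N := \sum_(x <- bx N) a x.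
have nu : {homo u : n m / (n <= m)%N >-> n <= m}.
  by move=> n m nm; exact: box_mono.
have hu : has_ubound (range u) by exists M => _ [n _ <-]; exact: aM.
have cu := nondecreasing_cvgn nu hu.
have ul n : u n <= sup (range u).
  by rewrite -(cvg_lim _ cu)//; apply: nondecreasing_cvgn_le => //; exact: cvgP cu.
exists (sup (range u)); split => //.
- by apply: le_trans (ul 0%N); apply: sumr_ge0.
- by apply: ge_sup; [exists (u 0%N); exists 0%N|move=> _ [n _ <-]; exact: aM].
apply/eqP; rewrite eq_le; apply/andP; split.
  apply: ge_ereal_sup => _ [F [/finite_seqP[s ->] _] <-].
  rewrite (_ : [set` s] = [set` undup s]); last first.
    by apply/seteqP; split=> x /=; rewrite mem_undup.
  rewrite -fsbig_seq ?undup_uniq// sumEFin lee_fin.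
  have [N HN] := exhaustion_finite (undup s) bxP.
  apply: (le_trans _ (ul N)); have [ub _ _] := bxP.
  by rewrite /u (big_subseq_split a (undup_uniq s) (ub N) HN) lerDl sumr_ge0.
have [ub _ _] := bxP.
apply/lee_addgt0Pr => e e0.
have [n nn] : exists n, sup (range u) - e < u n.
  have /sup_adherent -/(_ _ e0) : has_sup (range u) by split=> //; exists (u 0%N); exists 0%N.
  by move=> [_ [n _ <-]] ?; exists n.
apply: (@le_trans _ _ ((u n)%:E + e%:E)%E).
  by rewrite -EFinD lee_fin -lerBlDr ltW.
by rewrite leeD2r//; exact: esum_seq_ge.
Qed.

(** Bounded sums of absolute values make the positive and the negative part
summable; the unordered sum is the difference of the limits of their partial
sums. *)
Lemma zsum_cvg (a : T -> R) (M : R) :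
  (forall N, \sum_(x <- bx N) `|a x| <= M) ->
  \sum_(x <- bx N) a x @[N --> \oo] --> zsum a.
Proof.
move=> aM.
have [|N|P [_ _ PE Pc]] := @esum_box (fun x => Num.max (a x) 0) M.
- by move=> x; rewrite le_max lexx orbT.
- apply: le_trans (aM N); apply: ler_sum => x _.
  by rewrite ge_max normr_ge0 ler_norm.
have [|N|Q [_ _ QE Qc]] := @esum_box (fun x => Num.max (- a x) 0) M.
- by move=> x; rewrite le_max lexx orbT.
- apply: le_trans (aM N); apply: ler_sum => x _.
  by rewrite ge_max normr_ge0 -normrN ler_norm.
rewrite /zsum PE QE /=.
rewrite (_ : (fun N => _) = (fun N => \sum_(x <- bx N) Num.max (a x) 0 -
  \sum_(x <- bx N) Num.max (- a x) 0)); first exact: cvgB.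
apply/funext => N; rewrite -sumrB; apply: eq_bigr => x _.
by rewrite !maxEle oppr_le0; case: leP => h1; case: leP => h2; lra.
Qed.

Lemma zsum_unique (a : T -> R) (M l : R) :
  (forall N, \sum_(x <- bx N) `|a x| <= M) ->
  \sum_(x <- bx N) a x @[N --> \oo] --> l -> zsum a = l.
Proof. by move=> aM al; apply: cvg_unique (zsum_cvg aM) al. Qed.

Lemma zsum_le (a : T -> R) (M : R) :
  (forall N, \sum_(x <- bx N) `|a x| <= M) -> `|zsum a| <= M.
Proof.
move=> aM; apply: (cvgn_ler (cvg_norm (zsum_cvg aM))).
by apply: nearW => N; apply: le_trans (aM N); exact: ler_norm_sum.
Qed.

Lemma zsumD (a b : T -> R) (M M' : R) :
  (forall N, \sum_(x <- bx N) `|a x| <= M) ->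
  (forall N, \sum_(x <- bx N) `|b x| <= M') ->
  zsum (fun x => a x + b x) = zsum a + zsum b.
Proof.
move=> aM bM; apply: (zsum_unique (M := M + M')) => [N|].
  apply: le_trans (lerD (aM N) (bM N)); rewrite -big_split.
  by apply: ler_sum => x _; exact: ler_normD.
rewrite (_ : (fun N => _) = (fun N => \sum_(x <- bx N) a x + \sum_(x <- bx N) b x)).
  by apply: cvgD; apply: zsum_cvg.
by apply/funext => N; rewrite big_split.
Qed.

Lemma zsumZ (a : T -> R) (c M : R) :
  (forall N, \sum_(x <- bx N) `|a x| <= M) ->
  zsum (fun x => c * a x) = c * zsum a.
Proof.
move=> aM; apply: (zsum_unique (M := `|c| * M)) => [N|].
  rewrite (eq_bigr (fun x => `|c| * `|a x|)) => [|x _]; last by rewrite normrM.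
  by rewrite -mulr_sumr ler_wpM2l.
rewrite (_ : (fun N => _) = (fun N => c * \sum_(x <- bx N) a x)).
  by apply: cvgM; [exact: cvg_cst|exact: zsum_cvg aM].
by apply/funext => N; rewrite mulr_sumr.
Qed.

Lemma zsum0 : zsum (fun _ : T => 0 : R) = 0.
Proof.
apply: (zsum_unique (M := 0)) => [N|]; first by rewrite big1// => x _; rewrite normr0.
rewrite (_ : (fun N => _) = cst 0); first exact: cvg_cst.
by apply/funext => N; rewrite big1.
Qed.

Lemma zsum_bigsum (I : eqType) (r : seq I) (a : I -> T -> R) :
  (forall i, exists M, forall N, \sum_(x <- bx N) `|a i x| <= M) ->
  zsum (fun x => \sum_(i <- r) a i x) = \sum_(i <- r) zsum (a i) /\
  exists M, forall N, \sum_(x <- bx N) `|\sum_(i <- r) a i x| <= M.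
Proof.
move=> aM; elim: r => [|i r [IH [M HM]]].
  split; first by rewrite big_nil -[RHS]zsum0; congr zsum; apply/funext => x; rewrite big_nil.
  by exists 0 => N; rewrite big1// => x _; rewrite big_nil normr0.
have [Mi HMi] := aM i.
have E : (fun x => \sum_(j <- i :: r) a j x) = (fun x => a i x + \sum_(j <- r) a j x).
  by apply/funext => x; rewrite big_cons.
split.
  by rewrite E (zsumD HMi HM) big_cons IH.
exists (Mi + M) => N; apply: le_trans (lerD (HMi N) (HM N)); rewrite -big_split.
by apply: ler_sum => x _; rewrite big_cons; exact: ler_normD.
Qed.

End boxes.

Section fubini.
Variables (R : realType) (T1 T2 : choiceType).
Variables (b1 : nat -> seq T1) (b2 : nat -> seq T2).
Hypotheses (b1P : exhaustion b1) (b2P : exhaustion b2).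

Definition box_pair N : seq (T1 * T2) := [seq (k, m) | k <- b1 N, m <- b2 N].

Lemma exhaustion_pair : exhaustion box_pair.
Proof.
have [u1 m1 c1] := b1P; have [u2 m2 c2] := b2P; split.
- by move=> N; apply: allpairs_uniq => // -[? ?] [? ?].
- move=> N M NM _ /allpairsP[[k m] /= [kN mN ->]].
  by apply/allpairsP; exists (k, m); split => //=; [exact: m1 kN|exact: m2 mN].
- move=> [k m]; have [N1 h1] := c1 k; have [N2 h2] := c2 m; exists (maxn N1 N2).
  apply/allpairsP; exists (k, m); split => //=.
    exact: m1 (leq_maxl _ _) _ h1.
  exact: m2 (leq_maxr _ _) _ h2.
Qed.

(** A section is dominated by the box sums of the double family, because any finite
part of it lies in a box. So all the sums involved are finite, and they can be
exchanged as sums in the extended reals. *)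
Lemma nneg_fubini (a : T1 * T2 -> R) (M : R) : (forall x, 0 <= a x) ->
  (forall N, \sum_(x <- box_pair N) a x <= M) ->
  exists (x : T1 -> R) (P : R), [/\ forall k, 0 <= x k,
    forall k, (\esum_(m in [set: T2]) (a (k, m))%:E = (x k)%:E)%E,
    (forall N, \sum_(k <- b1 N) x k <= P),
    \sum_(k <- b1 N) x k @[N --> \oo] --> P &
    (\esum_(z in [set: T1 * T2]) (a z)%:E = P%:E)%E].
Proof.
move=> a0 aM.
have [P [P0 PM PE Pc]] := esum_box exhaustion_pair a0 aM.
have /choice[x Hx] k : exists x, 0 <= x /\ (\esum_(m in [set: T2]) (a (k, m))%:E = x%:E)%E.
  have [|N|x [x0 _ xE _]] := @esum_box R _ b2 b2P (fun m => a (k, m)) M.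
  - by move=> m; exact: a0.
  - have [_ m1 /(_ k)[N1 kN1]] := b1P; have [_ m2 _] := b2P.
    apply: le_trans (aM (maxn N N1)); rewrite big_allpairs/=.
    have kb : k \in b1 (maxn N N1) by exact: m1 (leq_maxr _ _) _ kN1.
    rewrite (big_rem k)//=.
    apply: le_trans (box_mono (bx := b2) b2P _ (leq_maxl N N1)) _.
      by move=> m; exact: a0.
    by rewrite lerDl sumr_ge0// => i _; rewrite sumr_ge0.
  - by exists x.
have x0 k : 0 <= x k by have [] := Hx k.
have xE k : (\esum_(m in [set: T2]) (a (k, m))%:E = (x k)%:E)%E by have [] := Hx k.
have EP : (\esum_(k in [set: T1]) (x k)%:E = P%:E)%E.
  rewrite -PE (eq_esum (b := fun k => \esum_(m in [set: T2]) (a (k, m))%:E)%E); last first.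
    by move=> k _; rewrite xE.
  rewrite (@esum_esum R T1 T2 setT (fun=> setT) (fun k m => (a (k, m))%:E)).
    rewrite (_ : _ `*`` _ = setT); first by apply: eq_esum => -[].
    by apply/seteqP; split.
  by move=> k m _ _; rewrite lee_fin.
have xP N : \sum_(k <- b1 N) x k <= P.
  rewrite -lee_fin -EP; have [u1 _ _] := b1P; exact: esum_seq_ge.
exists x, P; split=> //.
have [S [_ _ SE Sc]] := esum_box b1P x0 xP.
by have -> : P = S; [move: SE; rewrite EP => -[]|].
Qed.

(** The iterated sums of the positive and of the negative parts are finite by
nneg_fubini, so that the iterated sum is their difference. *)
Lemma zsum_fubini (a : T1 * T2 -> R) (M : R) :
  (forall N, \sum_(x <- box_pair N) `|a x| <= M) ->
  zsum (fun k => zsum (fun m => a (k, m))) = zsum a.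
Proof.
move=> aM.
have [||x [P [x0 xE xP xc EP]]] := @nneg_fubini (fun z => Num.max (a z) 0) M.
- by move=> z; rewrite le_max lexx orbT.
- move=> N; apply: le_trans (aM N); apply: ler_sum => z _.
  by rewrite ge_max normr_ge0 ler_norm.
have [||y [Q [y0 yE yQ yc EQ]]] := @nneg_fubini (fun z => Num.max (- a z) 0) M.
- by move=> z; rewrite le_max lexx orbT.
- move=> N; apply: le_trans (aM N); apply: ler_sum => z _.
  by rewrite ge_max normr_ge0 -normrN ler_norm.
rewrite [RHS]/zsum EP EQ /=.
rewrite (_ : (fun k => _) = (fun k => x k - y k)); last first.
  by apply/funext => k; rewrite /zsum xE yE.
apply: (zsum_unique b1P (M := P + Q)) => [N|].
  apply: le_trans (lerD (xP N) (yQ N)); rewrite -big_split.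
  apply: ler_sum => k _; apply: le_trans (ler_normB _ _) _.
  by rewrite !ger0_norm.
rewrite (_ : (fun N => _) = (fun N => \sum_(k <- b1 N) x k - \sum_(k <- b1 N) y k)).
  exact: cvgB.
by apply/funext => N; rewrite sumrB.
Qed.

End fubini.

(** * Boxes in the integer lattice *)

Section integer_boxes.

Definition zbox (N : nat) : seq int := [seq (nat_of_ord i)%:Z - N%:Z | i <- enum 'I_N.*2.+1].

Lemma mem_zbox N k : (k \in zbox N) = (absz k <= N)%N.
Proof.
apply/mapP/idP => [[i _ ->]|kN]; first by have := ltn_ord i; lia.
have h : (absz (k + N%:Z)%R < N.*2.+1)%N by lia.
by exists (Ordinal h); rewrite ?mem_enum//=; lia.
Qed.

Lemma size_zbox N : size (zbox N) = N.*2.+1.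
Proof. by rewrite size_map size_enum_ord. Qed.

Lemma exhaustion_zbox : exhaustion zbox.
Proof.
split=> [N|N M NM k|k].
- rewrite map_inj_uniq ?enum_uniq// => i j ij; apply/val_inj => /=; lia.
- by rewrite !mem_zbox => /leq_trans; apply.
- by exists (absz k); rewrite mem_zbox.
Qed.

Variable d : nat.
Local Notation O := (option 'I_d).
Local Notation T := (int * {ffun 'I_d -> int})%type.

(** The functions with values in the integers of absolute value at most N are
reached from a finite type of functions by this translation. *)
Definition recenter N (j : {ffun 'I_d -> 'I_N.*2.+1}) : {ffun 'I_d -> int} :=
  [ffun i => (nat_of_ord (j i))%:Z - N%:Z].

Definition fbox (N : nat) : seq {ffun 'I_d -> int} :=
  [seq recenter j | j <- enum {ffun 'I_d -> 'I_N.*2.+1}].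

Lemma mem_fbox N (m : {ffun 'I_d -> int}) :
  (m \in fbox N) = [forall i, m i \in zbox N].
Proof.
apply/mapP/forallP => [[j _ ->] i|H].
  by rewrite /recenter ffunE mem_zbox; move: (j i) => t; have := ltn_ord t; lia.
have h i : (absz (m i + N%:Z)%R < N.*2.+1)%N by have := H i; rewrite mem_zbox; lia.
exists [ffun i => Ordinal (h i)]; rewrite ?mem_enum//.
by apply/ffunP => i; rewrite !ffunE/=; have := H i; rewrite mem_zbox; lia.
Qed.

Lemma exhaustion_fbox : exhaustion fbox.
Proof.
split=> [N|N M NM m|m].
- rewrite map_inj_uniq ?enum_uniq// => i j ij; apply/ffunP => k; apply/val_inj => /=.
  have /ffunP/(_ k) := ij; rewrite !ffunE; lia.
- rewrite !mem_fbox => /forallP H; apply/forallP => i; have := H i.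
  by rewrite !mem_zbox => /leq_trans; apply.
- exists (\max_i absz (m i))%N; rewrite mem_fbox; apply/forallP => i.
  by rewrite mem_zbox; exact: (leq_bigmax i).
Qed.

Definition lbox := box_pair zbox fbox.

Lemma exhaustion_lbox : exhaustion lbox.
Proof. by apply: exhaustion_pair; [exact: exhaustion_zbox|exact: exhaustion_fbox]. Qed.

Definition icoord (x : T) (c : O) : int := if c is Some i then x.2 i else x.1.

Lemma mem_lbox N x : (x \in lbox N) = [forall c, icoord x c \in zbox N].
Proof.
case: x => k m; apply/allpairsP/forallP => [[[k' m'] /= [kN mN [-> ->]]] [i|]//=|H].
  by move: mN; rewrite mem_fbox => /forallP/(_ i).
exists (k, m); split=> //=; first exact: (H None).
by rewrite mem_fbox; apply/forallP => i; exact: (H (Some i)).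
Qed.

Variable R : realType.

Lemma sum_fbox_prod N (g : 'I_d -> int -> R) :
  \sum_(m <- fbox N) \prod_i g i (m i) = \prod_i \sum_(k <- zbox N) g i k.
Proof.
rewrite big_map big_enum/=.
rewrite (eq_bigr (fun i => \sum_(j : 'I_N.*2.+1) g i ((nat_of_ord j)%:Z - N%:Z))); last first.
  by move=> i _; rewrite big_map big_enum.
rewrite bigA_distr_bigA/=; apply: eq_bigr => j _; apply: eq_bigr => i _.
by rewrite ffunE.
Qed.

(** On a box, sums of products split; this is how statements on one kernel pass to
products of kernels. *)
Lemma sum_lbox_prod N (g : O -> int -> R) :
  \sum_(x <- lbox N) \prod_c g c (icoord x c) = \prod_c \sum_(k <- zbox N) g c k.
Proof.
rewrite [RHS]big_option big_allpairs/= -sum_fbox_prod mulr_suml.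
apply: eq_bigr => k _; rewrite mulr_sumr; apply: eq_bigr => m _.
by rewrite big_option.
Qed.

End integer_boxes.

(** * Kernels with uniformly small tails *)

Section tame_kernels.
Variable R : realType.
Implicit Types chi : R -> R.

(** A multiplicative substitute for |t|^D: it is at least 1, so that it dominates
every |t|^r with r <= D, and a product of weights dominates each of its
factors. *)
Definition weight (D : nat) (t : R) : R := (1 + `|t|) ^+ D.

Lemma weight_ge1 D t : 1 <= weight D t.
Proof. by rewrite exprn_ege1// lerDl. Qed.

Lemma weight_ge0 D t : 0 <= weight D t.
Proof. exact: le_trans ler01 (weight_ge1 _ _). Qed.

(** What the hypotheses on a kernel provide for finite sums: a uniform bound on the
weighted sums and uniformly small tails, both independent of the box. *)
Definition tame (D : nat) chi : Prop :=
  (exists2 M, 0 <= M & forall N (s : R),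
     \sum_(k <- zbox N) weight D (s - k%:~R) * `|chi (s - k%:~R)| <= M) /\
  (forall e : R, 0 < e -> exists r : R, forall N (s : R),
     \sum_(k <- zbox N | r <= `|s - k%:~R|) weight D (s - k%:~R) * `|chi (s - k%:~R)| <= e).

(** The integers within distance r of s lie within a fixed distance of the integer
part of s, and so their number is bounded independently of s. *)
Lemma card_near_int (r : R) : exists C : nat, forall N (s : R),
  (size [seq k <- zbox N | (`|s - k%:~R| < r)%R] <= C)%N.
Proof.
(* One unit for rounding r and one for rounding s. *)
pose n := (`|Num.ceil r| + 2)%N.
exists (n.*2.+1) => N s.
rewrite -(size_map (fun k : int => k - Num.floor s)) -size_zbox.
apply: uniq_leq_size.
  rewrite map_inj_uniq; last by move=> a b /addIr.
  by have [u _ _] := exhaustion_zbox; exact: filter_uniq.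
move=> z /mapP[k + ->]; rewrite mem_filter => /andP[h _].
rewrite mem_zbox.
have h1 : (Num.floor s)%:~R <= s by exact: floor_le_tmp.
have h2 : s < (Num.floor s + 1)%:~R by exact: floorD1_gt.
have h3 : r <= (Num.ceil r)%:~R by exact: ceil_ge.
move: h; rewrite ltr_norml => /andP[h4 h5].
have h6 : (k - Num.floor s)%:~R < (Num.ceil r + 1)%:~R :> R.
  rewrite !rmorphB !rmorphD/= in h2 *; lra.
have h7 : (- (Num.ceil r + 1))%:~R < (k - Num.floor s)%:~R :> R.
  rewrite rmorphN/= !rmorphB !rmorphD/= in h2 *; lra.
rewrite !ltr_int in h6 h7; rewrite /n; lia.
Qed.

(** For |t| >= 1 the weight (1 + |t|)^D is at most 2^D |t|^D, so that tails of the
moment series control weighted tails. The bound on the full sums comes from one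
tail together with the boundedness of chi at the boundedly many integers close
to s. *)
Lemma tame_unif_conv D chi : bounded_fun chi -> unif_conv D chi -> tame D chi.
Proof.
move=> [B [_ HB]] [_ ulim].
have chiB t : `|chi t| <= `|B| + 1.
  by apply: (HB _ _ t I); rewrite ltr_pwDr// ler_norm.
have tail (e : R) : 0 < e -> exists2 r : R, 1 <= r & forall N (s : R),
     \sum_(k <- zbox N | r <= `|s - k%:~R|) weight D (s - k%:~R) * `|chi (s - k%:~R)| <= e.
  move=> e0; have p0 : 0 < 2 ^+ D :> R by rewrite exprn_gt0.
  have /fine_cvgP[fin cv] := ulim.
  have /cvgrPdist_le/(_ (e / 2 ^+ D)) := cv; rewrite divr_gt0// => /(_ isT) near1.
  have [r0 [_ H]] : \forall r \near +oo, (fun r : R => ereal_sup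
      [set (\esum_(k in [set k : int | (r <= `|u - k%:~R|)%R])
        (`|u - k%:~R| ^+ D * `|chi (u - k%:~R)|)%:E)%E | u in [set: R]] <= (e / 2 ^+ D)%:E)%E r.
    near=> r.
    have h1 : ereal_sup
      [set (\esum_(k in [set k : int | (r <= `|u - k%:~R|)%R])
        (`|u - k%:~R| ^+ D * `|chi (u - k%:~R)|)%:E)%E | u in [set: R]] \is a fin_num.
      by near: r.
    rewrite -(fineK h1) lee_fin.
    have : `|0 - fine (ereal_sup
      [set (\esum_(k in [set k : int | (r <= `|u - k%:~R|)%R])
        (`|u - k%:~R| ^+ D * `|chi (u - k%:~R)|)%:E)%E | u in [set: R]])| <= e / 2 ^+ D.
      by near: r.
    by rewrite sub0r normrN; apply: le_trans; exact: ler_norm.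
  (* From r >= 1 on, 1 + |t| <= 2 |t|. *)
  pose r := Num.max 1 (r0 + 1).
  exists r; first by rewrite le_max lexx.
  move=> N s.
  have r0r : r0 < r by rewrite lt_max ltrDl ltr01 orbT.
  have h2 := H _ r0r.
  have h3 : ((\sum_(k <- [seq k <- zbox N | (r <= `|s - k%:~R|)%R])
     `|s - k%:~R| ^+ D * `|chi (s - k%:~R)|)%:E <= (e / 2 ^+ D)%:E)%E.
    apply: le_trans h2; apply: le_trans (ereal_sup_ubound _); last by exists s.
    apply: esum_seq_ge; first by have [u _ _] := exhaustion_zbox; exact: filter_uniq.
    by move=> k; rewrite mem_filter => /andP[].
  rewrite lee_fin ler_pdivlMr// big_filter mulr_suml in h3.
  apply: le_trans h3; apply: ler_sum => k rk; rewrite mulrAC ler_wpM2r//.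
  rewrite /weight -exprMn; apply: lerXn2r; rewrite ?nnegrE ?addr_ge0 ?mulr_ge0//.
  have : 1 <= `|s - k%:~R| by apply: le_trans rk; rewrite le_max lexx.
  lra.
split; last by move=> e /tail[r _ H]; exists r.
have [r r1 Hr] := tail 1 ltr01.
have [C HC] := card_near_int r.
exists (C%:R * ((1 + r) ^+ D * (`|B| + 1)) + 1).
  by rewrite addr_ge0// mulr_ge0// mulr_ge0 ?exprn_ge0 ?addr_ge0// (le_trans ler01).
move=> N s; rewrite (bigID (fun k : int => `|s - k%:~R| < r))/=; apply: lerD; last first.
  by rewrite (eq_bigl _ _ (fun k => esym (leNgt _ _))).
rewrite -big_filter; set L := [seq _ <- _ | _].
apply: (@le_trans _ _ (\sum_(k <- L) ((1 + r) ^+ D * (`|B| + 1)))).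
  rewrite big_seq [leRHS]big_seq; apply: ler_sum => k; rewrite mem_filter => /andP[kr _].
  apply: ler_pM => //; first exact: weight_ge0.
  rewrite /weight; apply: lerXn2r; rewrite ?nnegrE ?addr_ge0// ?(le_trans ler01)//.
  by rewrite lerD2l ltW.
rewrite big_const_seq count_predT iter_addr_0 -[leLHS]mulr_natl ler_wpM2r ?ler_nat ?HC//.
by rewrite mulr_ge0 ?exprn_ge0 ?addr_ge0// (le_trans ler01).
Unshelve. all: by end_near.
Qed.

End tame_kernels.

Section product_sums.
Variables (R : realType) (d D : nat).
Local Notation O := (option 'I_d).
Local Notation T := (int * {ffun 'I_d -> int})%type.
Variable chi : O -> R -> R.
Hypothesis chi_tame : forall c, tame D (chi c).

Definition prod_weight (s : O -> R) (x : T) : R :=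
  \prod_c (weight D (s c - (icoord x c)%:~R) * `|chi c (s c - (icoord x c)%:~R)|).

Lemma prod_weight_ge0 s x : 0 <= prod_weight s x.
Proof. by apply: prodr_ge0 => c _; rewrite mulr_ge0// weight_ge0. Qed.

Lemma prod_weight_bound : exists2 M, 0 <= M & forall N s, \sum_(x <- lbox d N) prod_weight s x <= M.
Proof.
have /choice[M HM] c : exists M, 0 <= M /\ forall N (s : R),
   \sum_(k <- zbox N) weight D (s - k%:~R) * `|chi c (s - k%:~R)| <= M.
  by have [[M M0 HM] _] := chi_tame c; exists M.
exists (\prod_c M c); first by apply: prodr_ge0 => c _; have [] := HM c.
move=> N s; rewrite (sum_lbox_prod N (fun c k => weight D (s c - k%:~R) * `|chi c (s c - k%:~R)|)).
apply: ler_prod => c _; have [_ ->] := HM c; rewrite andbT.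
by apply: sumr_ge0 => k _; rewrite mulr_ge0// weight_ge0.
Qed.

(** If some coordinate of s is far from that of x, then the sum is at most the sum,
over this coordinate, of a small one-dimensional tail times bounded sums in the
other coordinates. *)
Lemma prod_weight_tail (e : R) : 0 < e -> exists r : R, forall N s,
  \sum_(x <- lbox d N | [exists c, r <= `|s c - (icoord x c)%:~R|]) prod_weight s x <= e.
Proof.
move=> e0.
have /choice[M HM] c : exists M, 0 <= M /\ forall N (s : R),
   \sum_(k <- zbox N) weight D (s - k%:~R) * `|chi c (s - k%:~R)| <= M.
  by have [[M M0 HM] _] := chi_tame c; exists M.
have M0 c : 0 <= M c by have [] := HM c.
pose P := \prod_c (M c + 1) : R.
have P0 : 0 < P by apply: prodr_gt0 => c _; rewrite ltr_wpDl.
pose e' := e / (#|{: O}|%:R * P + 1).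
have K0 : 0 < #|{: O}|%:R * P + 1 :> R by rewrite ltr_wpDl// mulr_ge0// ltW.
have e'0 : 0 < e' by rewrite divr_gt0.
have /choice[r Hr] c : exists r : R, forall N (s : R),
     \sum_(k <- zbox N | r <= `|s - k%:~R|) weight D (s - k%:~R) * `|chi c (s - k%:~R)| <= e'.
  by have [_ /(_ _ e'0)] := chi_tame c.
exists (\big[Num.max/0]_c r c) => N s.
set rr := \big[Num.max/0]_c r c.
(* The product of the g c over the coordinates is the weight restricted to the
   points that are far from s in coordinate c. *)
pose g c c' (k : int) : R := (if c' == c then (rr <= `|s c' - k%:~R|)%R%:R else 1) *
   (weight D (s c' - k%:~R) * `|chi c' (s c' - k%:~R)|).
have g0 c c' k : 0 <= g c c' k.
  by rewrite mulr_ge0//; [case: ifP|rewrite mulr_ge0// weight_ge0].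
apply: (@le_trans _ _ (\sum_(x <- lbox d N) \sum_c \prod_c' g c c' (icoord x c'))).
  rewrite big_mkcond/=; apply: ler_sum => x _; case: ifPn => [/existsP[c hc]|_].
    rewrite (bigD1 c)//= ler_wpDr//.
      by apply: sumr_ge0 => c' _; apply: prodr_ge0.
    rewrite /prod_weight le_eqVlt; apply/orP; left; apply/eqP; apply: eq_bigr => c' _.
    by rewrite /g; case: eqP => [->|]; rewrite ?hc mul1r.
  by apply: sumr_ge0 => c _; apply: prodr_ge0.
rewrite exchange_big/=.
apply: (@le_trans _ _ (\sum_(c : O) e' * P)); last first.
  rewrite sumr_const -[e' * P *+ _]mulr_natl mulrCA /e' mulrAC ler_pdivrMr//.
  by rewrite ler_wpM2l ?ltW// ltrDl.
apply: ler_sum => c _; rewrite sum_lbox_prod (bigD1 c)//=.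
rewrite /P [X in _ <= _ * X](bigD1 c)//=.
apply: ler_pM.
- by apply: sumr_ge0 => k _.
- by apply: prodr_ge0 => c' _; apply: sumr_ge0.
- apply: le_trans (Hr c N (s c)); rewrite [leRHS]big_mkcond/=.
  apply: ler_sum => k _; rewrite /g eqxx; case: (leP rr _) => h.
    have -> : r c <= `|s c - k%:~R| by apply: le_trans h; exact: le_bigmax.
    by rewrite mul1r.
  by rewrite mul0r; case: ifP => // _; rewrite mulr_ge0// weight_ge0.
- apply: (@le_trans _ _ (\prod_(c' | c' != c) (M c' + 1))); last first.
    rewrite -[leLHS]mul1r ler_wpM2r ?lerDr//.
    by apply: prodr_ge0 => c' _; rewrite addr_ge0.
  apply: ler_prod => c' cc; apply/andP; split; first by apply: sumr_ge0.
  apply: le_trans (_ : _ <= M c') _; last by rewrite lerDl.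
  have [_ h] := HM c'; apply: le_trans (h N (s c')); apply: ler_sum => k _.
  by rewrite /g (negbTE cc) mul1r.
Qed.

(** For s in a bounded region, every lattice point outside a large box is far from
s in some coordinate. *)
Lemma prod_weight_tail_box (e S : R) : 0 < e -> exists N0, forall N s,
  (forall c, `|s c| <= S) ->
  \sum_(x <- lbox d N | x \notin lbox d N0) prod_weight s x <= e.
Proof.
move=> /prod_weight_tail[r Hr].
exists (`|Num.ceil (r + S)|)%N => N s sS; apply: le_trans (Hr N s).
rewrite big_mkcond [leRHS]big_mkcond/=; apply: ler_sum => x _.
case: ifPn => [|_]; last by case: ifP => // _; exact: prod_weight_ge0.
rewrite mem_lbox negb_forall => /existsP[c]; rewrite mem_zbox -ltnNge => h.
rewrite ifT//; apply/existsP; exists c.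
have h1 : r + S <= (Num.ceil (r + S))%:~R by exact: ceil_ge.
have h2 : (Num.ceil (r + S))%:~R <= `|(icoord x c)%:~R| :> R.
  rewrite -intr_norm ler_int; lia.
have h3 := sS c.
have := lerB_dist (icoord x c)%:~R (s c); rewrite [`|s c - _|]distrC.
lra.
Qed.

End product_sums.

(** * Discrete moments of the derivatives of a kernel *)

Section discrete_moments.
Variable R : realType.
Implicit Types chi : R -> R.

Lemma tame_tail_box D chi (e S : R) : tame D chi -> 0 < e ->
  exists N0, forall N s, `|s| <= S ->
  \sum_(k <- zbox N | k \notin zbox N0) weight D (s - k%:~R) * `|chi (s - k%:~R)| <= e.
Proof.
move=> [_ ht] /ht[r Hr].
exists (`|Num.ceil (r + S)|)%N => N s sS; apply: le_trans (Hr N s).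
rewrite big_mkcond [leRHS]big_mkcond/=; apply: ler_sum => k _.
case: ifPn => [|_]; last by case: ifP => // _; rewrite mulr_ge0// weight_ge0.
rewrite mem_zbox -ltnNge => h; rewrite ifT//.
have h1 : r + S <= (Num.ceil (r + S))%:~R by exact: ceil_ge.
have h2 : (Num.ceil (r + S))%:~R <= `|k%:~R| :> R.
  rewrite -intr_norm ler_int; lia.
have := lerB_dist k%:~R s; rewrite [`|s - _|]distrC.
lra.
Qed.

Lemma normX_le_weight r D (t : R) : (r <= D)%N -> `|t| ^+ r <= weight D t.
Proof.
move=> rD; apply: (@le_trans _ _ (weight r t)).
  by rewrite /weight lerXn2r ?nnegrE ?addr_ge0// lerDr.
by rewrite /weight ler_weXn2l// lerDl.
Qed.

Lemma moment_term_le r D chi (u : R) (k : int) : (r <= D)%N ->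
  `|(k%:~R - u) ^+ r * chi (u - k%:~R)| <= weight D (u - k%:~R) * `|chi (u - k%:~R)|.
Proof.
by move=> rD; rewrite normrM normrX distrC ler_wpM2r// normX_le_weight.
Qed.

Lemma moment_bound r D chi : (r <= D)%N -> tame D chi ->
  exists M, forall N (u : R), \sum_(k <- zbox N) `|(k%:~R - u) ^+ r * chi (u - k%:~R)| <= M.
Proof.
move=> rD [[M _ HM] _]; exists M => N u; apply: le_trans (HM N u).
by apply: ler_sum => k _; exact: moment_term_le.
Qed.

Lemma dmoment_cvg r D chi (u : R) : (r <= D)%N -> tame D chi ->
  \sum_(k <- zbox N) (k%:~R - u) ^+ r * chi (u - k%:~R) @[N --> \oo] --> dmoment r chi u.
Proof.
move=> rD ht; have [M HM] := moment_bound rD ht.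
by apply: (zsum_cvg exhaustion_zbox (M := M)) => N.
Qed.

(** Termwise differentiation of the moment series. The derivative of
(k - u)^r chi(u - k) has two terms, and both are controlled by the weight of
degree D >= r. *)
Lemma is_derive_dmoment r D chi chi' (u : R) : (r <= D)%N ->
  tame D chi -> tame D chi' -> (forall t : R, is_derive t (1:R) chi (chi' t)) ->
  is_derive u (1:R) (dmoment r chi) (dmoment r chi' u - r%:R * dmoment r.-1 chi u).
Proof.
move=> rD ht ht' dchi.
have r1D : (r.-1 <= D)%N by rewrite (leq_trans (leq_pred _)).
apply: (@is_derive_uniform_limit R
  (fun N t => \sum_(k <- zbox N) (k%:~R - t) ^+ r * chi (t - k%:~R))
  (fun N t => \sum_(k <- zbox N) ((k%:~R - t) ^+ r * chi' (t - k%:~R)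
      - r%:R * ((k%:~R - t) ^+ r.-1 * chi (t - k%:~R)))) _
  (fun t => dmoment r chi' t - r%:R * dmoment r.-1 chi t)).
- move=> N t; apply: is_derive_bigsum => k.
  have d1 : is_derive t (1:R) (fun s => (k%:~R - s) ^+ r) (- (r%:R * (k%:~R - t) ^+ r.-1)).
    have d0 : is_derive t (1:R) (fun s : R => k%:~R - s) (- 1).
      by apply: is_derive_eq (is_deriveB (is_derive_cst (k%:~R : R) t (1:R)) (is_derive_id t (1:R))) _; rewrite sub0r.
    have -> : (fun s : R => (k%:~R - s) ^+ r) = (fun s : R => k%:~R - s) ^+ r.
      by apply/funext => s; elim: r {rD r1D} => [|r IH]; rewrite ?expr0// !exprS IH.
    by apply: is_derive_eq; rewrite /GRing.scale/= mulrN1.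
  have d2 : is_derive t (1:R) (fun s => chi (s - k%:~R)) (chi' (t - k%:~R)).
    apply/is_derive_epsP => e e0.
    have [del del0 Hd] := (is_derive_epsP _ _ _ _).1 (dchi (t - k%:~R)) _ e0.
    by exists del => // h /Hd; rewrite [t + h *: 1 - _]addrAC.
  apply: is_derive_eq (is_derive_mul d1 d2) _; ring.
- by move=> t; exact: dmoment_cvg rD ht.
- move=> t.
  rewrite (_ : (fun N => _) = (fun N => \sum_(k <- zbox N) (k%:~R - t) ^+ r * chi' (t - k%:~R)
     - r%:R * \sum_(k <- zbox N) (k%:~R - t) ^+ r.-1 * chi (t - k%:~R))); last first.
    by apply/funext => N; rewrite sumrB mulr_sumr.
  apply: cvgB; first exact: dmoment_cvg rD ht'.
  by apply: cvgM; [exact: cvg_cst|exact: dmoment_cvg r1D ht].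
- move=> e e0.
  (* r may be 0, so the tolerance is divided by r + 1. *)
  have r10 : 0 < r%:R + 1 :> R by rewrite ltr_wpDl.
  have e20 : 0 < e / 2 by lra.
  have e30 : 0 < e / 2 / (r%:R + 1) by rewrite divr_gt0.
  have [N1 H1] := tame_tail_box (`|u| + 1) ht' e20.
  have [N2 H2] := tame_tail_box (`|u| + 1) ht e30.
  exists (maxn N1 N2) => N t NN tu.
  have tS : `|t| <= `|u| + 1.
    have := lerB_dist t u; lra.
  have [ub mb _] := exhaustion_zbox.
  rewrite (big_subseq_split _ (ub (maxn N1 N2)) (ub N) (mb _ _ NN)) addrAC subrr add0r.
  apply: le_trans (ler_norm_sum _ _ _) _.
  apply: (@le_trans _ _ (e / 2 + r%:R * (e / 2 / (r%:R + 1)))); last first.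
    rewrite [leRHS](_ : e = e / 2 + e / 2); last by field.
    rewrite lerD2l mulrA ler_pdivrMr// mulrC ler_wpM2l ?ltW//.
    by rewrite ltrDl.
  apply: le_trans (lerD (H1 N t tS) (ler_wpM2l (ler0n R r) (H2 N t tS))).
  rewrite mulr_sumr [in leRHS]big_mkcond [X in _ <= _ + X]big_mkcond -big_split/=.
  rewrite big_mkcond/=; apply: ler_sum => k _.
  have n1 : 0 <= weight D (t - k%:~R) * `|chi' (t - k%:~R)| by rewrite mulr_ge0// weight_ge0.
  have n2 : 0 <= r%:R * (weight D (t - k%:~R) * `|chi (t - k%:~R)|).
    by rewrite !mulr_ge0// weight_ge0.
  case: ifPn => [kN|_]; last by rewrite addr_ge0//; case: ifP.
  rewrite !ifT.
  + apply: le_trans (ler_normB _ _) _; apply: lerD; first exact: moment_term_le.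
    by rewrite normrM ger0_norm// ler_wpM2l// moment_term_le.
  + by apply: contraNN kN; exact: mb (leq_maxr _ _) _.
  + by apply: contraNN kN; exact: mb (leq_maxl _ _) _.
Qed.

Variables (n : nat) (chi : R -> R).
Hypothesis chi_Cb : Cb_real n chi.
Hypothesis chi_kernel : kernel_of_order n.+1 chi.
Hypothesis chi_moment : forall r, (r <= n.+1)%N -> const_moment r chi.
Hypothesis chi_unif : forall l, (1 <= l <= n)%N -> unif_conv n.+1 (chi^`(l)).

Lemma kernel_is_derive a (t : R) : (a < n)%N -> is_derive t (1:R) (chi^`(a)) (chi^`(a.+1) t).
Proof.
move=> an; rewrite derive1nS derive1E; apply: derivableP.
by have [H _] := chi_Cb; exact: H.
Qed.

Lemma kernel_tame a : (a <= n)%N -> tame n.+1 (chi^`(a)).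
Proof.
move=> an; have [_ /(_ a an)[_ ba]] := chi_Cb; apply: tame_unif_conv => //.
case: a an ba => [|a] an _; last exact: chi_unif.
by rewrite derive1n0; have [] := chi_kernel.
Qed.

(** A constant moment has derivative 0, and is_derive_dmoment computes this
derivative as m_r(chi^(a+1)) - r m_{r-1}(chi^(a)). *)
Lemma kernel_moment_succ a r : (a < n)%N -> (r <= n.+1)%N ->
  const_moment r (chi^`(a)) ->
  forall u, dmoment r (chi^`(a.+1)) u = r%:R * dmoment r.-1 (chi^`(a)) u.
Proof.
move=> an rn cm u.
have [_ D1] := is_derive_dmoment u rn (kernel_tame (ltnW an)) (kernel_tame an)
  (fun t => kernel_is_derive t an).
apply/eqP; rewrite -subr_eq0 -D1.
rewrite (_ : dmoment r chi^`(a) = cst (dmoment r chi^`(a) 0)) ?derive_cst//.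
by apply/funext => v; exact: cm.
Qed.

(** The recursion kernel_moment_succ carries constancy from the moments of chi to
those of its derivatives. *)
Lemma kernel_const_moment a r : (a <= n)%N -> (r <= n.+1)%N ->
  const_moment r (chi^`(a)).
Proof.
elim: a r => [|a IH] r an rn; first exact: chi_moment.
move=> u v; have E := kernel_moment_succ an rn (IH _ (ltnW an) rn).
by rewrite !E; congr (_ * _); apply: IH (ltnW an) _ _ _; rewrite (leq_trans (leq_pred _)).
Qed.

Lemma dmoment_kernel a r u : (a <= n)%N -> (r <= n.+1)%N ->
  dmoment r (chi^`(a)) u = moment r (chi^`(a)).
Proof. by move=> an rn; exact: kernel_const_moment. Qed.

(** The factor r = 0 in kernel_moment_succ kills the moment of order 0 of every
derivative, and for the kernel itself this moment is the partition of unity. *)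
Lemma moment0_kernel a : (a <= n)%N -> moment 0 (chi^`(a)) = (a == 0%N)%:R.
Proof.
case: a => [|a] an.
  rewrite /moment /dmoment; have [H _ _] := chi_kernel; rewrite eqxx mulr1n.
  by rewrite -[RHS](H 0); congr zsum; apply/funext => k; rewrite mul1r.
rewrite /moment kernel_moment_succ ?mul0r//.
by apply: kernel_const_moment => //; exact: ltnW.
Qed.

End discrete_moments.

Lemma near_dist (R : realType) (V : normedModType R) (z : V) (A : set V) :
  nbhs z A -> exists2 del : R, 0 < del & forall z', `|z' - z| < del -> A z'.
Proof.
move=> /nbhs_ballP[r /= r0 Hr]; exists r => // z' zz; apply: Hr.
by rewrite -ball_normE /ball_/= distrC.
Qed.

(** * Mean values over cells *)

Section integral_on_segment.
Variable R : realType.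
Local Notation mu := (@lebesgue_measure R).
Implicit Types f g : R -> R.

Lemma integrable_continuous f (a b : R) : continuous f ->
  mu.-integrable `[a, b] (EFin \o f).
Proof.
move=> cf; apply: continuous_compact_integrable; first exact: segment_compact.
exact: continuous_subspaceT.
Qed.

Lemma Rint_lin f g (a b x y : R) : continuous f -> continuous g ->
  \int[mu]_(t in `[a, b]) (x * f t + y * g t) =
  x * \int[mu]_(t in `[a, b]) f t + y * \int[mu]_(t in `[a, b]) g t.
Proof.
move=> cf cg.
have cx : continuous (fun t => x * f t) by move=> t; apply: cvgM; [exact: cvg_cst|exact: cf].
have cy : continuous (fun t => y * g t) by move=> t; apply: cvgM; [exact: cvg_cst|exact: cg].
rewrite RintegralD//; [|exact: integrable_continuous|exact: integrable_continuous].
by rewrite !RintegralZl//; exact: integrable_continuous.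
Qed.

Lemma Rint_bound f (a b C : R) : a <= b -> continuous f ->
  (forall t, a <= t <= b -> `|f t| <= C) ->
  `|\int[mu]_(t in `[a, b]) f t| <= (b - a) * C.
Proof.
move=> ab cf fC.
apply: (@le_trans _ _ (\int[mu]_(t in `[a, b]) `|f t|)).
  by apply: le_normr_Rintegral => //; exact: integrable_continuous.
have -> : (b - a) * C = \int[mu]_(t in `[a, b]) C.
  rewrite Rintegral_cst//= lebesgue_measure_itv/= lte_fin mulrC.
  by move: ab; rewrite le_eqVlt => /predU1P[->|->]//=; rewrite ltxx subrr.
apply: le_Rintegral => //.
- by apply: (@integrable_continuous (fun t => `|f t|)) => t; apply: cvg_norm; exact: cf.
- by apply: (@integrable_continuous (fun=> C)) => t; exact: cvg_cst.
Qed.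

Lemma Rint_monomial (a b x : R) (l : nat) : a < b ->
  \int[mu]_(t in `[a, b]) (t - x) ^+ l = ((b - x) ^+ l.+1 - (a - x) ^+ l.+1) / l.+1%:R.
Proof.
move=> ab; pose F t : R := (t - x) ^+ l.+1 / l.+1%:R.
have l0 : l.+1%:R != 0 :> R by rewrite pnatr_eq0.
have dF (t : R) : is_derive t (1:R) F ((t - x) ^+ l).
  have d0 : is_derive t (1:R) (fun s : R => s - x) 1.
    by apply: is_derive_eq (is_deriveB (is_derive_id t (1:R)) (is_derive_cst (x : R) t (1:R))) _; rewrite subr0.
  have -> : F = l.+1%:R^-1 *: ((fun s : R => s - x) ^+ l.+1).
    apply/funext => s; rewrite /F mulrC; congr (_ * _).
    by elim: (l.+1) => [|k IH]; rewrite ?expr0// !exprS IH.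
  apply: is_derive_eq; rewrite /GRing.scale/= mulr1 mulrA mulVf// mul1r.
  by elim: (l) => [|k IH]; rewrite ?expr0// !exprS -IH.
have cF : continuous F.
  by move=> t; apply: differentiable_continuous; apply/derivable1_diffP; have [] := dF t.
have cf : continuous (fun t => (t - x) ^+ l).
  move=> t; apply: (@continuous_comp _ _ _ (fun s : R => s - x) (fun u : R => u ^+ l)).
    by apply: cvgB; [exact: cvg_id|exact: cvg_cst].
  exact: exprn_continuous.
have := @continuous_FTC2 R (fun t => (t - x) ^+ l) F a b ab.
rewrite /Rintegral => ->.
- by rewrite -EFinB /= /F mulrBl.
- exact: continuous_subspaceT.
- split.
  + by move=> t _; have [] := dF t.
  + by apply: cvg_at_right_filter; exact: cF.
  + by apply: cvg_at_left_filter; exact: cF.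
- by move=> t _; rewrite derive1E; have [_ ->] := dF t.
Qed.

End integral_on_segment.

Section cell_average.
Variables (R : realType) (d : nat).
Local Notation Z := (R * 'rV[R]_d)%type.
Local Notation O := (option 'I_d).
Local Notation mu := (@lebesgue_measure R).
Implicit Types (h g : Z -> R) (c : O) (z : Z) (L : seq O).

Definition set_pcoord z c (t : R) : Z :=
  if c is Some i then (z.1, set_coord z.2 i t) else (t, z.2).

Lemma pcoord_set_pcoord z c t c' : pcoord (set_pcoord z c t) c' = if c' == c then t else pcoord z c'.
Proof. by case: c c' => [i|] [j|]//=; rewrite mxE. Qed.

(** Integration over one coordinate, as an operator on functions of all the
coordinates; iterating it gives box integrals. *)
Definition int_pcoord (lo hi : O -> R) c h : Z -> R :=
  fun z => \int[mu]_(t in `[lo c, hi c]) h (set_pcoord z c t).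

Lemma set_pcoord_near z z' c t t' (e : R) : 0 < e -> `|z' - z| < e -> `|t' - t| < e ->
  `|set_pcoord z' c t' - set_pcoord z c t| < e.
Proof.
move=> e0 zz tt; apply: norm_lt_pcoord => // c'; rewrite pcoordB !pcoord_set_pcoord.
by case: eqP => // _; rewrite -pcoordB; apply: le_lt_trans zz; exact: pcoord_le_norm.
Qed.

Lemma continuous_set_pcoord h z c : continuous h -> continuous (fun t : R => h (set_pcoord z c t)).
Proof.
move=> /(@continuous_epsP R Z) ch; apply/(@continuous_epsP R R) => t e e0.
have [r r0 Hr] := ch (set_pcoord z c t) e e0; exists r => // t' tt; apply: Hr.
by apply: set_pcoord_near => //; rewrite subrr normr0.
Qed.

(** By compactness of the segment, continuity at the points of a segment through z
is uniform on a tube around it. *)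
Lemma int_pcoord_continuous lo hi c h : lo c <= hi c -> continuous h -> continuous (int_pcoord lo hi c h).
Proof.
move=> lh ch; have /(@continuous_epsP R Z) ch' := ch.
apply/(@continuous_epsP R Z) => z e e0.
pose K := hi c - lo c + 1; have K0 : 0 < K by rewrite /K; lra.
pose e' := e / K; have e'0 : 0 < e' by rewrite divr_gt0.
have e'20 : 0 < e' / 2 by lra.
have [del del0 Hd] : exists2 del : R, 0 < del & forall z', `|z' - z| < del ->
    forall t, lo c <= t <= hi c -> `|h (set_pcoord z' c t) - h (set_pcoord z c t)| <= e'.
  have /compact_near_coveringP nc := @segment_compact R (lo c) (hi c).
  have H := nc Z (nbhs z) (fun z' t => `|h (set_pcoord z' c t) - h (set_pcoord z c t)| <= e').
  have [|del del0 Hd] := near_dist (H _ _).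
    move=> t _; have [r r0 Hr] := ch' (set_pcoord z c t) _ e'20.
    exists (ball t r, ball z r); first by split; exact: nbhsx_ballx.
    move=> [t' z'] /= []; rewrite -!ball_normE /ball_/= => tt zz.
    have h1 : `|h (set_pcoord z' c t') - h (set_pcoord z c t)| < e' / 2.
      by apply: Hr; apply: set_pcoord_near => //; rewrite distrC.
    have h2 : `|h (set_pcoord z c t') - h (set_pcoord z c t)| < e' / 2.
      by apply: Hr; apply: set_pcoord_near => //; [rewrite subrr normr0|rewrite distrC].
    have -> : h (set_pcoord z' c t') - h (set_pcoord z c t') =
       (h (set_pcoord z' c t') - h (set_pcoord z c t)) - (h (set_pcoord z c t') - h (set_pcoord z c t)) by ring.
    by apply: le_trans (ler_normB _ _) _; lra.
  exists del => // z' /Hd/= H' t tt; apply: H'; by rewrite /= in_itv.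
exists del => // z' /Hd Hz.
have -> : int_pcoord lo hi c h z' - int_pcoord lo hi c h z =
    \int[mu]_(t in `[lo c, hi c]) (1 * h (set_pcoord z' c t) + (-1) * h (set_pcoord z c t)).
  rewrite Rint_lin; [|exact: continuous_set_pcoord|exact: continuous_set_pcoord].
  by rewrite mul1r mulN1r.
apply: (@le_lt_trans _ _ ((hi c - lo c) * e')).
  apply: Rint_bound => //.
    move=> t; apply: cvgD; apply: cvgM; try exact: cvg_cst; exact: continuous_set_pcoord.
  by move=> t /Hz; rewrite mul1r mulN1r.
rewrite /e' mulrA ltr_pdivrMr// mulrC ltr_pM2l// /K; lra.
Qed.

Definition int_pcoords lo hi L h : Z -> R := foldr (int_pcoord lo hi) h L.

Variables lo hi : O -> R.
Hypothesis lohi : forall c, lo c <= hi c.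

Lemma int_pcoords_continuous L h : continuous h -> continuous (int_pcoords lo hi L h).
Proof. by move=> ch; elim: L => //= c L IH; exact: int_pcoord_continuous. Qed.

Lemma int_pcoords_lin L f g (x y : R) : continuous f -> continuous g ->
  int_pcoords lo hi L (fun z => x * f z + y * g z) =
  (fun z => x * int_pcoords lo hi L f z + y * int_pcoords lo hi L g z).
Proof.
move=> cf cg; elim: L => //= c L ->; apply/funext => z; rewrite /int_pcoord.
by rewrite Rint_lin//; apply: continuous_set_pcoord; exact: int_pcoords_continuous.
Qed.

(** The point z only supplies the coordinates that are not integrated, whence the
hypothesis on the coordinates outside L. *)
Lemma int_pcoords_bound L h (C : R) z : continuous h ->
  (forall p, (forall c, lo c <= pcoord p c <= hi c) -> `|h p| <= C) ->
  (forall c, c \notin L -> lo c <= pcoord z c <= hi c) ->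
  `|int_pcoords lo hi L h z| <= (\prod_(c <- L) (hi c - lo c)) * C.
Proof.
move=> ch hC; elim: L z => [|c L IH] z zL /=.
  by rewrite big_nil mul1r; apply: hC => c; exact: zL.
rewrite big_cons -mulrA; apply: Rint_bound => //.
  by apply: continuous_set_pcoord; exact: int_pcoords_continuous.
move=> t tt; apply: IH => c' c'L; rewrite pcoord_set_pcoord; case: eqP => [->//|/eqP cc].
by apply: zL; rewrite inE negb_or cc.
Qed.

Lemma int_pcoords_prod L (phi : O -> R -> R) z : uniq L -> (forall c, continuous (phi c)) ->
  int_pcoords lo hi L (fun p => \prod_c phi c (pcoord p c)) z =
  \prod_c (if c \in L then \int[mu]_(t in `[lo c, hi c]) phi c t else phi c (pcoord z c)).
Proof.
move=> + cphi; elim: L z => [|c L IH] z //= /andP[cL uL].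
rewrite /int_pcoord; under eq_Rintegral do rewrite IH//.
pose P := \prod_(c' | c' != c) (if c' \in L then \int[mu]_(t in `[lo c', hi c']) phi c' t else phi c' (pcoord z c')).
transitivity (\int[mu]_(t in `[lo c, hi c]) (P * phi c t + 0 * phi c t)).
  apply: eq_Rintegral => t _; rewrite mul0r addr0 (bigD1 c)//= (negbTE cL) pcoord_set_pcoord eqxx mulrC.
  congr (_ * _); apply: eq_bigr => c' cc; rewrite pcoord_set_pcoord.
  by rewrite (negbTE cc).
rewrite Rint_lin// mul0r addr0 [RHS](bigD1 c)//= mem_head mulrC; congr (_ * _).
by apply: eq_bigr => c' cc; rewrite inE (negbTE cc).
Qed.

End cell_average.

Section average.
Variables (R : realType) (d : nat).
Local Notation Z := (R * 'rV[R]_d)%type.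
Local Notation O := (option 'I_d).
Local Notation mu := (@lebesgue_measure R).
Variables (w : R) (w0 : 0 < w) (a : O -> int).
Implicit Types (h g : Z -> R) (c : O) (z : Z).

Definition axes : seq O := None :: map Some (enum 'I_d).

Lemma uniq_axes : uniq axes.
Proof.
rewrite /= map_inj_uniq ?enum_uniq ?andbT; last by move=> i j [].
by apply/mapP => -[].
Qed.

Lemma mem_axes c : c \in axes.
Proof.
by case: c => [i|]; rewrite inE//=; apply/mapP; exists i; rewrite ?mem_enum.
Qed.

Definition clow c : R := (a c)%:~R / w.
Definition chigh c : R := ((a c)%:~R + 1) / w.

Lemma clow_le_chigh c : clow c <= chigh c.
Proof. by rewrite /clow /chigh ler_pM2r ?invr_gt0// lerDl. Qed.

Lemma cell_side c : chigh c - clow c = w^-1.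
Proof. by rewrite /clow /chigh -mulrBl addrAC subrr add0r mul1r. Qed.

(** The mean value over the cell of side 1 / w with lower corner a / w; the base
point 0 is overwritten, since every coordinate is integrated. *)
Definition avg h : R := w ^+ d.+1 * int_pcoords clow chigh axes h 0.

Lemma avg_lin f g (x y : R) : continuous f -> continuous g ->
  avg (fun z => x * f z + y * g z) = x * avg f + y * avg g.
Proof. by move=> cf cg; rewrite /avg int_pcoords_lin//; [ring|exact: clow_le_chigh]. Qed.

Lemma avg_sum (I : Type) (r : seq I) (x : I -> R) (F : I -> Z -> R) :
  (forall i, continuous (F i)) ->
  avg (fun z => \sum_(i <- r) x i * F i z) = \sum_(i <- r) x i * avg (F i).
Proof.
move=> cF; elim: r => [|i r IH].
  rewrite big_nil (_ : (fun _ => _) = (fun z => 0 * (0 : R) + 0 * (0 : R))).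
    by rewrite (@avg_lin (fun=> 0) (fun=> 0)) ?mul0r ?addr0// => z; exact: cvg_cst.
  by apply/funext => z; rewrite big_nil mul0r addr0.
rewrite big_cons -IH -[avg (fun z => \sum_(j <- r) _)]mul1r -avg_lin//; last first.
  apply: (@continuous_bigsum R Z) => j z; apply: (@continuousM R Z); [exact: cvg_cst|exact: cF].
by congr avg; apply/funext => z; rewrite big_cons mul1r.
Qed.

Lemma prod_axes (F : O -> R) : \prod_(c <- axes) F c = \prod_c F c.
Proof. by rewrite big_option big_cons big_map big_enum. Qed.

Lemma avg_bound h (C : R) : continuous h ->
  (forall p, (forall c, clow c <= pcoord p c <= chigh c) -> `|h p| <= C) ->
  `|avg h| <= C.
Proof.
move=> ch hC; have wd : 0 < w ^+ d.+1 by rewrite exprn_gt0.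
rewrite /avg normrM (ger0_norm (ltW wd)) -ler_pdivlMl//.
apply: (le_trans (int_pcoords_bound clow_le_chigh ch hC _)).
  by move=> c; rewrite mem_axes.
rewrite prod_axes (eq_bigr (fun=> w^-1)) => [|c _]; last exact: cell_side.
by rewrite prodr_const card_option card_ord exprVn.
Qed.

(** The integral of (s + t)^l for t from 0 to 1, expanded in powers of s: the
denominators l - e + 1 of the limit come from here. *)
Definition cellmoment (l : nat) (s : R) : R :=
  \sum_(e < l.+1) 'C(l, e)%:R * s ^+ e / (l - e + 1)%N%:R.

Lemma cellmomentE l (s : R) :
  ((s + 1) ^+ l.+1 - s ^+ l.+1) / l.+1%:R = cellmoment l s.
Proof.
rewrite /cellmoment [s + 1]addrC exprDn big_ord_recr/= subnn expr0 binn mulr1n mul1r.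
rewrite addrK mulr_suml; apply: eq_bigr => e _.
rewrite expr1n mul1r -mulr_natl; have el : (e <= l)%N by rewrite -ltnS.
have l0 : l.+1%:R != 0 :> R by rewrite pnatr_eq0.
have e0 : (l - e + 1)%N%:R != 0 :> R by rewrite pnatr_eq0 addn1.
apply: (mulIf l0); apply: (mulIf e0); rewrite divfK// mulrAC.
rewrite [RHS]mulrAC divfK//.
have E : ('C(l.+1, e) * (l - e + 1) = 'C(l, e) * l.+1)%N.
  rewrite mulnC [RHS]mulnC; have /= -> := mul_bin_down l.+1 e; congr muln; lia.
by rewrite -natrM E natrM; ring.
Qed.

Lemma opow_continuous z J : continuous (fun p : Z => opow (pcoord (p - z)) J).
Proof.
rewrite (_ : (fun _ => _) = fun p => \prod_(c <- index_enum O) (pcoord (p - z) c ^+ J c)) //.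
elim: (index_enum O) => [|c s IH].
  have -> : (fun p : Z => \prod_(c <- [::]) pcoord (p - z) c ^+ J c) = cst 1.
    by apply/funext => q; rewrite big_nil.
  by move=> p; exact: cvg_cst.
have -> : (fun p : Z => \prod_(c0 <- c :: s) pcoord (p - z) c0 ^+ J c0) =
  (fun p => (pcoord p c - pcoord z c) ^+ J c * \prod_(c0 <- s) pcoord (p - z) c0 ^+ J c0).
  by apply/funext => p; rewrite big_cons pcoordB.
move=> p; apply: (@continuousM R Z); last exact: IH.
apply: (@continuous_comp _ _ _ (fun p : Z => pcoord p c - pcoord z c) (fun u : R => u ^+ J c)).
  by apply: (@continuousB R R Z); [exact: continuous_pcoord|exact: cvg_cst].
exact: exprn_continuous.
Qed.

(** The mean over a cell of a product of one-variable monomials is a product of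
one-variable means. The substitution t = (a + u) / w in each of them produces
(a - w z + u)^J / w^J with u between 0 and 1, whose integral over u is
cellmoment. *)
Lemma avg_monomial z J :
  avg (fun p => opow (pcoord (p - z)) J) * w ^+ osize J =
  \prod_c cellmoment (J c) ((a c)%:~R - w * pcoord z c).
Proof.
rewrite /avg (_ : (fun p => _) = (fun p => \prod_c (pcoord p c - pcoord z c) ^+ J c)); last first.
  by apply/funext => p; rewrite /opow; apply: eq_bigr => c _; rewrite pcoordB.
rewrite (@int_pcoords_prod _ _ _ _ axes (fun c t => (t - pcoord z c) ^+ J c)) ?uniq_axes//; last first.
  move=> c t; apply: (@continuous_comp _ _ _ (fun s : R => s - pcoord z c) (fun u : R => u ^+ J c)).
    by apply: cvgB; [exact: cvg_id|exact: cvg_cst].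
  exact: exprn_continuous.
rewrite -prodrXr -[w ^+ d.+1](_ : \prod_(c : O) w = _); last first.
  by rewrite prodr_const card_option card_ord.
rewrite -!big_split/=; apply: eq_bigr => c _; rewrite mem_axes.
rewrite Rint_monomial; last by rewrite -subr_gt0 cell_side invr_gt0.
rewrite -cellmomentE /clow /chigh.
have w0' : w != 0 by rewrite gt_eqF.
have l0 : (J c).+1%:R != 0 :> R by rewrite pnatr_eq0.
have e1 (s : R) : (s / w - pcoord z c) ^+ (J c).+1 = (s - w * pcoord z c) ^+ (J c).+1 / w ^+ (J c).+1.
  by rewrite -expr_div_n; congr (_ ^+ _); field.
rewrite !e1 [_ + 1 - w * _]addrAC [w ^+ (J c).+1]exprS.
have wJ : w ^+ J c != 0 by rewrite expf_neq0.
move: (((a c)%:~R - w * pcoord z c + 1) ^+ (J c).+1) (((a c)%:~R - w * pcoord z c) ^+ (J c).+1).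
move: (w ^+ J c) ((J c).+1%:R : R) wJ l0 => W K W0 K0 A B.
by field; rewrite K0 W0 w0'.
Qed.

(** The distance in a coordinate from z to a point of the cell is at most the
distance to its corner plus the side. *)
Lemma cell_dist p z c : clow c <= pcoord p c <= chigh c ->
  `|pcoord (z - p) c| <= (1 + `|w * pcoord z c - (a c)%:~R|) / w.
Proof.
rewrite pcoordB /clow /chigh => /andP[].
rewrite ler_pdivrMr// ler_pdivlMr// => h1 h2; rewrite ler_pdivlMr//.
rewrite -[X in _ * X](ger0_norm (ltW w0)) -normrM mulrBl [_ * w]mulrC.
have -> : w * pcoord z c - pcoord p c * w =
  (w * pcoord z c - (a c)%:~R) - (pcoord p c * w - (a c)%:~R) by ring.
apply: (le_trans (ler_normB _ _)); rewrite addrC lerD2r ler_norml; lra.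
Qed.

(** Displacements bounded by S are all that the constant depends on, so that the
estimate is uniform over a cell. *)
Lemma dirpow_lip (m : nat) (g : Z -> R) c (S : R) : Cb_prod m g -> 0 <= S ->
  exists2 C, 0 <= C & forall (p z : Z) (h : R), `|h| <= 1 ->
   (forall c', `|pcoord (z - p) c'| <= S) ->
   `|dirpow m g p (pcoord (z + h *: dir R c - p)) - dirpow m g p (pcoord (z - p))| <= C * `|h|.
Proof.
move=> + S0; case: m => [|m] H.
  by exists 0 => // p z h _ _; rewrite subrr normr0 mul0r.
have [C C0 HC] := dbound_exists H.
exists (m.+1%:R * (C * (\sum_(c' : O) (S + 1)) ^+ m)).
  by rewrite !mulr_ge0// exprn_ge0// sumr_ge0// => _ _; rewrite addr_ge0.
move=> p z h h1 zp.
have dd (t : R) c' : is_derive t (1:R) (fun s => pcoord (z + s *: dir R c - p) c') (c' == c)%:R.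
  rewrite (_ : (fun _ => _) = (fun s => pcoord (z - p) c' + s * (c' == c)%:R)); last first.
    by apply/funext => s; rewrite !(pcoordB, pcoordD) pcoordZ pcoord_dir; ring.
  apply: is_derive_eq (is_deriveD (is_derive_cst (pcoord (z - p) c') t 1)
    (is_derive_mul (is_derive_id t 1) (is_derive_cst ((c' == c)%:R : R) t 1))) _.
  by rewrite /= mulr0 add0r mulr1 add0r.
have [xi] := MVT_line 0 h (fun t => is_derive_dirpow p H (dd t)).
rewrite !subr0 scale0r addr0 => xih ->; rewrite normrM mulrC ler_wpM2r//.
rewrite normrM ger0_norm// ler_wpM2l//.
apply: (le_trans (dirpow_bound _ _ (dbound_derive c HC))).
rewrite ler_wpM2l//; apply: lerXn2r; rewrite ?nnegrE.
- exact: sumr_ge0.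
- by apply: sumr_ge0 => _ _; rewrite addr_ge0.
apply: ler_sum => c' _.
have -> : pcoord (z + xi *: dir R c - p) c' = pcoord (z - p) c' + xi * (c' == c)%:R.
  by rewrite !(pcoordB, pcoordD) pcoordZ pcoord_dir; ring.
apply: (le_trans (ler_normD _ _)); apply: lerD => //.
rewrite normrM; case: eqP => _; rewrite ?normr1 ?normr0 ?mulr1 ?mulr0//.
exact: le_trans xih h1.
Qed.

(** Second-order expansion with a remainder uniform over the cell: the mean value
theorem reduces it to the Lipschitz bound dirpow_lip for the derivative. *)
Lemma dirpow_quad (m : nat) (g : Z -> R) c (S : R) : Cb_prod m g -> 0 <= S ->
  exists2 C, 0 <= C & forall (p z : Z) (h : R), `|h| <= 1 ->
   (forall c', `|pcoord (z - p) c'| <= S) ->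
   `|dirpow m g p (pcoord (z + h *: dir R c - p)) - dirpow m g p (pcoord (z - p))
     - h * (m%:R * dirpow m.-1 ('D_(dir R c) g) p (pcoord (z - p)))| <= C * `|h| ^+ 2.
Proof.
move=> + S0; case: m => [|m] H.
  by exists 0 => // p z h _ _; rewrite subrr mul0r mulr0 subrr normr0 mul0r.
have [C C0 HC] := dirpow_lip c (Cb_prod_derive c H) S0.
exists (m.+1%:R * C); first by rewrite mulr_ge0.
move=> p z h h1 zp.
have dd (t : R) c' : is_derive t (1:R) (fun s => pcoord (z + s *: dir R c - p) c') (c' == c)%:R.
  rewrite (_ : (fun _ => _) = (fun s => pcoord (z - p) c' + s * (c' == c)%:R)); last first.
    by apply/funext => s; rewrite !(pcoordB, pcoordD) pcoordZ pcoord_dir; ring.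
  apply: is_derive_eq (is_deriveD (is_derive_cst (pcoord (z - p) c') t 1)
    (is_derive_mul (is_derive_id t 1) (is_derive_cst ((c' == c)%:R : R) t 1))) _.
  by rewrite /= mulr0 add0r mulr1 add0r.
have [xi] := MVT_line 0 h (fun t => is_derive_dirpow p H (dd t)).
rewrite !subr0 scale0r addr0 [m.+1.-1]/= => xih ->; rewrite -mulrBr -mulrBr.
have L := HC p z xi (le_trans xih h1) zp.
rewrite !normrM (ger0_norm (ler0n R _)).
have -> : m.+1%:R * C * `|h| ^+ 2 = `|h| * (m.+1%:R * (C * `|h|)) by ring.
rewrite !ler_wpM2l//; apply: le_trans L _; by rewrite ler_wpM2l.
Qed.

(** Differentiation under the mean. The expansion dirpow_quad is uniform on the
cell, so that it can be averaged. *)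
Lemma avg_dirpow_derive (m : nat) (g : Z -> R) c z : Cb_prod m g ->
  is_derive z (dir R c) (fun z => avg (fun p => dirpow m g p (pcoord (z - p))))
    (m%:R * avg (fun p => dirpow m.-1 ('D_(dir R c) g) p (pcoord (z - p)))).
Proof.
move=> H.
have H' : m%:R != 0 :> R -> Cb_prod m.-1 ('D_(dir R c) g).
  by case: m H => [|m] H; rewrite ?eqxx// => _; apply: Cb_prod_derive.
(* A bound on the coordinates of z - p for p in the cell. *)
pose S := \sum_c' ((1 + `|w * pcoord z c' - (a c')%:~R|) / w).
have S0' c' : 0 <= (1 + `|w * pcoord z c' - (a c')%:~R|) / w.
  by rewrite divr_ge0 ?addr_ge0// ltW.
have S0 : 0 <= S by apply: sumr_ge0.
have [C C0 HC] := dirpow_quad c H S0.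
have [m0|m0] := eqVneq (m%:R : R) 0.
  have {}m0 : m = 0%N by apply/eqP; rewrite -(pnatr_eq0 R) m0.
  rewrite m0 mul0r; exact: (is_derive_cst (avg g) z (dir R c)).
have cont m' g' z' : Cb_prod m' g' -> continuous (fun p => dirpow m' g' p (pcoord (z' - p))).
  exact: dirpow_continuous.
apply/is_derive_epsP => e e0.
exists (Num.min 1 (e / (C + 1))).
  by rewrite lt_min ltr01 divr_gt0// ltr_wpDl.
move=> h; rewrite lt_min => /andP[h1 he].
set f1 := fun p => dirpow m g p (pcoord (z + h *: dir R c - p)).
set f0 := fun p => dirpow m g p (pcoord (z - p)).
set f2 := fun p => dirpow m.-1 ('D_(dir R c) g) p (pcoord (z - p)).
have c1 : continuous f1 by exact: cont.
have c0 : continuous f0 by exact: cont.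
have c2 : continuous f2 by apply: cont; exact: H'.
have c10 : continuous (fun p => 1 * f1 p + (-1) * f0 p).
  by move=> p; apply: cvgD; apply: (@continuousM R Z); try exact: cvg_cst; [exact: c1|exact: c0].
have -> : avg f1 - avg f0 - h * (m%:R * avg f2) =
   avg (fun p => 1 * (1 * f1 p + (-1) * f0 p) + (- (h * m%:R)) * f2 p).
  by rewrite avg_lin// avg_lin//; ring.
apply: (@le_trans _ _ (C * `|h| ^+ 2)).
  apply: avg_bound => [p|p pc].
    apply: cvgD; apply: (@continuousM R Z); try exact: cvg_cst; [exact: c10|exact: c2].
  have -> : 1 * (1 * f1 p + -1 * f0 p) + - (h * m%:R) * f2 p =
     f1 p - f0 p - h * (m%:R * f2 p) by ring.
  apply: HC; first exact: ltW.
  move=> c'; apply: (le_trans (cell_dist z (pc c'))).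
  by rewrite /S (bigD1 c')//= lerDl sumr_ge0.
rewrite expr2 mulrA ler_wpM2r//.
have C1 : 0 < C + 1 by rewrite ltr_wpDl.
move: he; rewrite ltr_pdivlMr// => he; rewrite mulrC; apply/ltW; apply: le_lt_trans he.
by rewrite ler_wpM2l// lerDl.
Qed.

Lemma taylor_continuous N g z : Cb_prod N g -> continuous (fun p => taylor N g p (pcoord (z - p))).
Proof.
move=> H; apply: (@continuous_bigsum R Z) => m p; apply: (@continuousM R Z); last exact: cvg_cst.
by apply: dirpow_continuous; apply: Cb_prodW H; rewrite -ltnS.
Qed.

Lemma avg_taylorE N g z : Cb_prod N g ->
  avg (fun p => taylor N g p (pcoord (z - p))) =
  \sum_(m < N.+1) m`!%:R^-1 * avg (fun p => dirpow m g p (pcoord (z - p))).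
Proof.
move=> H; rewrite -(@avg_sum _ _ (fun m : 'I_N.+1 => m`!%:R^-1) (fun m p => dirpow m g p (pcoord (z - p)))).
  by congr avg; apply/funext => p; apply: eq_bigr => m _; rewrite mulrC.
by move=> m; apply: dirpow_continuous; apply: Cb_prodW H; rewrite -ltnS.
Qed.

(** The derivative in z of the degree m term of the polynomial of g is the degree
m - 1 term of the polynomial of d_c g, because the factor m cancels against m!.
Hence the result is again a Taylor polynomial, of a degree lower by one. *)
Lemma avg_taylor_derive N g c z : Cb_prod N.+1 g ->
  is_derive z (dir R c) (fun z => avg (fun p => taylor N.+1 g p (pcoord (z - p))))
    (avg (fun p => taylor N ('D_(dir R c) g) p (pcoord (z - p)))).
Proof.
move=> H; rewrite (avg_taylorE _ (Cb_prod_derive c H)).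
rewrite (_ : (fun z => _) = (fun z => \sum_(m < N.+2) m`!%:R^-1 * avg (fun p => dirpow m g p (pcoord (z - p))))); last first.
  by apply/funext => z'; exact: avg_taylorE.
rewrite [X in is_derive _ _ _ X](_ : _ = \sum_(m < N.+2) m`!%:R^-1 *
   (m%:R * avg (fun p => dirpow m.-1 ('D_(dir R c) g) p (pcoord (z - p))))); last first.
  rewrite [RHS]big_ord_recl/= mul0r mulr0 add0r; apply: eq_bigr => m _.
  rewrite /bump/= !add1n factS natrM.
  have f0 : m`!%:R != 0 :> R by rewrite pnatr_eq0 -lt0n fact_gt0.
  have m0 : m.+1%:R != 0 :> R by rewrite pnatr_eq0.
  by rewrite invfM mulrACA mulVf// mul1r.
apply: is_derive_bigsum => m; apply: is_derive_scale; apply: avg_dirpow_derive.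
by apply: Cb_prodW H; rewrite -ltnS.
Qed.

End average.

(** The operator integrates over x and then over y; the operator avg integrates
over the coordinates in the same order. *)
Lemma box_integral_avg (R : realType) (d : nat) (w : R) (k : int) (m : {ffun 'I_d -> int})
  (g : R * 'rV[R]_d -> R) :
  w ^+ d.+1 * \int[lebesgue_measure]_(u in `[k%:~R / w, (k%:~R + 1) / w])
     box_integral (\row_i ((m i)%:~R / w)) (\row_i (((m i)%:~R + 1) / w))
       (fun v => g (u, v)) = avg w (icoord (k, m)) g.
Proof.
rewrite /avg; congr (_ * _); rewrite [RHS]/= /int_pcoord; apply: eq_Rintegral => u _.
rewrite /box_integral [set_pcoord _ _ _]/=.
elim: (enum 'I_d) (0 : 'rV[R]_d) => [|i s IH] v //=.
rewrite /int_pcoord /clow /chigh /= !mxE; apply: eq_Rintegral => t _; exact: IH.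
Qed.

(** * Termwise differentiation of the sampling series *)

Section weights.
Variables (R : realType) (d : nat).
Local Notation Z := (R * 'rV[R]_d)%type.
Local Notation O := (option 'I_d).

Lemma le_sum_prod_weight (t : O -> R) :
  \sum_c (1 + `|t c|) <= (d.+1)%:R * \prod_c (1 + `|t c|).
Proof.
have h c : 1 + `|t c| <= \prod_c (1 + `|t c|).
  rewrite [leRHS](bigD1 c)//= ler_peMr ?addr_ge0//.
  elim/big_rec: _ => // i x _ x1; apply: mulr_ege1 => //.
  by rewrite lerDl.
apply: (@le_trans _ _ (\sum_(c : O) \prod_c (1 + `|t c|))).
  by apply: ler_sum => c _; exact: h.
by rewrite sumr_const card_option card_ord -[leLHS]mulr_natl.
Qed.

(** Displacements within a cell grow like the distance, in units of 1 / w, from w z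
to the corner of the cell; this is what the kernel weights absorb. The powers of w
are kept explicit, since in the limit they are compensated by w^(N+1). *)
Lemma cell_weight (w : R) (a : O -> int) (p z : Z) m D : 0 < w -> (m <= D)%N ->
  (forall c, clow w a c <= pcoord p c <= chigh w a c) ->
  (\sum_c `|pcoord (z - p) c|) ^+ m <=
  (d.+1)%:R ^+ m / w ^+ m * \prod_c weight D (w * pcoord z c - (a c)%:~R).
Proof.
move=> w0 mD pc.
set t := fun c => w * pcoord z c - (a c)%:~R.
apply: (@le_trans _ _ (((d.+1)%:R / w * \prod_c (1 + `|t c|)) ^+ m)).
  apply: lerXn2r; rewrite ?nnegrE.
  - exact: sumr_ge0.
  - by rewrite mulr_ge0// ?divr_ge0 ?prodr_ge0 ?(ltW w0)// => c _; rewrite addr_ge0.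
  apply: (@le_trans _ _ (\sum_c (1 + `|t c|) / w)).
    by apply: ler_sum => c _; exact: cell_dist.
  rewrite -mulr_suml mulrAC ler_wpM2r ?invr_ge0 ?(ltW w0)//.
  exact: le_sum_prod_weight.
rewrite exprMn expr_div_n ler_wpM2l ?divr_ge0 ?exprn_ge0 ?(ltW w0)//.
rewrite -prodrXl; apply: ler_prod => c _; rewrite exprn_ge0 ?addr_ge0//=.
by rewrite /weight ler_weXn2l// lerDl.
Qed.

Lemma avg_taylor_bound (w : R) N D (g : Z -> R) : 0 < w -> (N <= D)%N -> Cb_prod N g ->
  exists2 C, 0 <= C & forall (a : O -> int) z,
    `|avg w a (fun p => taylor N g p (pcoord (z - p)))| <=
    C * \prod_c weight D (w * pcoord z c - (a c)%:~R).
Proof.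
move=> w0 ND H; have [C C0 HC] := dbound_exists H.
exists (\sum_(m < N.+1) C * ((d.+1)%:R ^+ m / w ^+ m) / m`!%:R).
  by apply: sumr_ge0 => m _; rewrite !(mulr_ge0, invr_ge0, exprn_ge0)// ltW.
move=> a z; apply: (avg_bound w0); first exact: taylor_continuous.
move=> p pc; rewrite /taylor; apply: (le_trans (ler_norm_sum _ _ _)).
rewrite mulr_suml; apply: ler_sum => m _.
have mN : (m <= N)%N by rewrite -ltnS.
rewrite normrM [`|_^-1|]ger0_norm ?invr_ge0// mulrAC ler_wpM2r ?invr_ge0//.
apply: (le_trans (dirpow_bound _ _ (dboundW mN HC))).
rewrite -mulrA ler_wpM2l//; apply: cell_weight => //.
exact: leq_trans mN ND.
Qed.

End weights.

(** A segment around z in a coordinate direction is bounded, so that the tails in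
prod_weight_tail_box are uniform along it. *)
Lemma line_coord_bound (R : realType) (d : nat) (w : R) (z : R * 'rV[R]_d)
  (c c' : option 'I_d) (t : R) : `|t| <= 1 ->
  `|w * pcoord (z + t *: dir R c) c'| <= \sum_c' `|w| * (`|pcoord z c'| + 1).
Proof.
move=> t1; apply: (@le_trans _ _ (`|w| * (`|pcoord z c'| + 1))).
  rewrite normrM ler_wpM2l// pcoordD pcoordZ pcoord_dir.
  apply: (le_trans (ler_normD _ _)); rewrite lerD2l normrM.
  by case: eqP => _; rewrite ?normr1 ?normr0 ?mulr1 ?mulr0.
rewrite [leRHS](bigD1 c')//= lerDl.
by apply: sumr_ge0 => i _; rewrite mulr_ge0// addr_ge0.
Qed.

Lemma tail_add (R : realType) (T : choiceType) (a b : T -> R) (s t1 t2 t : seq T) :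
  {subset t1 <= t} -> {subset t2 <= t} ->
  \sum_(x <- s | x \notin t) `|a x + b x| <=
  \sum_(x <- s | x \notin t1) `|a x| + \sum_(x <- s | x \notin t2) `|b x|.
Proof.
move=> s1 s2; rewrite [in leRHS]big_mkcond [X in _ <= _ + X]big_mkcond -big_split/=.
rewrite big_mkcond/=; apply: ler_sum => x _.
case: ifPn => [xN|_]; last by rewrite addr_ge0//; case: ifP.
rewrite !ifT; first exact: ler_normD.
  by apply: contraNN xN; exact: s2.
by apply: contraNN xN; exact: s1.
Qed.

Section kernel_products.
Variables (R : realType) (d : nat) (chi : option 'I_d -> R -> R).

Definition kernel_prod (w : R) (x : int * {ffun 'I_d -> int}) (z : R * 'rV[R]_d) : R :=
  \prod_c chi c (w * pcoord z c - (icoord x c)%:~R).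

(** The link between the terms of the sampling series and the sums of products of
tame kernels. *)
Lemma kernel_prod_weight D w x z :
  `|kernel_prod w x z| * \prod_c weight D (w * pcoord z c - (icoord x c)%:~R) =
  prod_weight D chi (fun c => w * pcoord z c) x.
Proof. by rewrite /prod_weight /kernel_prod normr_prod -big_split/=; apply: eq_bigr => c _; rewrite mulrC. Qed.

End kernel_products.

Section operator_series.
Variables (R : realType) (d n : nat).
Local Notation Z := (R * 'rV[R]_d)%type.
Local Notation O := (option 'I_d).
Local Notation T := (int * {ffun 'I_d -> int})%type.
Variables (chi : O -> R -> R) (f : Z -> R).
Hypothesis chi_der : forall c a (t : R), (a < n)%N ->
  is_derive t (1:R) ((chi c)^`(a)) ((chi c)^`(a.+1) t).
Hypothesis chi_tame : forall c a, (a <= n)%N -> tame n.+1 ((chi c)^`(a)).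
Hypothesis f_Cb : Cb_prod n.+1 f.
Implicit Types (J I : O -> nat) (c : O) (z : Z) (x : T).

Definition deriv_family J : O -> R -> R := fun c => ((chi c)^`(J c))%classic.

Definition taylor_avg (w : R) I x z : R :=
  avg w (icoord x) (fun p => taylor (n - osize I) (dpart I f) p (pcoord (z - p))).

Definition series_term (w : R) J I x z : R := w ^+ osize J * kernel_prod (deriv_family J) w x z * taylor_avg w I x z.

(** The series obtained when, of the derivatives of the operator, those counted by J
have fallen on the kernels and those counted by I on the Taylor polynomial. The
degree n - |I| decreases with every derivative of the polynomial. *)
Definition opseries (w : R) J I z : R := zsum (fun x => series_term w J I x z).

Lemma Cb_dpart I m : (osize I + m <= n.+1)%N -> Cb_prod m (dpart I f).
Proof.
move=> H; apply: Cb_prod_pderivs; apply: Cb_prodW f_Cb.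
by rewrite size_coords -osizeE.
Qed.

Lemma dpart_inc I c : (osize I <= n)%N -> 'D_(dir R c) (dpart I f) = dpart (inc c I) f.
Proof.
move=> H; rewrite -[LHS]/(pderivs (c :: coords (I None) (fun i => I (Some i))) f).
rewrite (pderivs_dpart f_Cb)/=; last by rewrite size_coords -osizeE ltnS.
congr (dpart _ _); apply/funext => c'; rewrite /cnt/= /inc addnC eq_sym; congr addn.
rewrite -/(cnt (coords (I None) (fun i => I (Some i))) c') cnt_coords.
by case: c'.
Qed.

(** The Taylor polynomial on a cell has polynomial growth of degree at most n in the
distance to the cell, hence is dominated by the weight of degree n + 1. *)
Lemma series_term_bound w J I : 0 < w -> (osize I <= n)%N -> exists2 C, 0 <= C &
  forall x z, `|series_term w J I x z| <= C * prod_weight n.+1 (deriv_family J) (fun c => w * pcoord z c) x.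
Proof.
move=> w0 In.
have h1 : (n - osize I <= n.+1)%N by lia.
have h2 : Cb_prod (n - osize I) (dpart I f) by apply: Cb_dpart; lia.
have [C C0 HC] := avg_taylor_bound w0 h1 h2.
exists (w ^+ osize J * C); first by rewrite mulr_ge0// exprn_ge0// ltW.
move=> x z; rewrite -kernel_prod_weight /series_term 2!normrM ger0_norm ?exprn_ge0 ?(ltW w0)//.
rewrite -!mulrA ler_wpM2l ?exprn_ge0 ?(ltW w0)// [leRHS]mulrCA ler_wpM2l//.
exact: HC.
Qed.

Lemma le_osize J c : (osize J <= n)%N -> (J c <= n)%N.
Proof. by move=> Jn; exact: leq_trans (leq_osize J c) Jn. Qed.

Lemma series_term_summable w J I z : 0 < w -> (osize J <= n)%N -> (osize I <= n)%N ->
  exists M, forall N, \sum_(x <- lbox d N) `|series_term w J I x z| <= M.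
Proof.
move=> w0 Jn In; have [C C0 HC] := series_term_bound J w0 In.
have [M M0 HM] := prod_weight_bound (fun c => chi_tame c (le_osize c Jn)).
exists (C * M) => N; apply: (@le_trans _ _ (\sum_(x <- lbox d N) C * prod_weight n.+1 (deriv_family J) (fun c => w * pcoord z c) x)).
  by apply: ler_sum => x _.
by rewrite -mulr_sumr ler_wpM2l.
Qed.

Lemma series_term_tail w J I (e S : R) : 0 < w -> (osize J <= n)%N -> (osize I <= n)%N -> 0 < e ->
  exists N0, forall N z, (forall c, `|w * pcoord z c| <= S) ->
  \sum_(x <- lbox d N | x \notin lbox d N0) `|series_term w J I x z| <= e.
Proof.
move=> w0 Jn In e0; have [C C0 HC] := series_term_bound J w0 In.
have C1 : 0 < C + 1 by rewrite ltr_wpDl.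
have e1 : 0 < e / (C + 1) by rewrite divr_gt0.
have [N0 H0] := prod_weight_tail_box (fun c => chi_tame c (le_osize c Jn)) S e1.
exists N0 => N z zS.
apply: (@le_trans _ _ (\sum_(x <- lbox d N | x \notin lbox d N0) (C + 1) * prod_weight n.+1 (deriv_family J) (fun c => w * pcoord z c) x)).
  apply: ler_sum => x _; apply: (le_trans (HC x z)); rewrite ler_wpM2r ?prod_weight_ge0//.
  by rewrite lerDl.
by rewrite -mulr_sumr mulrC -ler_pdivlMr//; apply: H0.
Qed.

Lemma kernel_prod_derive w J x z c : (J c < n)%N ->
  is_derive z (dir R c) (kernel_prod (deriv_family J) w x) (w * kernel_prod (deriv_family (inc c J)) w x z).
Proof.
move=> Jc; pose P := \prod_(c' | c' != c) ((chi c')^`(J c'))%classic (w * pcoord z c' - (icoord x c')%:~R).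
have E (h : R) : kernel_prod (deriv_family J) w x (z + h *: dir R c) =
   P * ((chi c)^`(J c))%classic (w * pcoord z c - (icoord x c)%:~R + h * w).
  rewrite /kernel_prod /deriv_family (bigD1 c)//= mulrC; congr (_ * _).
    apply: eq_bigr => c' cc; rewrite pcoordD pcoordZ pcoord_dir.
    by rewrite (negbTE cc) mulr0 addr0.
  rewrite pcoordD pcoordZ pcoord_dir eqxx.
  by have -> : w * (pcoord z c + h * 1) - (icoord x c)%:~R = w * pcoord z c - (icoord x c)%:~R + h * w by ring.
have E' : kernel_prod (deriv_family (inc c J)) w x z = P * ((chi c)^`((J c).+1))%classic (w * pcoord z c - (icoord x c)%:~R).
  rewrite /kernel_prod /deriv_family (bigD1 c)//= mulrC; congr (_ * _).
    by apply: eq_bigr => c' cc; rewrite /inc (negbTE cc) addn0.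
  by rewrite /inc eqxx addn1.
have E0 : kernel_prod (deriv_family J) w x z = P * ((chi c)^`(J c))%classic (w * pcoord z c - (icoord x c)%:~R).
  by have := E 0; rewrite scale0r addr0 mul0r addr0.
have K0 : 0 < `|P| * `|w| + 1 by rewrite ltr_wpDl// mulr_ge0.
apply/is_derive_epsP => e e0.
have e1 : 0 < e / (`|P| * `|w| + 1) by rewrite divr_gt0.
have [del del0 Hd] := (is_derive_epsP _ _ _ _).1 (chi_der c (w * pcoord z c - (icoord x c)%:~R) Jc) _ e1.
exists (del / (`|w| + 1)); first by rewrite divr_gt0// ltr_wpDl.
move=> h; rewrite ltr_pdivlMr ?ltr_wpDl// => hd.
have := Hd (h * w); rewrite [(h * w) *: 1]mulr1 => H.
rewrite E E0 E'.
set A := _ (_ + h * w) in H *; set B := _ (w * _ - _) in H *; set A' := _ (w * _ - _) in H *.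
have -> : P * A - P * B - h * (w * (P * A')) = P * (A - B - h * w * A') by ring.
rewrite normrM; apply: (@le_trans _ _ (`|P| * (e / (`|P| * `|w| + 1) * `|h * w|))).
  rewrite ler_wpM2l//; apply: H; rewrite normrM; apply: le_lt_trans hd.
  by rewrite ler_wpM2l// lerDl.
rewrite normrM.
have -> : `|P| * (e / (`|P| * `|w| + 1) * (`|h| * `|w|)) =
  (e * `|h|) * ((`|P| * `|w|) / (`|P| * `|w| + 1)).
  by field; rewrite gt_eqF.
rewrite ler_piMr ?mulr_ge0 ?(ltW e0)// ler_pdivrMr// mul1r; lra.
Qed.

Lemma taylor_avg_derive w I x z c : 0 < w -> (osize I < n)%N ->
  is_derive z (dir R c) (taylor_avg w I x) (taylor_avg w (inc c I) x z).
Proof.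
move=> w0 In; rewrite /taylor_avg -dpart_inc ?(ltnW In)// osize_inc.
have -> : (n - osize I = (n - (osize I).+1).+1)%N by lia.
apply: avg_taylor_derive => //; apply: Cb_dpart; lia.
Qed.

Lemma series_term_derive w J I x z c : 0 < w -> (osize J + osize I < n)%N ->
  is_derive z (dir R c) (series_term w J I x) (series_term w (inc c J) I x z + series_term w J (inc c I) x z).
Proof.
move=> w0 JIn.
have Jc : (J c < n)%N by have := leq_osize J c; lia.
have In : (osize I < n)%N by lia.
have d1 := kernel_prod_derive w x z Jc.
have d2 := taylor_avg_derive x z c w0 In.
apply: is_derive_eq (is_derive_mul (is_derive_scale (w ^+ osize J) d1) d2) _.
rewrite /series_term osize_inc exprS; ring.
Qed.

(** The product rule in one term, and termwise differentiation along the line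
through z in direction c: the tails of both derived series are uniform for
parameters in [-1, 1]. *)
Lemma opseries_derive w J I z c : 0 < w -> (osize J + osize I < n)%N ->
  is_derive z (dir R c) (opseries w J I) (opseries w (inc c J) I z + opseries w J (inc c I) z).
Proof.
move=> w0 JIn.
have b1 : (osize (inc c J) <= n)%N by rewrite osize_inc; lia.
have b2 : (osize J <= n)%N by lia.
have b3 : (osize (inc c I) <= n)%N by rewrite osize_inc; lia.
have b4 : (osize I <= n)%N by lia.
pose g (s : R) := opseries w (inc c J) I (z + s *: dir R c) + opseries w J (inc c I) (z + s *: dir R c).
have g0 : g 0 = opseries w (inc c J) I z + opseries w J (inc c I) z.
  by rewrite /g (line0 z (dir R c)).
apply: is_derive_line0; rewrite -g0.
apply: (@is_derive_uniform_limit R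
  (fun N s => \sum_(x <- lbox d N) series_term w J I x (z + s *: dir R c))
  (fun N s => \sum_(x <- lbox d N) (series_term w (inc c J) I x (z + s *: dir R c) + series_term w J (inc c I) x (z + s *: dir R c)))
  _ g).
- move=> N t; apply: is_derive_bigsum => x; apply: (is_derive_line _ _ _ _ _).1.
  exact: series_term_derive.
- move=> t; have [M HM] := series_term_summable (z + t *: dir R c) w0 b2 b4.
  by rewrite /opseries; exact: (zsum_cvg (exhaustion_lbox d) HM).
- move=> t; have [M HM] := series_term_summable (z + t *: dir R c) w0 b1 b4.
  have [M' HM'] := series_term_summable (z + t *: dir R c) w0 b2 b3.
  rewrite (_ : (fun N => _) = (fun N => \sum_(x <- lbox d N) series_term w (inc c J) I x (z + t *: dir R c) +
    \sum_(x <- lbox d N) series_term w J (inc c I) x (z + t *: dir R c))).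
    by rewrite /g /opseries; apply: cvgD; [exact: (zsum_cvg (exhaustion_lbox d) HM)|exact: (zsum_cvg (exhaustion_lbox d) HM')].
  by apply/funext => N; rewrite big_split.
- move=> e e0; have e20 : 0 < e / 2 by lra.
  pose S := \sum_c' `|w| * (`|pcoord z c'| + 1).
  have [N1 H1] := series_term_tail S w0 b1 b4 e20.
  have [N2 H2] := series_term_tail S w0 b2 b3 e20.
  exists (maxn N1 N2) => N t NN; rewrite subr0 => t1.
  have zS c' : `|w * pcoord (z + t *: dir R c) c'| <= S.
    exact: line_coord_bound.
  have [ub mb _] := exhaustion_lbox d.
  rewrite (big_subseq_split _ (ub (maxn N1 N2)) (ub N) (mb _ _ NN)) addrAC subrr add0r.
  apply: le_trans (ler_norm_sum _ _ _) _.
  have -> : e = e / 2 + e / 2 by field.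
  apply: le_trans (lerD (H1 N _ zS) (H2 N _ zS)).
  exact: tail_add (mb _ _ (leq_maxl _ _)) (mb _ _ (leq_maxr _ _)).
Qed.

Lemma is_derive_leibniz2 (s : seq O) (F : (O -> nat) -> (O -> nat) -> Z -> R)
  (dF : (O -> nat) -> (O -> nat) -> R) (z v : Z) :
  (forall J I, (osize J + osize I = size s)%N -> is_derive z v (F J I) (dF J I)) ->
  is_derive z v (fun z => leibniz2 s (fun J I => F J I z)) (leibniz2 s dF).
Proof.
elim: s F dF => [|c s IH] F dF H /=; first by apply: H; rewrite osize0.
apply: (IH (fun J I z => F (inc c J) I z + F J (inc c I) z) (fun J I => dF (inc c J) I + dF J (inc c I))).
move=> J I JI.
have d1 : is_derive z v (F (inc c J) I) (dF (inc c J) I) by apply: H; rewrite osize_inc/= -JI.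
have d2 : is_derive z v (F J (inc c I)) (dF J (inc c I)).
  by apply: H; rewrite osize_inc/= -JI addnS.
exact: is_deriveD.
Qed.

(** The existence of the partial derivatives and their value are proved together,
since each derivative is taken of the previous value. *)
Lemma opseries_pderivs w (s : seq O) : 0 < w -> (size s <= n)%N ->
  pderivable s (opseries w (zeroI (d := d)) (zeroI (d := d))) /\
  pderivs s (opseries w (zeroI (d := d)) (zeroI (d := d))) = (fun z => leibniz2 s (fun J I => opseries w J I z)).
Proof.
move=> w0; elim: s => [|c s IH] sn; first by split.
have [pd E] := IH (ltnW sn).
have D z : is_derive z (dir R c) (pderivs s (opseries w (zeroI (d := d)) (zeroI (d := d))))
   (leibniz2 (c :: s) (fun J I => opseries w J I z)).
  rewrite E; apply: (is_derive_leibniz2 (dF := fun J I => opseries w (inc c J) I z + opseries w J (inc c I) z)).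
  by move=> J I JI; apply: opseries_derive; rewrite // JI.
split; first by split=> // z; have [] := D z.
by apply/funext => z; have [_] := D z.
Qed.

End operator_series.

(** * The Kantorovich operator as a sampling series *)

Section taylor_expansion.
Variables (R : realType) (d : nat).
Local Notation Z := (R * 'rV[R]_d)%type.
Local Notation O := (option 'I_d).

Lemma taylor_expand N (g : Z -> R) p h : Cb_prod N g ->
  taylor N g p h =
  \sum_(l < N.+1) \sum_(j : {ffun 'I_d -> 'I_N.+1} | (l + mdeg (mi j) <= N)%N)
    (l`! * mfact (mi j))%:R^-1 * (opow h (ojoin l (mi j)) * partial l (mi j) g p).
Proof.
move=> H; rewrite /taylor.
transitivity (\sum_(m < N.+1) \sum_(l < N.+1) \sum_(j : {ffun 'I_d -> 'I_N.+1} | (l + mdeg (mi j) == m)%N)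
    (l`! * mfact (mi j))%:R^-1 * (opow h (ojoin l (mi j)) * partial l (mi j) g p)).
  apply: eq_bigr => m _; apply: dirpow_partial => //.
  by apply: Cb_prodW H; rewrite -ltnS.
rewrite exchange_big/=; apply: eq_bigr => l _.
rewrite (exchange_big_dep (fun j => (l + mdeg (mi j) <= N)%N))/=; last first.
  by move=> m j _ /eqP ->; rewrite -ltnS.
apply: eq_bigr => j lj; rewrite -ltnS in lj.
by rewrite (big_pred1 (Ordinal lj))// => m; rewrite eq_sym.
Qed.

Lemma opow_ojoin (z p : Z) l (j : 'I_d -> nat) :
  opow (pcoord (z - p)) (ojoin l j) = (z.1 - p.1) ^+ l * mpow (z.2 - p.2) j.
Proof. by rewrite /opow big_option. Qed.

Lemma continuous_mul (f g : Z -> R) : continuous f -> continuous g ->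
  continuous (fun z => f z * g z).
Proof. by move=> cf cg z; apply: (@continuousM R Z); [exact: cf|exact: cg]. Qed.

Lemma opowN_continuous z J : continuous (fun p : Z => opow (pcoord (z - p)) J).
Proof.
have -> : (fun p : Z => opow (pcoord (z - p)) J) = (fun p => (-1) ^+ osize J * opow (pcoord (p - z)) J).
  apply/funext => p; rewrite /opow /osize -prodrXr -big_split/=; apply: eq_bigr => c _.
  by rewrite -exprMn mulN1r -pcoordN opprB.
apply: continuous_mul; first by move=> p; exact: cvg_cst.
exact: opow_continuous.
Qed.

Variables (n : nat) (phi : R -> R) (psi : 'I_d -> R -> R) (f : Z -> R).
Hypothesis f_Cb : Cb_prod n.+1 f.

(** The kernels of all coordinates as one family, so that x and y_1, ..., y_d are
treated alike. *)
Definition kernel_family : O -> R -> R := fun c => if c is Some i then psi i else phi.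

Hypothesis chi_tame : forall c, tame n.+1 (kernel_family c).

(** The operator is defined by iterated sums, and as a sum of integrals of
monomials. Fubini's theorem for sums and linearity of the mean give the form in
which it is differentiated. *)
Lemma kantorovich_opseries w z : 0 < w ->
  kantorovich n phi psi w f z = opseries n kernel_family f w (zeroI (d := d)) (zeroI (d := d)) z.
Proof.
move=> w0.
have o0 : (osize (zeroI (d := d)) <= n)%N by rewrite osize0.
have ht c a : (a <= 0)%N -> tame n.+1 ((kernel_family c)^`(a)).
  by case: a => // _; exact: chi_tame.
have [M HM] : exists M, forall N, \sum_(x <- lbox d N) `|series_term n kernel_family f w (zeroI (d := d)) (zeroI (d := d)) x z| <= M.
  have [C C0 HC] := series_term_bound kernel_family f_Cb (zeroI (d := d)) w0 o0.
  have [M M0 HM] := prod_weight_bound (chi := fun c => (kernel_family c)^`(0)%classic) chi_tame.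
  exists (C * M) => N; apply: (@le_trans _ _ (\sum_(x <- lbox d N) C * prod_weight n.+1 (deriv_family kernel_family (zeroI (d := d))) (fun c => w * pcoord z c) x)).
    by apply: ler_sum => x _; exact: HC.
  by rewrite -mulr_sumr ler_wpM2l.
rewrite /opseries -(zsum_fubini exhaustion_zbox (exhaustion_fbox d) HM) /kantorovich.
congr zsum; apply/funext => k; congr zsum; apply/funext => m.
rewrite /series_term osize0 expr0 mul1r; congr (_ * _); first by rewrite /kernel_prod big_option.
rewrite /taylor_avg osize0 subn0.
have d0 : dpart (zeroI (d := d)) f = f.
  rewrite -(pderivs_dpart (s := [::]) f_Cb)//.
rewrite d0.
pose Ix := ('I_n.+1 * {ffun 'I_d -> 'I_n.+1})%type.
(* The integrands, extended by 0 to the pairs of indices of size beyond n. *)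
pose F (lj : 'I_n.+1 * {ffun 'I_d -> 'I_n.+1}) (p : Z) : R :=
  if (lj.1 + mdeg (mi lj.2) <= n)%N then
    partial lj.1 (mi lj.2) f p * (z.1 - p.1) ^+ lj.1 * mpow (z.2 - p.2) (mi lj.2) else 0.
have FE (lj : Ix) (p : Z) : (lj.1 + mdeg (mi lj.2) <= n)%N ->
    F lj p = partial lj.1 (mi lj.2) f p * opow (pcoord (z - p)) (ojoin lj.1 (mi lj.2)).
  by move=> h; rewrite /F h opow_ojoin mulrA.
have cF (lj : Ix) : continuous (F lj).
  case h : (lj.1 + mdeg (mi lj.2) <= n)%N; last first.
    by rewrite (_ : F lj = cst 0)//; [move=> p; exact: cvg_cst|apply/funext => p; rewrite /F h].
  rewrite (_ : F lj = fun p => partial lj.1 (mi lj.2) f p * opow (pcoord (z - p)) (ojoin lj.1 (mi lj.2))); last first.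
    by apply/funext => p; exact: FE.
  apply: continuous_mul; last exact: opowN_continuous.
  apply: (@Cb_prod_continuous _ _ 0); apply: Cb_prod_pderivs; apply: Cb_prodW f_Cb.
  by rewrite size_coords addn0 ltnW// ltnS.
transitivity (\sum_(lj : 'I_n.+1 * {ffun 'I_d -> 'I_n.+1})
   (lj.1`! * mfact (mi lj.2))%:R^-1 * avg w (icoord (k, m)) (F lj)).
  rewrite pair_big_dep/= big_mkcond/=; apply: eq_bigr => -[l j] _ /=.
  case: ifP => h.
    congr (_ * _); rewrite -(box_integral_avg w k m).
    congr (_ * _); apply: eq_Rintegral => u _; congr box_integral.
    by apply/funext => v; rewrite /F/= h.
  rewrite (_ : F _ = fun p => 0 * F (l, j) p + 0 * F (l, j) p); last first.
    by apply/funext => p; rewrite /F /= h; ring.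
  by rewrite avg_lin// !mul0r addr0 mulr0.
rewrite -avg_sum//; congr avg; apply/funext => p.
rewrite (taylor_expand _ _ (Cb_prodW (leqnSn n) f_Cb)) pair_big_dep/= [RHS]big_mkcond/=.
apply: eq_bigr => -[l j] _ /=; case: ifP => h; last by rewrite /F/= h mulr0.
by rewrite FE//= [X in _ * X]mulrC.
Qed.

End taylor_expansion.

(** * The limit of one Leibniz term *)

Section product_series.
Variables (R : realType) (d : nat).
Local Notation Z := (R * 'rV[R]_d)%type.
Local Notation O := (option 'I_d).

Lemma cvg_prod (I : Type) (r : seq I) (u : I -> nat -> R) (l : I -> R) :
  (forall i, u i N @[N --> \oo] --> l i) ->
  \prod_(i <- r) u i N @[N --> \oo] --> \prod_(i <- r) l i.
Proof.
move=> ul; elim: r => [|i r IH].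
  rewrite big_nil (_ : (fun _ => _) = cst 1); first exact: cvg_cst.
  by apply/funext => N; rewrite big_nil.
rewrite big_cons (_ : (fun _ => _) = (fun N => u i N * \prod_(j <- r) u j N)).
  by apply: cvgM.
by apply/funext => N; rewrite big_cons.
Qed.

(** Absolutely convergent series multiply: on boxes the sum of products is the
product of sums. *)
Lemma zsum_prod (g : O -> int -> R) :
  (forall c, exists M, forall N, \sum_(k <- zbox N) `|g c k| <= M) ->
  zsum (fun x => \prod_c g c (icoord x c)) = \prod_c zsum (g c) /\
  exists M, forall N, \sum_(x <- lbox d N) `|\prod_c g c (icoord x c)| <= M.
Proof.
move=> /choice[M HM].
have B N : \sum_(x <- lbox d N) `|\prod_c g c (icoord x c)| <= \prod_c M c.
  rewrite (eq_bigr (fun x => \prod_c `|g c (icoord x c)|)) => [|x _]; last by rewrite normr_prod.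
  rewrite (sum_lbox_prod N (fun c k => `|g c k|)); apply: ler_prod => c _.
  by rewrite HM andbT sumr_ge0.
split; last by exists (\prod_c M c).
apply: (zsum_unique (exhaustion_lbox d) B).
rewrite (_ : (fun N => _) = (fun N => \prod_c \sum_(k <- zbox N) g c k)); last first.
  by apply/funext => N; rewrite sum_lbox_prod.
by apply: cvg_prod => c; exact: (zsum_cvg exhaustion_zbox (HM c)).
Qed.

(** The factor that one coordinate contributes to the limit: the sum over k of
chi(u - k) times the mean of (t - u)^l over the cell from k to k + 1. *)
Definition mean_moment (l : nat) (chi : R -> R) : R :=
  \sum_(e < l.+1) 'C(l, e)%:R * moment e chi / (l - e + 1)%N%:R.

(** The polynomial cellmoment l in k - s, summed against chi, is a combination of
moments of order at most l. *)
Lemma zsum_cellmoment D l (chi : R -> R) (s : R) : tame D chi -> (l <= D)%N ->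
  (forall r, (r <= l)%N -> dmoment r chi s = moment r chi) ->
  zsum (fun k : int => chi (s - k%:~R) * cellmoment l (k%:~R - s)) = mean_moment l chi /\
  exists M, forall N, \sum_(k <- zbox N) `|chi (s - k%:~R) * cellmoment l (k%:~R - s)| <= M.
Proof.
move=> ht lD hm.
pose a (e : 'I_l.+1) (k : int) : R := ('C(l, e)%:R / (l - e + 1)%N%:R) * ((k%:~R - s) ^+ e * chi (s - k%:~R)).
have E : (fun k : int => chi (s - k%:~R) * cellmoment l (k%:~R - s)) = (fun k => \sum_(e <- index_enum 'I_l.+1) a e k).
  apply/funext => k; rewrite /cellmoment mulr_sumr; apply: eq_bigr => e _; rewrite /a; ring.
have el (e : 'I_l.+1) : (e <= l)%N by rewrite -ltnS.
have ae e : exists M, forall N, \sum_(k <- zbox N) `|a e k| <= M.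
  have [M HM] := moment_bound (leq_trans (el e) lD) ht.
  exists (`|'C(l, e)%:R / (l - e + 1)%N%:R| * M) => N.
  under eq_bigr do rewrite normrM.
  by rewrite -mulr_sumr ler_wpM2l.
have [Z1 Z2] := zsum_bigsum exhaustion_zbox (index_enum 'I_l.+1) ae.
rewrite E; split; last first.
  have [M HM] := Z2; exists M => N; apply: le_trans (HM N).
  by apply: ler_sum => k _; rewrite (congr1 (fun F => F k) E).
rewrite Z1; apply: eq_bigr => e _.
have [M HM] := moment_bound (leq_trans (el e) lD) ht.
rewrite (zsumZ exhaustion_zbox _ (HM^~ s)) -/(dmoment e chi s) hm//; ring.
Qed.

Lemma avg_cst (w : R) (a : O -> int) (C : R) : 0 < w -> avg w a (fun _ : Z => C) = C.
Proof.
move=> w0; have := avg_monomial w0 a (0 : Z) (zeroI (d := d)).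
rewrite osize0 expr0 mulr1 [RHS]big1; last first.
  by move=> c _; rewrite /cellmoment big_ord1/= expr0 subn0 bin0 mul1r divr1.
have op1 p : opow (pcoord (p - 0 : Z)) (zeroI (d := d)) = 1 by apply: big1 => c _; rewrite expr0.
move=> E; have c1 : continuous (fun _ : Z => 1 : R) by move=> p; exact: cvg_cst.
have := avg_lin w0 a C 0 c1 c1; rewrite mul0r addr0.
rewrite (_ : (fun=> 1) = (fun p : Z => opow (pcoord (p - 0)) (zeroI (d := d)))); last first.
  by apply/funext => p; rewrite op1.
by rewrite E !mulr1 addr0.
Qed.

(** Continuity of the derivatives at z, in a form homogeneous in h; the constant e
multiplies the same power of the l^1 norm as in dirpow_bound. *)
Lemma dirpow_near m (g : Z -> R) (z : Z) (e : R) : Cb_prod m g -> 0 < e ->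
  exists2 del : R, 0 < del & forall (q : Z) h, `|q - z| < del ->
   `|dirpow m g q h - dirpow m g z h| <= e * (\sum_c `|h c|) ^+ m.
Proof.
move=> + e0; elim: m g => [|m IH] g H.
  have /(@continuous_epsP R Z)/(_ z e e0)[del del0 Hd] := Cb_prod_continuous H.
  by exists del => // q h /Hd/ltW; rewrite mulr1.
have /choice[del Hd] c : exists del : R, 0 < del /\ forall (q : Z) h, `|q - z| < del ->
   `|dirpow m ('D_(dir R c) g) q h - dirpow m ('D_(dir R c) g) z h| <= e * (\sum_c `|h c|) ^+ m.
  by have [del del0 Hd] := IH _ (Cb_prod_derive c H); exists del.
exists (\big[Num.min/1]_c del c).
  by apply/bigmin_gtP; split => // c _; have [] := Hd c.
move=> q h qz; rewrite !dirpowS -sumrB; apply: (le_trans (ler_norm_sum _ _ _)).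
rewrite exprS mulrCA mulr_suml; apply: ler_sum => c _.
rewrite -mulrBr normrM ler_wpM2l//; have [_ -> //] := Hd c.
by apply: lt_le_trans qz _; exact: bigmin_le.
Qed.

End product_series.

Section main_limit.
Variables (R : realType) (d D N : nat).
Local Notation Z := (R * 'rV[R]_d)%type.
Local Notation O := (option 'I_d).
Local Notation T := (int * {ffun 'I_d -> int})%type.
Variables (chi : O -> R -> R) (G : Z -> R).
Hypothesis ND : (N < D)%N.
Hypothesis chi_tame : forall c, tame D (chi c).
Hypothesis chi_mom : forall c r u, (r <= D)%N -> dmoment r (chi c) u = moment r (chi c).
Hypothesis G_Cb : Cb_prod N.+1 G.
Implicit Types (z p : Z) (x : T).

Local Notation Ix := ('I_N.+2 * {ffun 'I_d -> 'I_N.+2})%type.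

(** The coefficients of ((p - z) . nabla)^(N+1) G(z) / (N+1)!. Extending them by 0
to all pairs of indices keeps the sum over a fixed finite type. *)
Definition top_coef z (lj : Ix) : R :=
  if (lj.1 + mdeg (mi lj.2) == N.+1)%N then
    (lj.1`! * mfact (mi lj.2))%:R^-1 * partial lj.1 (mi lj.2) G z else 0.

Definition top_idx (lj : Ix) : O -> nat := ojoin lj.1 (mi lj.2).

Lemma top_idx_le lj c : (top_idx lj c <= D)%N.
Proof.
apply: leq_trans ND; rewrite -ltnS /top_idx; case: c => [i|] /=; exact: ltn_ord.
Qed.

Lemma dirpow_top_coef z h :
  dirpow N.+1 G z h / N.+1`!%:R = \sum_(lj : Ix) top_coef z lj * opow h (top_idx lj).
Proof.
rewrite (@dirpow_partial _ _ _ N.+2 N.+2)// pair_big_dep/= big_mkcond/=.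
apply: eq_bigr => -[l j] _ /=; rewrite /top_coef /=; case: ifP => _; last by rewrite mul0r.
by rewrite /top_idx /=; ring.
Qed.

(** The limit of the rescaled series, before moments of means are expanded into
moments; see limit_valueE. *)
Definition limit_value z : R :=
  (-1) ^+ N * \sum_(lj : Ix) top_coef z lj * \prod_c mean_moment (top_idx lj c) (chi c).

(** The Taylor polynomial of G at p evaluated at z, with the derivatives in the
Lagrange remainder moved from the intermediate point to z. *)
Definition main_part z p : R :=
  G z + (-1) ^+ N * \sum_(lj : Ix) top_coef z lj * opow (pcoord (p - z)) (top_idx lj).

Definition taylor_rem z p : R := taylor N G p (pcoord (z - p)) - main_part z p.

Lemma main_sum_continuous z : continuous (fun p => \sum_(lj : Ix) top_coef z lj * opow (pcoord (p - z)) (top_idx lj)).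
Proof.
apply: (@continuous_bigsum R Z) => lj; apply: continuous_mul; first by move=> p; exact: cvg_cst.
exact: opow_continuous.
Qed.

Lemma main_part_continuous z : continuous (main_part z).
Proof.
move=> p; apply: (@continuousD R R Z); first exact: cvg_cst.
move: p; apply: continuous_mul; first by move=> p; exact: cvg_cst.
exact: main_sum_continuous.
Qed.

Lemma taylor_rem_continuous z : continuous (taylor_rem z).
Proof.
move=> p; apply: (@continuousB R R Z); last exact: main_part_continuous.
by apply: taylor_continuous; exact: Cb_prodW G_Cb.
Qed.

Lemma taylor_remE z p : exists2 xi : R, 0 <= xi <= 1 &
  taylor_rem z p = (-1) ^+ N * (dirpow N.+1 G (z + xi *: (p - z)) (pcoord (p - z)) -
      dirpow N.+1 G z (pcoord (p - z))) / N.+1`!%:R.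
Proof.
have [xi xi01 E] := taylor_Lagrange z p G_Cb.
by exists xi => //; rewrite /taylor_rem /main_part E -dirpow_top_coef; ring.
Qed.

Lemma avg_taylor_decomp w a z : 0 < w ->
  avg w a (fun p => taylor N G p (pcoord (z - p))) =
  G z + (-1) ^+ N * (\sum_(lj : Ix) top_coef z lj * avg w a (fun p => opow (pcoord (p - z)) (top_idx lj)))
  + avg w a (taylor_rem z).
Proof.
move=> w0.
rewrite (_ : (fun p => _) = (fun p => 1 * main_part z p + 1 * taylor_rem z p)); last first.
  by apply/funext => p; rewrite /taylor_rem; ring.
rewrite avg_lin//; [|exact: main_part_continuous|exact: taylor_rem_continuous].
rewrite !mul1r; congr (_ + _).
rewrite /main_part (_ : (fun p => _) = (fun p => 1 * G z + (-1) ^+ N * \sum_(lj : Ix) top_coef z lj * opow (pcoord (p - z)) (top_idx lj))); last first.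
  by apply/funext => p; rewrite mul1r.
rewrite (@avg_lin _ _ _ w0 _ (fun=> G z)); [|by move=> p; exact: cvg_cst|exact: main_sum_continuous].
rewrite mul1r avg_cst//; congr (_ + _ * _).
by apply: avg_sum => // lj; exact: opow_continuous.
Qed.

(** If |w z_c - kappa_c| < rho for every c, then the cell lies within
(1 + rho) / w of z, where the derivatives of order N + 1 are nearly constant. On
the other cells they are only bounded. The power w^(N+1) compensates the size of
the cells in cell_weight. *)
Lemma taylor_rem_bound z (e : R) : 0 < e -> exists del C : R, [/\ 0 < del, 0 <= C &
  forall (w rho : R) (x : T), 0 < w -> (1 + rho) / w < del ->
    `|w ^+ N.+1 * avg w (icoord x) (taylor_rem z)| <=
    (if [exists c, rho <= `|w * pcoord z c - (icoord x c)%:~R|] then C else e) *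
    \prod_c weight D (w * pcoord z c - (icoord x c)%:~R)].
Proof.
move=> e0.
pose B : R := d.+1%:R ^+ N.+1; have B0 : 0 < B by rewrite exprn_gt0.
have eB : 0 < e / B by rewrite divr_gt0.
have [C C0 HC] := dbound_exists G_Cb.
have [del del0 Hd] := dirpow_near z G_Cb eB.
exists del, (2 * C * B); split=> //; first by rewrite !mulr_ge0// ltW.
move=> w rho x w0 wdel.
have wN : 0 < w ^+ N.+1 by rewrite exprn_gt0.
rewrite normrM (ger0_norm (ltW wN)) -ler_pdivlMl//.
apply: (avg_bound w0); first exact: taylor_rem_continuous.
move=> p pc; have [xi /andP[xi0 xi1] ->] := taylor_remE z p.
rewrite !normrM normrX normrN1 expr1n mul1r.
have f1 : `|(N.+1`!%:R : R)^-1| <= 1.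
  by rewrite ger0_norm ?invr_ge0// invf_le1 ?ltr0n ?fact_gt0// ler1n fact_gt0.
apply: le_trans (ler_wpM2l (normr_ge0 _) f1) _; rewrite mulr1.
have hs : \sum_c `|pcoord (p - z) c| = \sum_c `|pcoord (z - p) c|.
  by apply: eq_bigr => c _; rewrite -opprB pcoordN normrN.
have cw := cell_weight z w0 ND pc.
set W := \prod_c weight D _ in cw *.
have W0 : 0 <= W by apply: prodr_ge0 => c _; exact: weight_ge0.
case: ifPn => [_|].
  apply: le_trans (ler_normB _ _) _.
  have h q : `|dirpow N.+1 G q (pcoord (p - z))| <= C * (B / w ^+ N.+1 * W).
    apply: le_trans (dirpow_bound _ _ HC) _; rewrite ler_wpM2l// hs.
    exact: cw.
  apply: le_trans (lerD (h _) (h _)) _.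
  by rewrite le_eqVlt; apply/orP; left; apply/eqP; field; rewrite gt_eqF.
rewrite negb_exists => /forallP nr.
have near1 : `|z + xi *: (p - z) - z| < del.
  rewrite addrAC subrr add0r; apply: norm_lt_pcoord => // c; rewrite pcoordZ normrM ger0_norm//.
  apply: (@le_lt_trans _ _ `|pcoord (z - p) c|).
    by rewrite -opprB pcoordN normrN ler_piMl.
  apply: le_lt_trans (cell_dist w0 z (pc c)) _; apply: le_lt_trans wdel.
  by rewrite ler_pM2r ?invr_gt0// lerD2l ltW// ltNge.
apply: le_trans (Hd _ (pcoord (p - z)) near1) _; rewrite hs.
apply: le_trans (ler_wpM2l (ltW eB) cw) _; rewrite -/B.
rewrite le_eqVlt; apply/orP; left; apply/eqP; field.
by rewrite !gt_eqF.
Qed.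

Lemma kernel_prod_cellmoment w x z (L : O -> nat) :
  kernel_prod chi w x z * \prod_c cellmoment (L c) ((icoord x c)%:~R - w * pcoord z c) =
  \prod_c (chi c (w * pcoord z c - (icoord x c)%:~R) *
           cellmoment (L c) ((icoord x c)%:~R - w * pcoord z c)).
Proof. by rewrite -big_split. Qed.

Lemma zsum_kernel_prod_moment w z (L : O -> nat) : (forall c, L c <= D)%N ->
  zsum (fun x => kernel_prod chi w x z * \prod_c cellmoment (L c) ((icoord x c)%:~R - w * pcoord z c)) =
    \prod_c mean_moment (L c) (chi c) /\
  exists M, forall n, \sum_(x <- lbox d n)
   `|kernel_prod chi w x z * \prod_c cellmoment (L c) ((icoord x c)%:~R - w * pcoord z c)| <= M.
Proof.
move=> LD.
have E := fun x => kernel_prod_cellmoment w x z L.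
have H c := zsum_cellmoment (s := w * pcoord z c) (chi_tame c) (LD c)
  (fun r rl => chi_mom c (w * pcoord z c) (leq_trans rl (LD c))).
have [Z1 [M HM]] := @zsum_prod R d (fun c k => chi c (w * pcoord z c - k%:~R) * cellmoment (L c) (k%:~R - w * pcoord z c)) (fun c => (H c).2).
split.
  rewrite (_ : (fun x => _) = (fun x => \prod_c (chi c (w * pcoord z c - (icoord x c)%:~R) *
           cellmoment (L c) ((icoord x c)%:~R - w * pcoord z c)))); last by apply/funext => x.
  by rewrite Z1; apply: eq_bigr => c _; have [-> _] := H c.
by exists M => n; apply: le_trans (HM n); apply: ler_sum => x _; rewrite E.
Qed.

Lemma mean_moment0 (g : R -> R) : mean_moment 0 g = moment 0 g.
Proof. by rewrite /mean_moment big_ord1/= bin0 subn0 mul1r divr1. Qed.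

Lemma cellmoment0 (s : R) : cellmoment 0 s = 1.
Proof. by rewrite /cellmoment big_ord1/= expr0 subn0 bin0 mul1r divr1. Qed.

(** The constant and the polynomial part of the Taylor mean are summed exactly, for
every w. The remainder is split at distance rho: e / 2 comes from the cells near
z, through the factor of taylor_rem_bound, and e / 2 from the tail beyond
rho. *)
Lemma series_limit z :
  (w ^+ N.+1 * (zsum (fun x => kernel_prod chi w x z * avg w (icoord x) (fun p => taylor N G p (pcoord (z - p))))
     - (\prod_c moment 0 (chi c)) * G z)) @[w --> +oo] --> limit_value z.
Proof.
have [Mp Mp0 HMp] := prod_weight_bound chi_tame.
apply/cvgrPdist_le => e e0.
have Mp1 : 0 < Mp + 1 by rewrite ltr_wpDl.
have e1 : 0 < e / 2 / (Mp + 1) by rewrite !divr_gt0.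
have [del [C [del0 C0 HB]]] := taylor_rem_bound z e1.
have C1 : 0 < C + 1 by rewrite ltr_wpDl.
have e2 : 0 < e / 2 / (C + 1) by rewrite !divr_gt0.
have [rho Hrho] := prod_weight_tail chi_tame e2.
near=> w.
have w0 : 0 < w by near: w; exact: nbhs_pinfty_gt.
have wdel : (1 + rho) / w < del.
  rewrite ltr_pdivrMr// mulrC -ltr_pdivrMr//.
  by near: w; apply: nbhs_pinfty_gt; exact: num_real.
pose rem x := kernel_prod chi w x z * (w ^+ N.+1 * avg w (icoord x) (taylor_rem z)).
have HR n : \sum_(x <- lbox d n) `|rem x| <= e.
  apply: (@le_trans _ _ (\sum_(x <- lbox d n) (
      (if [exists c, rho <= `|w * pcoord z c - (icoord x c)%:~R|] then
         (C + 1) * prod_weight D chi (fun c => w * pcoord z c) x else 0) +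
      e / 2 / (Mp + 1) * prod_weight D chi (fun c => w * pcoord z c) x))).
    apply: ler_sum => x _; rewrite /rem normrM.
    apply: le_trans (ler_wpM2l (normr_ge0 _) (HB w rho x w0 wdel)) _.
    rewrite mulrCA kernel_prod_weight.
    have p0 := prod_weight_ge0 D chi (fun c => w * pcoord z c) x.
    case: ifP => _; last by rewrite add0r.
    rewrite -mulrDl ler_wpM2r//; have := ltW e1; lra.
  rewrite big_split/= -big_mkcond/= -!mulr_sumr.
  rewrite [leRHS](_ : e = (C + 1) * (e / 2 / (C + 1)) + e / 2 / (Mp + 1) * (Mp + 1)); last first.
    by field; rewrite !gt_eqF.
  apply: lerD; first by rewrite ler_wpM2l ?(ltW C1)//; exact: Hrho.
  rewrite ler_wpM2l ?(ltW e1)//; apply: le_trans (HMp n _) _; lra.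
have [Z0 [M0 HM0]] := zsum_kernel_prod_moment w z (L := fun=> 0%N) (fun _ => leq0n _).
have ZL lj := zsum_kernel_prod_moment w z (top_idx_le lj).
(* The exact part of the terms: A0 comes from the constant G z, and A lj from the
   monomial of index lj, by avg_monomial. *)
pose A lj x : R := ((-1) ^+ N * top_coef z lj) * (kernel_prod chi w x z * \prod_c cellmoment (top_idx lj c) ((icoord x c)%:~R - w * pcoord z c)).
pose A0 x : R := (w ^+ N.+1 * G z) * (kernel_prod chi w x z * \prod_c cellmoment 0 ((icoord x c)%:~R - w * pcoord z c)).
have E x : w ^+ N.+1 * (kernel_prod chi w x z * avg w (icoord x) (fun p => taylor N G p (pcoord (z - p)))) =
    (A0 x + \sum_(lj : Ix) A lj x) + rem x.
  have A0E : A0 x = w ^+ N.+1 * G z * kernel_prod chi w x z.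
    by rewrite /A0 big1 ?mulr1// => c _; exact: cellmoment0.
  rewrite (avg_taylor_decomp _ _ w0) /rem A0E.
  have -> : \sum_(lj : Ix) A lj x = (-1) ^+ N * kernel_prod chi w x z * (w ^+ N.+1 *
     \sum_(lj : Ix) top_coef z lj * avg w (icoord x) (fun p => opow (pcoord (p - z)) (top_idx lj))).
    rewrite !mulr_sumr; apply: eq_bigr => lj _; rewrite /A.
    have [h|h] := boolP (lj.1 + mdeg (mi lj.2) == N.+1)%N; last first.
      by rewrite /top_coef (negbTE h); ring.
    have os : osize (top_idx lj) = N.+1 by rewrite osizeE /=; apply/eqP.
    by rewrite -(avg_monomial w0) os; ring.
  ring.
have bA lj : exists M, forall n, \sum_(x <- lbox d n) `|A lj x| <= M.
  have [_ [M HM]] := ZL lj; exists (`|(-1) ^+ N * top_coef z lj| * M) => n.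
  rewrite (eq_bigr (fun x => `|(-1) ^+ N * top_coef z lj| * `|kernel_prod chi w x z * \prod_c cellmoment (top_idx lj c) ((icoord x c)%:~R - w * pcoord z c)|)) => [|x _]; last by rewrite normrM.
  by rewrite -mulr_sumr ler_wpM2l.
have bA0 : exists M, forall n, \sum_(x <- lbox d n) `|A0 x| <= M.
  exists (`|w ^+ N.+1 * G z| * M0) => n.
  rewrite (eq_bigr (fun x => `|w ^+ N.+1 * G z| * `|kernel_prod chi w x z * \prod_c cellmoment 0 ((icoord x c)%:~R - w * pcoord z c)|)) => [|x _]; last by rewrite normrM.
  by rewrite -mulr_sumr ler_wpM2l.
have [SA [MA HMA]] := zsum_bigsum (exhaustion_lbox d) (index_enum Ix) bA.
have [MA0 HMA0] := bA0.
have HM1 n : \sum_(x <- lbox d n) `|A0 x + \sum_(lj : Ix) A lj x| <= MA0 + MA.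
  apply: le_trans (lerD (HMA0 n) (HMA n)); rewrite -big_split.
  by apply: ler_sum => x _; exact: ler_normD.
have wN0 : w ^+ N.+1 != 0 by rewrite expf_neq0 ?gt_eqF.
have HMw n : \sum_(x <- lbox d n) `|kernel_prod chi w x z * avg w (icoord x) (fun p => taylor N G p (pcoord (z - p)))| <=
   `|w ^+ N.+1|^-1 * (MA0 + MA + e).
  apply: le_trans (ler_wpM2l _ (lerD (HM1 n) (HR n))); last by rewrite invr_ge0.
  rewrite -big_split mulr_sumr; apply: ler_sum => x _ /=.
  rewrite ler_pdivlMl ?normr_gt0// -normrM E; exact: ler_normD.
rewrite mulrBr -(zsumZ (exhaustion_lbox d) _ HMw).
rewrite (_ : (fun x => w ^+ N.+1 * _) = (fun x => (A0 x + \sum_(lj : Ix) A lj x) + rem x)); last first.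
  by apply/funext => x; exact: E.
rewrite (zsumD (exhaustion_lbox d) HM1 HR) (zsumD (exhaustion_lbox d) HMA0 HMA) SA.
rewrite {1}/A0 (zsumZ (exhaustion_lbox d) _ HM0) Z0.
have -> : \prod_c mean_moment 0 (chi c) = \prod_c moment 0 (chi c).
  by apply: eq_bigr => c _; exact: mean_moment0.
have -> : \sum_(lj : Ix) zsum (A lj) = limit_value z.
  rewrite /limit_value mulr_sumr; apply: eq_bigr => lj _; have [h [M HM]] := ZL lj.
  by rewrite /A (zsumZ (exhaustion_lbox d) _ HM) h mulrA.
set P := \prod_c moment 0 (chi c).
rewrite (_ : limit_value z - _ = - zsum rem); last by ring.
rewrite normrN; exact: (zsum_le (exhaustion_lbox d) HR).
Unshelve. all: by end_near.
Qed.

End main_limit.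

Lemma cvg_bigsum (R : realType) (I : Type) (r : seq I) (P : pred I)
  (F : set_system R) {FF : Filter F} (u : I -> R -> R) (l : I -> R) :
  (forall i, P i -> u i w @[w --> F] --> l i) ->
  \sum_(i <- r | P i) u i w @[w --> F] --> \sum_(i <- r | P i) l i.
Proof.
move=> ul; elim: r => [|i r IH].
  rewrite big_nil (_ : (fun _ => _) = cst 0); first exact: cvg_cst.
  by apply/funext => w; rewrite big_nil.
rewrite big_cons; case: ifPn => Pi.
  rewrite (_ : (fun _ => _) = (fun w => u i w + \sum_(j <- r | P j) u j w)).
    by apply: cvgD => //; exact: ul.
  by apply/funext => w; rewrite big_cons Pi.
rewrite (_ : (fun _ => _) = (fun w => \sum_(j <- r | P j) u j w))//.
by apply/funext => w; rewrite big_cons (negbTE Pi).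
Qed.

Lemma cvg_pinfty_eq (R : realType) (u v : R -> R) (l : R) :
  (forall w, 0 < w -> u w = v w) ->
  v w @[w --> +oo] --> l -> u w @[w --> +oo] --> l.
Proof.
move=> uv; apply: cvg_trans; apply: near_eq_cvg; near=> w.
by apply/esym/uv; near: w; exact: nbhs_pinfty_gt.
Unshelve. all: by end_near.
Qed.

(** * Collecting the Leibniz terms *)

Section target.
Variables (R : realType) (d : nat).
Local Notation Z := (R * 'rV[R]_d)%type.
Local Notation O := (option 'I_d).

Lemma partial_dpart (f : Z -> R) m l (j : 'I_d -> nat) I :
  Cb_prod m f -> (l + mdeg j + osize I <= m)%N ->
  partial l j (dpart I f) = partial (l + I None)%N (fun i => j i + I (Some i))%N f.
Proof.
move=> H lm; rewrite /dpart /partial -pderivs_cat (pderivs_dpart H); last first.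
  by rewrite size_cat !size_coords -osizeE.
by rewrite cnt_cat !cnt_coords.
Qed.

Lemma mean_moment_widen (g : R -> R) l M : (l < M)%N ->
  mean_moment l g = \sum_(e < M | (e <= l)%N) 'C(l, e)%:R * (moment e g / (l - e + 1)%N%:R).
Proof.
move=> lM; rewrite /mean_moment (big_ord_widen_cond M predT (fun e => 'C(l, e)%:R * moment e g / (l - e + 1)%N%:R))//.
by apply: eq_big => e //=; rewrite mulrA.
Qed.

Lemma prod_mean_moment (g : 'I_d -> R -> R) (j : 'I_d -> nat) M : (forall i, j i < M)%N ->
  \prod_i mean_moment (j i) (g i) =
  \sum_(e : {ffun 'I_d -> 'I_M} | mle (mi e) j)
    mbin R j (mi e) * \prod_i (moment (e i) (g i) / (j i - e i + 1)%N%:R).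
Proof.
move=> jM; rewrite (eq_bigr (fun i => \sum_(e < M | (e <= j i)%N) 'C(j i, e)%:R * (moment e (g i) / (j i - e + 1)%N%:R))); last first.
  by move=> i _; exact: mean_moment_widen.
rewrite bigA_distr_big_dep/=; apply: eq_big => e.
  by rewrite /mle; apply/familyP/forallP.
by move=> /familyP h; rewrite big_split/= mbinE//; apply/forallP => i; exact: h.
Qed.

Lemma limit_valueE N (chi : O -> R -> R) (G : Z -> R) z :
  limit_value N chi G z =
  \sum_(l < N.+2) \sum_(j : {ffun 'I_d -> 'I_N.+2} | (l + mdeg (mi j) == N + 1)%N)
    ((-1) ^+ N / (l`! * mfact (mi j))%:R) *
    \sum_(c < l.+1) \sum_(e : {ffun 'I_d -> 'I_N.+2} | mle (mi e) (mi j))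
      'C(l, c)%:R * mbin R (mi j) (mi e) *
      (moment c (chi None) / (l - c + 1)%N%:R) *
      (\prod_i (moment (e i) (chi (Some i)) / (j i - e i + 1)%N%:R)) *
      partial l (mi j) G z.
Proof.
rewrite /limit_value mulr_sumr pair_big_dep/= [RHS]big_mkcond/=; apply: eq_bigr => -[l j] _ /=.
rewrite /top_coef /= addn1; case: ifP => _; last by rewrite mul0r mulr0.
rewrite mulrA [(-1) ^+ N * _]mulrA -!mulrA; congr (_ * (_ * _)).
rewrite big_option /= (prod_mean_moment (M := N.+2) (fun i => chi (Some i)) (j := mi j)); last first.
  by move=> i; exact: ltn_ord.
rewrite /mean_moment mulr_suml mulr_sumr; apply: eq_bigr => c _.
rewrite mulr_sumr mulr_sumr; apply: eq_bigr => e _.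
by rewrite /mi; ring.
Qed.

End target.

Section assembly.
Variables (R : realType) (d n : nat).
Local Notation Z := (R * 'rV[R]_d)%type.
Local Notation O := (option 'I_d).
Variables (chi : O -> R -> R) (f : Z -> R).
Hypothesis chi_tame : forall c a, (a <= n)%N -> tame n.+1 ((chi c)^`(a)).
Hypothesis chi_mom : forall c a r u, (a <= n)%N -> (r <= n.+1)%N ->
  dmoment r ((chi c)^`(a)) u = moment r ((chi c)^`(a)).
Hypothesis chi_mom0 : forall c a, (a <= n)%N -> moment 0 ((chi c)^`(a)) = (a == 0%N)%:R.
Hypothesis f_Cb : Cb_prod n.+1 f.
Implicit Types (J I : O -> nat) (z : Z).

(** Only the term without derivatives of kernels has a nonzero moment of order 0;
this is why subtracting the derivative of f compensates all the Leibniz terms at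
once. *)
Lemma prod_moment0 J : (osize J <= n)%N ->
  \prod_c moment 0 (deriv_family chi J c) = delta R (zeroI (d := d)) J.
Proof.
move=> Jn; rewrite (eq_bigr (fun c => (J c == 0%N)%:R)); last first.
  by move=> c _; rewrite chi_mom0// (leq_trans (leq_osize J c)).
rewrite deltaP; case: eqP => [<-|/eqP J0]; first by rewrite big1.
have [c Jc] : exists c, J c != 0%N.
  apply/existsP; apply: contraNT J0; rewrite negb_exists => /forallP H.
  by apply/eqP/funext => c; rewrite (eqP (negPn (H c))).
by rewrite (bigD1 c)//= (negbTE Jc) mul0r.
Qed.

Lemma opseriesE w J I z : 0 < w -> (osize J <= n)%N -> (osize I <= n)%N ->
  opseries n chi f w J I z = w ^+ osize J *
  zsum (fun x => kernel_prod (deriv_family chi J) w x z *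
     avg w (icoord x) (fun p => taylor (n - osize I) (dpart I f) p (pcoord (z - p)))).
Proof.
move=> w0 Jn In; have [M HM] := series_term_summable chi_tame f_Cb z w0 Jn In.
have wJ : w ^+ osize J != 0 by rewrite expf_neq0 ?gt_eqF.
rewrite (_ : (fun x => _) = (fun x => (w ^+ osize J)^-1 * series_term n chi f w J I x z)).
  by rewrite (zsumZ (exhaustion_lbox d) _ HM) mulrA divff// mul1r.
by apply/funext => x; rewrite /series_term -[X in _ = _ * X]mulrA [RHS]mulrA mulVf// mul1r.
Qed.

(** The exponent k + 1 of the normalization and the power of w from the kernel
derivatives add up to n - |I| + 1, the order at which the Taylor remainder
appears. *)
Lemma opseries_limit J I z k : (osize J + osize I + k = n)%N ->
  w ^+ (k + 1) * (opseries n chi f w J I z - delta R (zeroI (d := d)) J * dpart I f z)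
    @[w --> +oo] --> limit_value (n - osize I) (deriv_family chi J) (dpart I f) z.
Proof.
move=> JIk; have Jn : (osize J <= n)%N by lia.
have In : (osize I <= n)%N by lia.
have Jc c : (J c <= n)%N by exact: leq_trans (leq_osize J c) Jn.
have ND : (n - osize I < n.+1)%N by lia.
have GC : Cb_prod (n - osize I).+1 (dpart I f) by apply: (Cb_dpart f_Cb); lia.
have L := series_limit ND (fun c => chi_tame c (Jc c)) (fun c r u => chi_mom c u (Jc c)) GC (z := z).
apply: cvg_pinfty_eq L => w w0.
rewrite prod_moment0// opseriesE//.
rewrite (_ : (n - osize I).+1 = (k + 1 + osize J))%N; last by lia.
rewrite [w ^+ (k + 1 + osize J)]exprD -[RHS]mulrA; congr (_ * _).
have [J0|J0] := eqVneq J (zeroI (d := d)); first by rewrite J0 osize0 expr0 !mul1r.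
by rewrite deltaP eq_sym (negbTE J0) !mul0r !subr0.
Qed.

End assembly.

Theorem theorem6 (R : realType) (d n : nat) (hd : (1 <= d)%N)
  (phi : R -> R) (psi : 'I_d -> R -> R)
  (phi_Cb : Cb_real n phi) (psi_Cb : forall i, Cb_real n (psi i))
  (phi_kernel : kernel_of_order n.+1 phi)
  (psi_kernel : forall i, kernel_of_order n.+1 (psi i))
  (phi_moment : forall r, (r <= n.+1)%N -> const_moment r phi)
  (psi_moment : forall i r, (r <= n.+1)%N -> const_moment r (psi i))
  (phi_unif : forall l, (1 <= l <= n)%N -> unif_conv n.+1 (phi^`(l)))
  (psi_unif : forall i l, (1 <= l <= n)%N -> unif_conv n.+1 ((psi i)^`(l)))
  (p : nat) (q : 'I_d -> nat) (hpq : (p + mdeg q <= n)%N)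
  (f : R * 'rV[R]_d -> R) (f_Cb : Cb_prod n.+1 f) :
  (forall w : R, 0 < w -> pderivable (coords p q) (kantorovich n phi psi w f)) /\
  forall (x : R) (y : 'rV[R]_d),
    (w ^+ (n - (p + mdeg q) + 1) *
       (partial p q (kantorovich n phi psi w f) (x, y) - partial p q f (x, y)))
      @[w --> +oo]
    -->
    \sum_(a < p.+1)
    \sum_(b : {ffun 'I_d -> 'I_(mdeg q).+1} | mle (mi b) q)
      let N := (n - (p + mdeg q - a - mdeg (mi b)))%N in
      'C(p, a)%:R * mbin R q (mi b) *
      \sum_(l < N.+2)
      \sum_(j : {ffun 'I_d -> 'I_N.+2} | (l + mdeg (mi j) == N + 1)%N)
        ((-1) ^+ N / (l`! * mfact (mi j))%:R) *
        \sum_(c < l.+1)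
        \sum_(e : {ffun 'I_d -> 'I_N.+2} | mle (mi e) (mi j))
          'C(l, c)%:R * mbin R (mi j) (mi e) *
          (moment c (phi^`(a))%classic / (l - c + 1)%N%:R) *
          (\prod_i (moment (e i) ((psi i)^`(b i))%classic / (j i - e i + 1)%N%:R)) *
          partial (l + p - a) (fun i => mi j i + q i - mi b i)%N f (x, y).
Proof.
pose chi := kernel_family phi psi.
have hder c a (t : R) : (a < n)%N ->
    is_derive t (1:R) ((chi c)^`(a))%classic (((chi c)^`(a.+1))%classic t).
  move=> an; case: c => [i|]; [exact: (kernel_is_derive (psi_Cb i))|exact: (kernel_is_derive phi_Cb)].
have htame c a : (a <= n)%N -> tame n.+1 ((chi c)^`(a))%classic.
  move=> an; case: c => [i|].
    exact: (kernel_tame (psi_Cb i) (psi_kernel i) (psi_unif i)).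
  exact: (kernel_tame phi_Cb phi_kernel phi_unif).
have hmom c a r u : (a <= n)%N -> (r <= n.+1)%N ->
    dmoment r ((chi c)^`(a))%classic u = moment r ((chi c)^`(a))%classic.
  move=> an rn; case: c => [i|].
    exact: (dmoment_kernel (psi_Cb i) (psi_kernel i) (psi_moment i) (psi_unif i)).
  exact: (dmoment_kernel phi_Cb phi_kernel phi_moment phi_unif).
have hmom0 c a : (a <= n)%N -> moment 0 ((chi c)^`(a))%classic = (a == 0%N)%:R.
  move=> an; case: c => [i|].
    exact: (moment0_kernel (psi_Cb i) (psi_kernel i) (psi_moment i) (psi_unif i)).
  exact: (moment0_kernel phi_Cb phi_kernel phi_moment phi_unif).
pose s := coords p q.
have ss : (size s <= n)%N by rewrite size_coords.
have cs : cnt s = ojoin p q by exact: cnt_coords.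
have KE w : 0 < w -> kantorovich n phi psi w f = opseries n chi f w (zeroI (d := d)) (zeroI (d := d)).
  by move=> w0; apply/funext => z; apply: kantorovich_opseries => // c; exact: (htame c 0%N).
have PD w (w0 : 0 < w) := opseries_pderivs hder htame f_Cb w0 ss.
split; first by move=> w w0; rewrite KE//; have [] := PD w w0.
move=> x y; set z := (x, y).
have qi i : (q i < (mdeg q).+1)%N by rewrite ltnS /mdeg (bigD1 i)//= leq_addr.
pose I_ J := subI (cnt s) J.
(* One and the same binomial sum over J gives the derivative of the operator, by
   leibniz2E, and that of f, where the delta leaves only J = 0. *)
apply: (@cvg_pinfty_eq _ _ (fun w => \sum_(a < p.+1)
    \sum_(b : {ffun 'I_d -> 'I_(mdeg q).+1} | mle (mi b) q)
     'C(p, a)%:R * mbin R q (mi b) * (w ^+ (n - (p + mdeg q) + 1) *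
        (opseries n chi f w (ojoin a (mi b)) (I_ (ojoin a (mi b))) z -
         delta R (zeroI (d := d)) (ojoin a (mi b)) * dpart (I_ (ojoin a (mi b))) f z)))) => [w w0|].
  rewrite -(leibniz_closed (fun J => w ^+ (n - (p + mdeg q) + 1) *
    (opseries n chi f w J (I_ J) z - delta R (zeroI (d := d)) J * dpart (I_ J) f z)) cs qi).
  rewrite leibniz_scale; congr (_ * _).
  have EL : leibniz s (fun J => opseries n chi f w J (I_ J) z) = partial p q (kantorovich n phi psi w f) z.
    by rewrite /partial KE// (PD w w0).2 leibniz2E.
  have EF : leibniz s (fun J => delta R (zeroI (d := d)) J * dpart (I_ J) f z) = partial p q f z.
    rewrite leibniz_delta0 /I_ cs /dpart /subI /=; congr (partial _ _ _ _); first by rewrite subn0.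
    by apply/funext => i; rewrite subn0.
  rewrite (leibniz_supp (psi := fun J => opseries n chi f w J (I_ J) z + (-1) * (delta R (zeroI (d := d)) J * dpart (I_ J) f z))).
    by rewrite leibniz_add leibniz_scale EL EF mulN1r.
  by move=> J _; rewrite mulN1r.
apply: cvg_bigsum => a _; apply: cvg_bigsum => b bq.
set N := (n - (p + mdeg q - a - mdeg (mi b)))%N; apply: cvgM; first exact: cvg_cst.
have ap : (a <= p)%N by rewrite -ltnS.
have bqi i : (mi b i <= q i)%N by exact: (forallP bq).
have qE : mdeg q = (mdeg (mi b) + mdeg (fun i => q i - mi b i))%N.
  by rewrite /mdeg -big_split/=; apply: eq_bigr => i _; rewrite subnKC.
have IE : I_ (ojoin a (mi b)) = ojoin (p - a) (fun i => q i - mi b i)%N.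
  by rewrite /I_ cs; apply/funext => -[i|].
have oI : osize (I_ (ojoin a (mi b))) = (p - a + mdeg (fun i => q i - mi b i))%N.
  by rewrite IE osizeE.
have oJ : osize (ojoin a (mi b)) = (a + mdeg (mi b))%N by rewrite osizeE.
have NE : (n - osize (I_ (ojoin a (mi b))))%N = N by rewrite oI /N; lia.
have JI : (osize (ojoin a (mi b)) + osize (I_ (ojoin a (mi b))) + (n - (p + mdeg q)) = n)%N.
  by rewrite oI oJ; lia.
have H := opseries_limit htame hmom hmom0 f_Cb JI (z := z).
rewrite NE in H; rewrite (_ : \sum_(l < N.+2) _ =
  limit_value N (deriv_family chi (ojoin a (mi b))) (dpart (I_ (ojoin a (mi b))) f) z) //.
rewrite limit_valueE.
apply: eq_bigr => l _; apply: eq_bigr => j /eqP lj; congr (_ * _).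
apply: eq_bigr => c _; apply: eq_bigr => e _; congr (_ * _).
rewrite (partial_dpart f_Cb); last by rewrite lj oI; lia.
rewrite IE /= addnBA//; congr (partial _ _ _ _).
by apply/funext => i; rewrite addnBA.
Qed.
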